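(* Let $m\ge 1$ be a fixed integer. For each $n$ let $p=p_n>n$ and let $Y_1,\dots,Y_n$ be i.i.d. random vectors in $\mathbb{R}^p$ with mean zero and covariance matrix $\Sigma$, with eigenvalues $\lambda_1,\dots,\lambda_p$ in descending order and spectral decomposition $\Sigma=\Gamma\Lambda\Gamma'$, $\Lambda=\mathrm{diag}(\lambda_1,\dots,\lambda_p)$ ($p,\Sigma,\lambda_j$ may depend on $n$). Assume there are constants $c_0,C_0,\delta_0>0$ and $\bar c$, independent of $n$, such that: (a) $\lambda_1>\lambda_2>\dots>\lambda_m>\lambda_{m+1}\ge\dots\ge\lambda_p>0$, $c_0\le\lambda_j\le C_0$ for all $j>m$, and $\min_{j\le m}(\lambda_j-\lambda_{j+1})/\lambda_j\ge\delta_0$; (b) for $1\le j\le m$, $c_j:=p/(n\lambda_j)$ is bounded, and $(p-m)^{-1}\sum_{j=m+1}^p\lambda_j=\bar c+o(n^{-1/2})$; (c) the standardized vectors $\Lambda^{-1/2}\Gamma'Y_i$, $i=1,\dots,n$, are i.i.d. copies of a random vector $Z=(Z_1,\dots,Z_p)$ with independent sub-Gaussian entries of mean zero and variance one and $\max_j\|Z_j\|_{\psi_2}\le C_0$. Let $\hat\lambda_1\ge\hat\lambda_2\ge\cdots$ be the eigenvalues of the sample covariance matrix $\hat\Sigma$. Then, as $n\to\infty$, $\hat\lambda_1,\dots,\hat\lambda_m$ have independent limiting distributions, and for each $j=1,\dots,m$, $$\sqrt n\Big\{\frac{\hat\lambda_j}{\lambda_j}-\Big(1+\bar c\,c_j+O_P\big(\lambda_j^{-1}\sqrt{p/n}\big)\Big)\Big\}\overset{d}{\Rightarrow}N(0,\kappa_j-1),$$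 where $\kappa_j$ is the kurtosis of the $j$-th coordinate $X_j$ of $\Gamma'Y_1$.
   Context: All limits are as $n\to\infty$. $X_i=\Gamma'Y_i$, so $\mathrm{var}(X_i)=\Lambda$; $X=(X_1,\dots,X_n)'$ is the $n\times p$ transformed data matrix and $\hat\Sigma=n^{-1}X'X$ (its eigenvalues coincide with those of $n^{-1}\sum_i Y_iY_i'$). The sub-Gaussian norm is $\|\zeta\|_{\psi_2}=\sup_{q\ge1}q^{-1/2}(E|\zeta|^q)^{1/q}$. The kurtosis of $X_j=\sqrt{\lambda_j}Z_j$ is $\kappa_j=E[Z_j^4]$. Convention: for random vectors, $a=b+O_P(\delta)$ means $\|a-b\|=O_P(\delta)$, and $a=b+o_P(\delta)$ means $\|a-b\|=o_P(\delta)$. $a\overset{d}{\Rightarrow}\mathcal L$ means there exists $b\sim\mathcal L$ with $a=b+o_P(1)$. An $O_P(\cdot)$ term appearing inside a displayed limit stands for some random quantity of that order (i.e. the statement holds for some such random quantity). ''Independent limiting distributions'' means that the standardized quantities for $j=1,\dots,m$ are jointly asymptotically independent. *)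

(* Defs.v *)
From HB Require Import structures.
From mathcomp Require Import all_boot all_order all_algebra.
From mathcomp Require Import all_classical all_reals all_analysis.

Set Implicit Arguments.
Unset Strict Implicit.
Unset Printing Implicit Defensive.
Import Order.TTheory GRing.Theory Num.Theory.
Import numFieldNormedType.Exports.

Local Open Scope classical_set_scope.
Local Open Scope ring_scope.

(* The sigma-algebra on matrices (in particular on column vectors) generated by
   the entries, i.e. the product Borel sigma-algebra. *)
Section measurable_matrix.
Variables (R : realType) (p q : nat).

Definition mx_cylinders : set (set 'M[R]_(p, q)) :=
  [set C | exists (i : 'I_p) (j : 'I_q) (B : set R),
    measurable B /\ C = [set M : 'M[R]_(p, q) | B (M i j)]].

Let measurable_mx0 : <<s mx_cylinders >> set0.
Proof. exact: sigma_algebra0. Qed.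

Let measurable_mxC A : <<s mx_cylinders >> A -> <<s mx_cylinders >> (~` A).
Proof. exact: sigma_algebraC. Qed.

Let measurable_mx_bigcup (F : (set 'M[R]_(p, q))^nat) :
  (forall i, <<s mx_cylinders >> (F i)) ->
  <<s mx_cylinders >> (\bigcup_i F i).
Proof. exact: sigma_algebra_bigcup. Qed.

HB.instance Definition _ := @isMeasurable.Build (sigma_display mx_cylinders)
  'M[R]_(p, q) <<s mx_cylinders >>
  measurable_mx0 measurable_mxC measurable_mx_bigcup.

End measurable_matrix.

(* Since I is finite and A i may be the whole space, the product rule for the
   full family contains the product rule for every subfamily. *)
Definition independent_family (R : realType) (d : measure_display)
    (T : measurableType d) (P : probability T R) (I : finType)
    (d' : measure_display) (U : measurableType d') (X : I -> T -> U) : Prop :=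
  forall A : I -> set U, (forall i, measurable (A i)) ->
    P [set w | forall i, A i (X i w)] =
    (\prod_(i : I) fine (P (X i @^-1` A i)))%:E.

Definition same_law (R : realType) (d1 d2 : measure_display)
    (T1 : measurableType d1) (P1 : probability T1 R)
    (T2 : measurableType d2) (P2 : probability T2 R)
    (d' : measure_display) (U : measurableType d')
    (X1 : T1 -> U) (X2 : T2 -> U) : Prop :=
  forall A : set U, measurable A -> P1 (X1 @^-1` A) = P2 (X2 @^-1` A).

Definition iid (R : realType) (d : measure_display)
    (T : measurableType d) (P : probability T R) (I : finType)
    (d' : measure_display) (U : measurableType d') (X : I -> T -> U) : Prop :=
  independent_family P X /\ forall i k, same_law P P (X i) (X k).

(* normal_prob m s takes the standard deviation s and is a placeholder (a
   uniform law) at s = 0; N(mu, 0) is the Dirac mass at mu. *)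
Definition normal_law (R : realType) (mu v : R) : set R -> \bar R :=
  if v == 0 then \d_mu else normal_prob mu (Num.sqrt v).

(* sup_(q >= 1) q^(-1/2) (E |X|^q)^(1/q) *)
Definition psi2_norm (R : realType) (d : measure_display)
    (T : measurableType d) (P : probability T R) (X : T -> R) : \bar R :=
  ereal_sup [set ((q `^ (- 2^-1))%:E * 'N[P]_(q%:E)[EFin \o X])%E
            | q in [set q : R | 1 <= q]].

(* Kurtosis of a standardized (mean zero, variance one) random variable. *)
Definition kurtosis (R : realType) (d : measure_display)
    (T : measurableType d) (P : probability T R) (X : T -> R) : R :=
  fine ('E_P[(fun w => X w ^+ 4)%R])%E.

(* The eigenvalues, with multiplicity, in descending order, of a matrix whose
   characteristic polynomial splits over R (e.g. a symmetric matrix); the junk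
   value [::] is used otherwise. *)
Definition eigvals (R : realType) (p : nat) (A : 'M[R]_p) : seq R :=
  xget [::] [set s : seq R | sorted >=%R s /\
                   char_poly A = \prod_(x <- s) ('X - x%:P)].

(* n^-1 X'X, where the rows of X are the transposes of x_1, ..., x_n. *)
Definition sample_cov (R : realType) (n p : nat) (x : 'I_n -> 'cV[R]_p) :
    'M[R]_p :=
  let X := \matrix_(i < n, j < p) x i j 0 in n%:R^-1 *: (X^T *m X).

Definition lead_idx (m p : nat) (mp : (m < p)%N) (j : 'I_m) : 'I_p :=
  widen_ord (ltnW mp) j.

Definition enorm (R : realType) (m : nat) (x : 'cV[R]_m) : R :=
  Num.sqrt (\sum_(j < m) x j 0 ^+ 2).

Section asymptotics.
Variables (R : realType) (d : nat -> measure_display).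
Variables (T : forall n, measurableType (d n)).
Variables (P : forall n, probability (T n) R).

Definition is_OP (a : forall n, T n -> R) (delta : nat -> R) : Prop :=
  forall eps : R, 0 < eps -> exists M : R,
    \forall n \near \oo,
      (P n [set w | (M * delta n < `|a n w|)%R] <= eps%:E)%E.

Definition is_oP (a : forall n, T n -> R) (delta : nat -> R) : Prop :=
  forall eps : R, 0 < eps ->
    P n [set w | (eps * delta n < `|a n w|)%R] @[n --> \oo] --> 0%E.

End asymptotics.

(* a => L in the sense a = b + o_P(1) with b ~ L, jointly for the m coordinates,
   where L is the product of the laws N(0, v n j), j < m (v may depend on n).
   T n may be too small to carry a Gaussian variable (it may be finite), so b is
   defined on an extension T' n of the probability space, i.e. a probability
   space with a measure-preserving map pi n onto T n. *)
Definition asymp_indep_normal (R : realType) (m : nat)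
    (d : nat -> measure_display) (T : forall n, measurableType (d n))
    (P : forall n, probability (T n) R)
    (a : forall n, T n -> 'cV[R]_m) (v : nat -> 'I_m -> R) : Prop :=
  exists (d' : nat -> measure_display) (T' : forall n, measurableType (d' n))
    (P' : forall n, probability (T' n) R)
    (pi : forall n, {mfun T' n >-> T n})
    (b : forall n, {RV (P' n) >-> 'cV[R]_m}),
  [/\ forall n (A : set (T n)), measurable A -> P' n (pi n @^-1` A) = P n A,
      forall n, independent_family (P' n) (fun (j : 'I_m) w => b n w j 0),
      forall n (j : 'I_m) (B : set R), measurable B ->
        P' n [set w | B (b n w j 0)] = normal_law 0 (v n j) B
    & is_oP P' (fun n w => enorm (a n (pi n w) - b n w)) (fun=> 1)].

(* Main.v *)
(** Let [z] be the matrix of standardized entries, [G] the Gram matrix of its [m]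
    leading columns divided by [sqrt n], and [t = n^-1 sum_(k >= m) lam_k].  The
    nonzero eigenvalues of the sample covariance are those of an [n x n] Gram
    matrix, which is [sum_(j < m) lam_j y_j y_j^T + t I + noise].  Testing the
    min-max principle on the span of the leading [y_j] and on its complement gives
    [|lamhat_j - lam_j G_jj - t| <= theta + C lam_j eta^2], where [theta] is the
    operator norm of the noise and [eta] the largest entry of [G - I].  A net
    argument with sub-Gaussian moment generating functions gives
    [theta = O_P (sqrt (p / n))], and [eta^2 = o_P (n^(-1/2))] by Chebyshev's
    inequality.  So [Rem] may be chosen as the part of
    [lamhat_j / lam_j - G_jj - t / lam_j] exceeding a deterministic
    [o (n^(-1/2))], and what remains is [sqrt n (G_jj - 1)], a normalized sum [W]
    of i.i.d. variables.

    Lindeberg's replacement argument, applied to Gaussian distribution functions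
    instead of smooth test functions, bounds the distance between the
    distribution function [F] of [W + sigma g] and a Gaussian one, for an
    auxiliary standard Gaussian [g] and [sigma = n^(-1/8)].  As [F] is continuous
    and strictly increasing, [Phi^-1 (F (W + sigma g))] is exactly Gaussian, and it
    is close to the standardized [W].  The [m] couplings use disjoint columns of
    [z] and independent [g], hence are independent. *)
Require Import Defs.
From HB Require Import structures.
From mathcomp Require Import all_boot all_order all_algebra.
From mathcomp Require Import all_classical all_reals all_analysis.
From mathcomp Require Import measurable_realfun ring lra.

Set Implicit Arguments.
Unset Strict Implicit.
Unset Printing Implicit Defensive.
Import Order.TTheory GRing.Theory Num.Theory.
Import numFieldNormedType.Exports.

Local Open Scope classical_set_scope.
Local Open Scope ring_scope.

(** * Independence of blocks *)

(** The entries of [G - I] are of order [n^(-1/2)], the size of the fluctuation itself, so an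
    eigenvalue bound linear in [eta] would be useless. The relative gap makes the off-diagonal
    entries act to second order only: weighted AM-GM splits a cross term [eta a_j a_l] into a
    multiple of [eta^2 a_j^2] and a fraction of [a_l^2] that the gap absorbs. Errors are kept
    relative to [lam_j], since the spikes may diverge.

    The limit law may vary with [n] and the law of [W] may have atoms, so an explicit coupling for
    each [n], with bounds uniform in [n], takes the place of a weak limit. Besides making [F]
    invertible, smoothing turns the indicator of a half-line into [gcdf ((y - u) / r)], and adding
    an independent Gaussian of variance [v] to [u] just changes [r] into [sqrt (r^2 + v)]. The
    replacement argument therefore never introduces the replacing variables. Its error is of order
    [1 / (sqrt n sigma^3) + 1 / (n sigma^4)]; with [sigma = n^(-1/8)] this is at most of order
    [n^(-1/8)], the same as the cost [sigma] of the smoothing. *)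

Section generated_sigma.
Context {d} {T : measurableType d} {R : realType}.

(** A pi-system generating the sigma-algebra of the [X i] with [i] in [J]. Measurability with
    respect to this sub-sigma-algebra is expressed by giving the domain the type
    [g_sigma_algebraType (gen_sys J X)], so that the usual closure lemmas for measurable functions
    apply. *)
Definition gen_sys (I : Type) (J : set I) (X : I -> T -> R) : set (set T) :=
  [set A | exists B : I -> set R, (forall i, measurable (B i)) /\
     A = [set w | forall i, J i -> B i (X i w)]].

Lemma gen_sys_setI (I : Type) (J : set I) (X : I -> T -> R) :
  setI_closed (gen_sys J X).
Proof.
move=> _ _ [B1 [mB1 ->]] [B2 [mB2 ->]].
exists (fun i => B1 i `&` B2 i); split; first by move=> i; exact: measurableI.
apply/seteqP; split => [w [h1 h2] i Ji|w h]; first by split; [exact: h1|exact: h2].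
by split => i Ji; case: (h i Ji).
Qed.

Lemma gen_sys_measurable (I : finType) (J : set I) (X : I -> T -> R) :
  (forall i, measurable_fun setT (X i)) ->
  forall A, gen_sys J X A -> measurable A.
Proof.
move=> mX _ [B [mB ->]].
rewrite (_ : [set _ | _] = \bigcap_(i in J) (X i @^-1` B i)).
  apply: fin_bigcap_measurable => [|i _]; first exact: finite_finset.
  by rewrite -[_ @^-1` _]setTI; apply: mX.
by apply/seteqP; split.
Qed.

Lemma gen_sigma_measurable (I : finType) (J : set I) (X : I -> T -> R) :
  (forall i, measurable_fun setT (X i)) ->
  forall A, <<s gen_sys J X >> A -> measurable A.
Proof.
move=> mX; apply: smallest_sub; first exact: sigma_algebra_measurable.
exact: gen_sys_measurable.
Qed.

Lemma gen_sigma_fun (I : Type) (J : set I) (X : I -> T -> R) (i : I) : J i ->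
  measurable_fun setT (X i : g_sigma_algebraType (gen_sys J X) -> R).
Proof.
move=> Ji _ B mB; rewrite setTI; apply: sub_sigma_algebra.
(* A cylinder over [i] written as a rectangle whose other sides are the whole line; the implication
   does without a decidable equality on [I]. *)
exists (fun k => [set x | k = i -> B x]); split.
  move=> k; have [->|ki] := pselect (k = i).
    by rewrite (_ : [set _ | _] = B)//; apply/seteqP; split => x //=; apply.
  by rewrite (_ : [set _ | _] = setT)//; apply/seteqP; split => x //= _ /ki.
apply/seteqP; split => w /= h; first by move=> k Jk ki; rewrite ki.
exact: h.
Qed.

End generated_sigma.

Section blocks.
Context {d} {T : measurableType d} {R : realType} (P : probability T R).
Variables (I K : finType) (X : I -> T -> R) (g : I -> K).
Hypothesis mX : forall i, measurable_fun setT (X i).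
Hypothesis iX : independent_family P X.

Let blk (k : K) : set I := [set i | g i = k].

Let mblk k A : <<s gen_sys (blk k) X >> A -> measurable A.
Proof. exact: gen_sigma_measurable. Qed.

Let fineP (A : set T) : measurable A -> (fine (P A))%:E = P A.
Proof. by move=> mA; rewrite fineK// fin_num_measure. Qed.

Let indep_rect (A : K -> set T) :
  (forall k, gen_sys (blk k) X (A k)) ->
  P (\bigcap_k A k) = (\prod_k fine (P (A k)))%:E.
Proof.
move=> /choice[B HB].
have mB i : measurable (B (g i) i) by apply: (HB (g i)).1.
have AE k : A k = [set w | forall i, g i = k -> B (g i) i (X i w)].
  rewrite (HB k).2; apply/seteqP; split => w /= h i gi.
    by rewrite gi; exact: h.
  by rewrite -gi; exact: h.
have -> : \bigcap_k A k = [set w | forall i, B (g i) i (X i w)].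
  apply/seteqP; split => [w h i|w h k _]; last by rewrite AE.
  by have := h (g i) Logic.I; rewrite AE; exact.
rewrite (iX mB)//; congr (_%:E).
rewrite (partition_big g xpredT)//=; apply: eq_bigr => k _.
have mA0 i : measurable (if g i == k then B (g i) i else setT) by case: ifP.
rewrite AE.
have -> : [set w | forall i, g i = k -> B (g i) i (X i w)] =
    [set w | forall i, (if g i == k then B (g i) i else setT) (X i w)].
  apply/seteqP; split => w /= h i; first by case: eqP => // /h.
  by move=> gi; have := h i; rewrite gi eqxx.
rewrite (iX mA0)//= big_mkcond/=; apply: eq_bigr => i _.
by case: ifP => // _; rewrite preimage_setT probability_setT.
Qed.

(** The pi-lambda argument, one block at a time: blocks in [r] have arbitrary events of their
    generated sigma-algebra, the other blocks still have rectangles. The induction upgrades block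
    [k0] with all other events frozen in [O]. *)
Let indep_step (r : seq K) : uniq r -> forall A : K -> set T,
  (forall k, if k \in r then <<s gen_sys (blk k) X >> (A k)
             else gen_sys (blk k) X (A k)) ->
  P (\bigcap_k A k) = (\prod_k fine (P (A k)))%:E.
Proof.
elim: r => [_ A hA|k0 r IH /= /andP[k0r ur] A hA].
  by apply: indep_rect => k; exact: (hA k).
pose O := \bigcap_(k in [set k | k != k0]) A k.
have mA k : measurable (A k).
  have := hA k; case: ifP => _; first exact: mblk.
  by apply: gen_sys_measurable => i; exact: mX.
have mO : measurable O.
  by apply: fin_bigcap_measurable => [|k _ //]; exact: finite_finset.
pose c : R := \prod_(k | k != k0) fine (P (A k)).
(* The events satisfying the product rule against the fixed [O] form a Dynkin system containing the
   rectangles of block [k0]. *)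
pose D : set (set T) :=
  [set S | measurable S /\ P (S `&` O) = (fine (P S) * c)%:E].
have SO S : \bigcap_k (if k == k0 then S else A k) = S `&` O.
  apply/seteqP; split => [w h|w [h1 h2] k _].
    split; first by have := h k0 Logic.I; rewrite eqxx.
    by move=> k /= kk; have := h k Logic.I; rewrite (negbTE kk).
  by have [//|kk] := eqVneq k k0; exact: h2.
have DG : gen_sys (blk k0) X `<=` D.
  move=> S GS; split; first by apply: gen_sys_measurable GS => i; exact: mX.
  rewrite -SO IH//.
    rewrite (bigD1 k0)//= eqxx; congr (_ * _)%:E.
    by apply: eq_bigr => k /negbTE ->.
  move=> k; have [->|kk] := eqVneq k k0; first by rewrite ?eqxx (negbTE k0r).
  by have := hA k; rewrite inE (negbTE kk).
have DT : D setT.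
  apply: DG; exists (fun=> setT); split => //.
  by apply/seteqP; split.
(* The case [S = setT] identifies [c] as the probability of [O], which closure under complement
   requires. *)
have PO : P O = c%:E.
  by have [_] := DT; rewrite setTI probability_setT mul1r.
have : <<s gen_sys (blk k0) X >> `<=` D.
  apply: lambda_system_subset => //; first exact: gen_sys_setI.
  apply/dynkin_lambda_system; split => //.
    move=> S [mS hS]; split; first exact: measurableC.
    have -> : P (~` S `&` O) = (P O - P (S `&` O))%E.
      rewrite setIC -setDE (setIC S); apply: measureD => //.
      by rewrite ltey_eq fin_num_measure.
    by rewrite hS PO probability_setC// -(fineP mS) /= mulrBl mul1r EFinB.
  move=> F tF DF; have mF n : measurable (F n) by have [] := DF n.
  split; first exact: bigcupT_measurable.
  rewrite setI_bigcupl measure_bigcup//=; last 2 first.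
  - by move=> k _; exact: measurableI.
  - exact: trivIset_setIr.
  rewrite EFinM fineP; last exact: bigcupT_measurable.
  rewrite measure_bigcup//= muleC -nneseriesZl//.
  by apply: eq_eseriesr => k _; have [_ ->] := DF k; rewrite EFinM fineP// muleC.
move=> /(_ (A k0)); have := hA k0; rewrite inE eqxx /= => h /(_ h)[_].
rewrite -SO => e; rewrite (_ : (fun k => A k) = fun k => if k == k0 then A k0 else A k).
  by rewrite e (bigD1 k0)//= eqxx; congr (_ * _)%:E; apply: eq_bigr => k /negbTE ->.
by apply/funext => k; case: eqP => [->|].
Qed.

Lemma indep_blocks (Y : K -> T -> R) :
  (forall k, measurable_fun setT (Y k : g_sigma_algebraType (gen_sys (blk k) X) -> R)) ->
  independent_family P Y.
Proof.
move=> mY B mB.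
have -> : [set w | forall k, B k (Y k w)] = \bigcap_k (Y k @^-1` B k).
  by apply/seteqP; split => [w h k _|w h k]; [exact: h|exact: (h k)].
apply: (indep_step (enum_uniq K)) => k; rewrite mem_enum.
by have := mY k measurableT (B k) (mB k); rewrite setTI.
Qed.

End blocks.

(** * Expectations *)

Section mean.
Context {d} {T : measurableType d} {R : realType} (P : probability T R).
Implicit Types X Y : T -> R.

Definition intg X := P.-integrable setT (EFin \o X).
Definition mean X : R := \int[P]_w X w.

Lemma intg_measurable X : intg X -> measurable_fun setT X.
Proof. by move=> /integrableP[/measurable_EFinP]. Qed.

Lemma intg_le X Y : measurable_fun setT X -> (forall w, `|X w| <= Y w) ->
  intg Y -> intg X.
Proof.
move=> mX XY; apply: le_integrable => //; first exact/measurable_EFinP.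
by move=> w _ /=; rewrite lee_fin (le_trans (XY w))// ler_norm.
Qed.

Lemma intg_cst (c : R) : intg (fun=> c).
Proof. exact: finite_measure_integrable_cst. Qed.

Lemma intgD X Y : intg X -> intg Y -> intg (fun w => X w + Y w).
Proof. by move=> iX iY; exact: (integrableD measurableT iX iY). Qed.

Lemma intgN X : intg X -> intg (fun w => - X w).
Proof. by move=> iX; exact: (integrableN iX). Qed.

Lemma intgB X Y : intg X -> intg Y -> intg (fun w => X w - Y w).
Proof. by move=> iX iY; apply: intgD => //; exact: intgN. Qed.

Lemma intgZ (c : R) X : intg X -> intg (fun w => c * X w).
Proof. by move=> iX; exact: (integrableZl measurableT c iX). Qed.

Lemma intg_sum (I : Type) (r : seq I) (Q : pred I) (F : I -> T -> R) :
  (forall i, intg (F i)) -> intg (fun w => \sum_(i <- r | Q i) F i w).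
Proof.
move=> iF; elim: r => [|i r IH].
  by under eq_fun do rewrite big_nil; exact: intg_cst.
under eq_fun do rewrite big_cons; case: (Q i) => //.
exact: intgD.
Qed.

Lemma intg_bounded X (c : R) : measurable_fun setT X ->
  (forall w, `|X w| <= c) -> intg X.
Proof. by move=> mX h; apply: intg_le (intg_cst c). Qed.

Lemma intg_norm X : intg X -> intg (fun w => `|X w|).
Proof. by move=> /integrable_norm. Qed.

Lemma mean_cst (c : R) : mean (fun=> c) = c.
Proof.
rewrite /mean Rintegral_cst//.
have -> : fine (P setT) = 1 by rewrite probability_setT.
by rewrite mulr1.
Qed.

Lemma meanD X Y : intg X -> intg Y -> mean (fun w => X w + Y w) = mean X + mean Y.
Proof. exact: RintegralD. Qed.

Lemma meanB X Y : intg X -> intg Y -> mean (fun w => X w - Y w) = mean X - mean Y.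
Proof. exact: RintegralB. Qed.

Lemma meanZ (c : R) X : intg X -> mean (fun w => c * X w) = c * mean X.
Proof. exact: RintegralZl. Qed.

Lemma mean_sum (I : Type) (r : seq I) (Q : pred I) (F : I -> T -> R) :
  (forall i, intg (F i)) ->
  mean (fun w => \sum_(i <- r | Q i) F i w) = \sum_(i <- r | Q i) mean (F i).
Proof.
move=> iF; elim: r => [|i r IH].
  by under eq_fun do rewrite big_nil; rewrite big_nil mean_cst.
rewrite big_cons -IH; case: (boolP (Q i)) => Qi.
  rewrite -meanD//; last exact: intg_sum.
  by congr mean; apply/funext => w; rewrite big_cons Qi.
by congr mean; apply/funext => w; rewrite big_cons (negbTE Qi).
Qed.

Lemma mean_le X Y : intg X -> intg Y -> (forall w, X w <= Y w) -> mean X <= mean Y.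
Proof. by move=> iX iY XY; apply: le_Rintegral. Qed.

Lemma mean_ge0 X : (forall w, 0 <= X w) -> 0 <= mean X.
Proof. by move=> X0; apply: Rintegral_ge0. Qed.

Lemma mean_norm_le X : intg X -> `|mean X| <= mean (fun w => `|X w|).
Proof. exact: le_normr_Rintegral. Qed.

Lemma markov_mean X (c : R) : 0 < c -> intg X -> (forall w, 0 <= X w) ->
  (P [set w | (c <= X w)%R] <= (mean X / c)%:E)%E.
Proof.
move=> c0 iX X0; have mX := intg_measurable iX.
rewrite EFinM muleC lee_pdivlMl//.
have := le_integral_comp_abse P measurableT (f := id) (g := EFin \o X) (a := c).
move=> /(_ _ _ _ _ c0); rewrite setTI => h.
rewrite (_ : [set w | c <= X w] = [set x | (c%:E <= `|(EFin \o X) x|)%E]).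
  rewrite (le_trans (h _ _ _ _))//=; first exact/measurable_EFinP.
  rewrite /mean /Rintegral fineK; last exact: integrable_fin_num.
  by rewrite le_eqVlt; apply/orP; left; apply/eqP/eq_integral => w _ /=; rewrite ger0_norm.
by apply/seteqP; split => w /=; rewrite lee_fin ger0_norm.
Qed.

Lemma mean_integral X : intg X -> (mean X)%:E = (\int[P]_w (X w)%:E)%E.
Proof. by move=> iX; rewrite /mean /Rintegral fineK//; exact: integrable_fin_num. Qed.

End mean.

Section same_law_mean.
Context {R : realType} {d1 d2 d'} {T1 : measurableType d1} {T2 : measurableType d2}
  {U : measurableType d'}.
Variables (P1 : probability T1 R) (P2 : probability T2 R).
Variables (X1 : T1 -> U) (X2 : T2 -> U).
Hypotheses (mX1 : measurable_fun setT X1) (mX2 : measurable_fun setT X2).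
Hypothesis X12 : same_law P1 P2 X1 X2.

Let p1 : {mfun T1 >-> U} :=
  MeasurableFun.Pack (MeasurableFun.Class (isMeasurableFun.Build _ _ _ _ _ mX1)).
Let p2 : {mfun T2 >-> U} :=
  MeasurableFun.Pack (MeasurableFun.Class (isMeasurableFun.Build _ _ _ _ _ mX2)).

Lemma same_law_ge0_integral (f : U -> \bar R) : measurable_fun setT f ->
  (forall u, 0 <= f u)%E ->
  (\int[P1]_w f (X1 w) = \int[P2]_w f (X2 w))%E.
Proof.
move=> mf f0.
have := @ge0_integral_distribution _ _ _ _ _ P1 p1 f mf f0.
have := @ge0_integral_distribution _ _ _ _ _ P2 p2 f mf f0.
rewrite /comp /= => <- <-; apply: eq_measure_integral => A mA _; exact: X12.
Qed.

Lemma same_law_intg (f : U -> R) : measurable_fun setT f ->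
  intg P2 (f \o X2) -> intg P1 (f \o X1).
Proof.
move=> mf /integrableP[_ h]; apply/integrableP; split.
  by apply/measurable_EFinP; exact: measurableT_comp.
rewrite (same_law_ge0_integral (f := fun u => `|(f u)%:E|%E))//.
by apply: measurableT_comp => //; exact/measurable_EFinP.
Qed.

Lemma same_law_mean (f : U -> R) : measurable_fun setT f ->
  intg P2 (f \o X2) -> mean P1 (f \o X1) = mean P2 (f \o X2).
Proof.
move=> mf i2; have i1 := same_law_intg mf i2.
have mf' : measurable_fun setT (EFin \o f) by exact/measurable_EFinP.
apply/EFin_inj; rewrite !mean_integral//.
have := @integral_distribution _ _ _ _ _ P1 p1 _ mf' i1.
have := @integral_distribution _ _ _ _ _ P2 p2 _ mf' i2.
rewrite /comp /= => <- <-; apply: eq_measure_integral => A mA _; exact: X12.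
Qed.

End same_law_mean.

(** * Products of independent variables *)

Section indep2.
Context {d} {T : measurableType d} {R : realType} (P : probability T R).

Definition indep2 (X Y : T -> R) := forall A B : set R,
  measurable A -> measurable B ->
  P (X @^-1` A `&` Y @^-1` B) = (P (X @^-1` A) * P (Y @^-1` B))%E.

(** The joint law is the product of the two laws; Tonelli gives integrability of the product and
    Fubini its value. *)
Lemma indep2_mean (X Y : T -> R) : indep2 X Y -> intg P X -> intg P Y ->
  intg P (fun w => X w * Y w) /\
  mean P (fun w => X w * Y w) = mean P X * mean P Y.
Proof.
move=> XY iX iY.
have mX := intg_measurable iX; have mY := intg_measurable iY.
pose pX : {mfun T >-> R} :=
  MeasurableFun.Pack (MeasurableFun.Class (isMeasurableFun.Build _ _ _ _ _ mX)).
pose pY : {mfun T >-> R} :=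
  MeasurableFun.Pack (MeasurableFun.Class (isMeasurableFun.Build _ _ _ _ _ mY)).
have mXY : measurable_fun setT (fun w => (X w, Y w)) by exact/measurable_fun_pairP.
pose pXY : {mfun T >-> (R * R)%type} :=
  MeasurableFun.Pack (MeasurableFun.Class (isMeasurableFun.Build _ _ _ _ _ mXY)).
pose D := (distribution P pX \x distribution P pY)%E.
have DE A : measurable A -> D A = distribution P pXY A.
  by apply: product_measure_unique => A1 A2 mA1 mA2; exact: XY.
pose f (z : R * R) : \bar R := (z.1 * z.2)%:E.
have mf : measurable_fun setT f by apply/measurable_EFinP; exact: measurable_funM.
have mabs : measurable_fun setT (fun x : R => `|x%:E|%E).
  by apply: measurableT_comp => //; exact/measurable_EFinP.
have absX : (\int[distribution P pX]_x `|x%:E| < +oo)%E.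
  by rewrite ge0_integral_distribution//=; case/integrableP : iX.
have absY : (\int[distribution P pY]_x `|x%:E| < +oo)%E.
  by rewrite ge0_integral_distribution//=; case/integrableP : iY.
have fE x y : (`|f (x, y)| = `|x%:E| * `|y%:E|)%E by rewrite /f /= normrM.
have iD : D.-integrable setT f.
  apply/integrable12ltyP => //.
  under eq_integral => x _.
    under eq_integral do rewrite fE.
    rewrite ge0_integralZl//.
    over.
  rewrite ge0_integralZr//; last exact: integral_ge0.
  by rewrite lte_mul_pinfty// ?integral_ge0// ge0_fin_numE// integral_ge0.
have iXY : P.-integrable setT (f \o pXY).
  apply/integrableP; split; first exact: measurableT_comp.
  have := integrableP _ _ _ iD => -[_].
  rewrite (eq_measure_integral (distribution P pXY)); last by move=> A mA _; exact: DE.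
  by rewrite ge0_integral_distribution//; exact: measurableT_comp.
split => //; apply/EFin_inj; rewrite mean_integral//.
have -> : (\int[P]_w (X w * Y w)%:E = \int[D]_z f z)%E.
  rewrite (eq_measure_integral (distribution P pXY)); last by move=> A mA _; exact: DE.
  by rewrite integral_distribution.
rewrite -(integral12_prod_meas1 iD) /fubini_F /f /=.
have idX : (distribution P pX).-integrable setT EFin.
  apply/integrableP; split => //; exact/measurable_EFinP.
have idY : (distribution P pY).-integrable setT EFin.
  apply/integrableP; split => //; exact/measurable_EFinP.
have eY : (\int[distribution P pY]_y y%:E = (mean P Y)%:E)%E.
  by rewrite mean_integral// integral_distribution//; exact/measurable_EFinP.
under eq_integral => x _.
  under eq_integral do rewrite EFinM.
  rewrite integralZl// eY.
  over.
rewrite /= integralZr//.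
rewrite EFinM; congr (_ * _)%E.
by rewrite mean_integral// integral_distribution//; exact/measurable_EFinP.
Qed.

End indep2.

Section families.
Context {d} {T : measurableType d} {R : realType} (P : probability T R).
Variables (I : finType) (X : I -> T -> R).
Hypothesis mX : forall i, measurable_fun setT (X i).
Hypothesis iX : independent_family P X.

Lemma indep2_disjoint (J1 J2 : pred I) (Y1 Y2 : T -> R) :
  (forall i, J1 i -> J2 i -> false) ->
  measurable_fun setT (Y1 : g_sigma_algebraType (gen_sys [set i | J1 i] X) -> R) ->
  measurable_fun setT (Y2 : g_sigma_algebraType (gen_sys [set i | J2 i] X) -> R) ->
  indep2 P Y1 Y2.
Proof.
move=> J12 mY1 mY2 A B mA mB.
(* Three blocks: [J1], [J2] and the remaining indices, the last one carrying a constant variable. *)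
pose g i := if J1 i then 0%R else if J2 i then 1%R else (2%:R : 'I_3).
pose Y (k : 'I_3) := if k == 0 then Y1 else if k == 1 then Y2 else cst 0.
have g0 : [set i | g i = 0] = [set i | J1 i].
  apply/seteqP; split => i /=; rewrite /g; case: (boolP (J1 i)) => //.
  by case: (J2 i).
have g1 : [set i | g i = 1] = [set i | J2 i].
  apply/seteqP; split => i /=; rewrite /g.
    by case: (boolP (J1 i)) => //; case: (J2 i).
  by move=> h2; rewrite h2; case: (boolP (J1 i)) => // h1; have := J12 _ h1 h2.
have iY : independent_family P Y.
  apply: (indep_blocks (g := g) mX iX) => k; rewrite /Y.
  case: eqVneq => [->|k0]; first by rewrite g0.
  case: eqVneq => [->|k1]; first by rewrite g1.
  exact: measurable_cst.
pose C (k : 'I_3) : set R := if k == 0 then A else if k == 1 then B else setT.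
have mC k : measurable (C k) by rewrite /C; case: ifP => // _; case: ifP.
have := iY C mC; rewrite !big_ord_recl big_ord0 /C /Y /= !mulr1.
rewrite preimage_cst ?in_setT probability_setT mulr1 EFinM.
have fin D (Z : T -> R) J : measurable D ->
    measurable_fun setT (Z : g_sigma_algebraType (gen_sys J X) -> R) ->
    (fine (P (Z @^-1` D)))%:E = P (Z @^-1` D).
  move=> mD mZ; rewrite fineK// fin_num_measure//.
  apply: (gen_sigma_measurable (J := J) mX).
  by have := mZ measurableT D mD; rewrite setTI.
rewrite (fin A Y1 [set i | J1 i])// (fin B Y2 [set i | J2 i])// => <-.
congr (P _); apply/seteqP; split => w /=.
  by move=> [h1 h2] k; case: ifP => // _; case: ifP.
move=> h; split; first by have := h 0.
by have := h 1.
Qed.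

Lemma indep_prod_mean (r : seq I) : uniq r -> (forall i, i \in r -> intg P (X i)) ->
  intg P (fun w => \prod_(i <- r) X i w) /\
  mean P (fun w => \prod_(i <- r) X i w) = \prod_(i <- r) mean P (X i).
Proof.
elim: r => [_ _|i r IH /= /andP[ir ur] hi].
  rewrite big_nil; under eq_fun do rewrite big_nil.
  by split; [exact: intg_cst|exact: mean_cst].
have [ipr mpr] := IH ur (fun j jr => hi j (mem_behead (s := i :: r) jr)).
under eq_fun do rewrite big_cons.
rewrite big_cons -mpr; apply: indep2_mean => //; last first.
  by apply: hi; rewrite mem_head.
apply: (@indep2_disjoint (fun j => j == i) (fun j => j \in r)).
- by move=> j /eqP -> ir'; rewrite ir' in ir.
- by apply: gen_sigma_fun => /=.
(* The guard [j \in r] makes every factor measurable for the sub-sigma-algebra, including those that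
   do not occur in the product. *)
- rewrite [X in measurable_fun _ X](_ : _ = fun w => \prod_(j <- r) (if j \in r then X j w else 1)); last first.
    by apply/funext => w; apply: eq_big_seq => j ->.
  apply: measurable_prod => j _; case: (boolP (j \in r)) => jr //.
  by apply: gen_sigma_fun.
Qed.

End families.

(** * Symmetric matrices and the min-max principle *)

Section quadratic_forms.
Context {R : realType}.

Definition nrm2 n (u : 'rV[R]_n) : R := (u *m u^T) 0 0.
Definition qf n (A : 'M[R]_n) (u : 'rV[R]_n) : R := (u *m A *m u^T) 0 0.

Lemma nrm2E n (u : 'rV[R]_n) : nrm2 u = \sum_i u 0 i ^+ 2.
Proof. by rewrite /nrm2 mxE; apply: eq_bigr => i _; rewrite mxE expr2. Qed.

Lemma nrm2_ge0 n (u : 'rV[R]_n) : 0 <= nrm2 u.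
Proof. by rewrite nrm2E sumr_ge0// => i _; exact: sqr_ge0. Qed.

Lemma nrm2_eq0 n (u : 'rV[R]_n) : (nrm2 u == 0) = (u == 0).
Proof.
apply/idP/eqP => [|->]; last by rewrite /nrm2 mul0mx mxE.
rewrite nrm2E psumr_eq0 => [/allP h|i _]; last exact: sqr_ge0.
apply/rowP => i; rewrite mxE; apply/eqP; rewrite -sqrf_eq0.
by apply: h; rewrite mem_index_enum.
Qed.

Lemma nrm2_gt0 n (u : 'rV[R]_n) : (0 < nrm2 u) = (u != 0).
Proof. by rewrite lt_def nrm2_ge0 nrm2_eq0 andbT. Qed.

Lemma nrm2Z n (c : R) (u : 'rV[R]_n) : nrm2 (c *: u) = c ^+ 2 * nrm2 u.
Proof. by rewrite /nrm2 linearZ/= -scalemxAl -scalemxAr !mxE mulrA expr2. Qed.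

Lemma nrm2N n (u : 'rV[R]_n) : nrm2 (- u) = nrm2 u.
Proof. by rewrite /nrm2 linearN/= mulNmx mulmxN opprK. Qed.

Lemma nrm2D n (u v : 'rV[R]_n) :
  nrm2 (u + v) = nrm2 u + 2 * (u *m v^T) 0 0 + nrm2 v.
Proof.
rewrite !nrm2E mxE mulr_sumr -!big_split/=; apply: eq_bigr => i _.
by rewrite !mxE; ring.
Qed.

Lemma qfD n (A : 'M[R]_n) (u v : 'rV[R]_n) : A^T = A ->
  qf A (u + v) = qf A u + 2 * (u *m A *m v^T) 0 0 + qf A v.
Proof.
have add (M N : 'M[R]_1) : (M + N) 0 0 = M 0 0 + N 0 0 by rewrite mxE.
move=> sA; rewrite /qf linearD/= !mulmxDl !mulmxDr !add.
have -> : v *m A *m u^T = (u *m A *m v^T)^T by rewrite !trmx_mul trmxK sA mulmxA.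
by rewrite [(_^T) 0 0]mxE; ring.
Qed.

Lemma qfZ n (A : 'M[R]_n) (c : R) (u : 'rV[R]_n) :
  qf A (c *: u) = c ^+ 2 * qf A u.
Proof. by rewrite /qf linearZ/= -!scalemxAl -scalemxAr !mxE mulrA expr2. Qed.

Lemma nrm2_isom n p (Q : 'M[R]_(n, p)) (u : 'rV[R]_n) :
  Q *m Q^T = 1%:M -> nrm2 (u *m Q) = nrm2 u.
Proof. by move=> QQ; rewrite /nrm2 trmx_mul mulmxA -(mulmxA u) QQ mulmx1. Qed.

Lemma qfM n p (A : 'M[R]_p) (Q : 'M[R]_(n, p)) (u : 'rV[R]_n) :
  qf A (u *m Q) = qf (Q *m A *m Q^T) u.
Proof. by rewrite /qf trmx_mul !mulmxA. Qed.

Lemma qfE n (A : 'M[R]_n) (u : 'rV[R]_n) :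
  qf A u = \sum_i \sum_j u 0 i * A i j * u 0 j.
Proof.
rewrite /qf mxE exchange_big/=; apply: eq_bigr => j _.
by rewrite !mxE mulr_suml.
Qed.

Lemma qf_diag n (d : 'rV[R]_n) (u : 'rV[R]_n) :
  qf (diag_mx d) u = \sum_i d 0 i * u 0 i ^+ 2.
Proof.
rewrite qfE; apply: eq_bigr => i _; rewrite (bigD1 i)//= big1 ?addr0.
  by rewrite mxE eqxx mulr1n expr2 mulrAC [u 0 i * _ * _]mulrC.
by move=> j ji; rewrite mxE eq_sym (negbTE ji) mulr0n mulr0 mul0r.
Qed.

Lemma nrm2_delta n (k : 'I_n) : nrm2 (delta_mx 0 k : 'rV[R]_n) = 1.
Proof. by rewrite /nrm2 trmx_delta mul_delta_mx mxE. Qed.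

Lemma qf_diag_delta n (d : 'rV[R]_n) (k : 'I_n) :
  qf (diag_mx d) (delta_mx 0 k) = d 0 k.
Proof.
rewrite qf_diag (bigD1 k)//= mxE !eqxx expr1n mulr1 big1 ?addr0//.
by move=> l lk; rewrite mxE eqxx (negbTE lk) expr0n mulr0.
Qed.

Lemma cvg_sumr (T : Type) (F : set_system T) (I : Type) (r : seq I)
    (f : I -> T -> R) (a : I -> R) : Filter F ->
  (forall i, f i x @[x --> F] --> a i) ->
  \sum_(i <- r) f i x @[x --> F] --> \sum_(i <- r) a i.
Proof.
move=> FF h; elim: r => [|i r IH].
  by rewrite big_nil; under eq_fun do rewrite big_nil; exact: cvg_cst.
by rewrite big_cons; under eq_fun do rewrite big_cons; exact: cvgD.
Qed.

Lemma continuous_qf n (A : 'M[R]_n) : continuous (qf A : 'rV[R]_n -> R).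
Proof.
rewrite (_ : qf A = fun u => \sum_i \sum_j u 0 i * A i j * u 0 j); last first.
  by apply/funext => u; exact: qfE.
move=> u; apply: (@cvg_sumr _ (nbhs u)) => i; apply: (@cvg_sumr _ (nbhs u)) => j.
apply: cvgM; last exact: coord_continuous.
by apply: cvgMr_tmp; exact: coord_continuous.
Qed.

Lemma unit_sphere_compact n : compact [set u : 'rV[R]_n | nrm2 u = 1].
Proof.
apply: bounded_closed_compact.
  exists 1; split => // M M1 u /= u1; apply/ltW/(le_lt_trans _ M1).
  rewrite [leLHS]/Num.norm /= mx_normrE; apply/bigmax_leP; split => //= -[i j] _; rewrite ord1 /=.
  rewrite -[leRHS](@normr1 R) -ler_sqr ?nnegrE// !real_normK ?num_real// expr1n -u1.
  by rewrite nrm2E (bigD1 j)//= lerDl sumr_ge0// => k _; exact: sqr_ge0.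
rewrite (_ : [set _ | _] = (qf 1%:M : 'rV[R]_n -> R) @^-1` [set 1]).
  by apply: closed_comp => [u _|]; [exact: continuous_qf|exact: closed_eq].
by apply/seteqP; split => u /=; rewrite /qf mulmx1.
Qed.

(** Compactness of the unit sphere; homogeneity carries the bound to all [v]. *)
Lemma exists_max_qf n (A : 'M[R]_n.+1) : exists2 u, nrm2 u = 1 &
  forall v, qf A v <= qf A u * nrm2 v.
Proof.
have S0 : [set u : 'rV[R]_n.+1 | nrm2 u = 1] !=set0.
  by exists (delta_mx 0 0); rewrite /= nrm2_delta.
have [|u] := @EVT_max_rV R n.+1 (qf A) _ S0 (@unit_sphere_compact n.+1).
  by apply: continuous_subspaceT; exact: continuous_qf.
rewrite inE /= => u1 h; exists u => // v.
have [->|v0] := eqVneq v 0.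
  by rewrite /nrm2 /qf !mul0mx !mxE mulr0.
have nv : 0 < nrm2 v by rewrite nrm2_gt0.
have := h ((Num.sqrt (nrm2 v))^-1 *: v); rewrite inE /= nrm2Z qfZ.
have -> : (Num.sqrt (nrm2 v))^-1 ^+ 2 = (nrm2 v)^-1 by rewrite exprVn sqr_sqrtr// ltW.
move=> /(_ (mulVf (lt0r_neq0 nv))).
by rewrite ler_pdivrMl// mulrC.
Qed.

(* Varying the maximizer in the direction v: the linear term has to vanish. *)
Lemma max_qf_eigen n (A : 'M[R]_n) (u : 'rV[R]_n) (r : R) : A^T = A ->
  nrm2 u = 1 -> qf A u = r -> (forall v, qf A v <= r * nrm2 v) -> u *m A = r *: u.
Proof.
move=> sA u1 Au h; apply/eqP; rewrite -subr_eq0 -nrm2_eq0.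
set w := u *m A - r *: u.
pose c := r * nrm2 w - qf A w.
have c0 : 0 <= c by rewrite subr_ge0.
have scl (a : R) (M : 'M[R]_1) : (a *: M) 0 0 = a * M 0 0 by rewrite mxE.
have sbl (M N : 'M[R]_1) : (M - N) 0 0 = M 0 0 - N 0 0 by rewrite !mxE.
have uw : (u *m A *m w^T) 0 0 - r * (u *m w^T) 0 0 = nrm2 w.
  by rewrite /nrm2 {3}/w mulmxBl -scalemxAl -scl sbl.
have key t : 2 * t * nrm2 w <= t ^+ 2 * c.
  have := h (u + t *: w).
  rewrite nrm2D qfD// nrm2Z qfZ u1 Au linearZ/= -!scalemxAr !scl => hh.
  rewrite -[X in 2 * t * X]uw /c; move: hh; move: ((u *m A *m w^T) 0 0) ((u *m w^T) 0 0) (nrm2 w) (qf A w).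
  by move=> x y z t'; nra.
have N0 := nrm2_ge0 w.
rewrite eq_le N0 andbT leNgt; apply/negP => Np.
have cp : 0 < c + 1 by rewrite ltr_wpDl.
have := key (nrm2 w / (c + 1)).
rewrite leNgt => /negP; apply.
rewrite exprMn exprVn.
have -> : nrm2 w ^+ 2 / (c + 1) ^+ 2 * c = nrm2 w ^+ 2 / (c + 1) * (c / (c + 1)).
  by field; rewrite gt_eqF.
have -> : 2 * (nrm2 w / (c + 1)) * nrm2 w = nrm2 w ^+ 2 / (c + 1) * 2.
  by field; rewrite gt_eqF.
rewrite ltr_pM2l ?divr_gt0 ?exprn_gt0// ltr_pdivrMr//; lra.
Qed.

(* The Householder reflection exchanging u and the first basis vector. *)
Lemma orthogonal_completion n (u : 'rV[R]_n.+1) : nrm2 u = 1 ->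
  exists Q : 'M[R]_n.+1, Q *m Q^T = 1%:M /\ row 0 Q = u.
Proof.
move=> u1; pose e : 'rV[R]_n.+1 := delta_mx 0 0; pose w := u - e.
have e1 : nrm2 e = 1 by rewrite nrm2_delta.
have [w0|w0] := eqVneq w 0.
  exists 1%:M; split; first by rewrite trmx1 mulmx1.
  by rewrite row1 -/e; apply/eqP; rewrite eq_sym -subr_eq0 -/w w0.
have N0 : 0 < nrm2 w by rewrite nrm2_gt0.
pose c := 2 / nrm2 w; pose Q := 1%:M - c *: (w^T *m w).
have tQ : Q^T = Q.
  by rewrite /Q linearB/= trmx1 linearZ/= trmx_mul trmxK.
have ww : w *m w^T = (nrm2 w)%:M by rewrite [LHS]mx11_scalar.
exists Q; split.
  have KK : (w^T *m w) *m (w^T *m w) = nrm2 w *: (w^T *m w).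
    by rewrite mulmxA -(mulmxA w^T) ww mul_mx_scalar -scalemxAl.
  rewrite tQ /Q; move: KK; move: (w^T *m w) => K KK.
  rewrite mulmxBl !mulmxBr !mul1mx mulmx1 -scalemxAl -scalemxAr KK !scalerA.
  have cc : c * c * nrm2 w = c + c by rewrite /c; field; rewrite gt_eqF.
  rewrite cc.
  rewrite scalerDl; move: (c *: K) => x.
  have -> : x - (x + x) = - x by rewrite opprD addrA subrr add0r.
  by rewrite opprK subrK.
rewrite /Q linearB/= row1 linearZ/= row_mul -/e.
have -> : row 0 (w^T) = (w 0 0)%:M by apply/rowP => i; rewrite !ord1 !mxE.
rewrite mul_scalar_mx scalerA.
have Nw : nrm2 w = - 2 * w 0 0.
  have eu : (u *m e^T) 0 0 = u 0 0.
    rewrite mxE (bigD1 0)//= !mxE !eqxx mulr1 big1 ?addr0// => i i0.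
    by rewrite !mxE eqxx (negbTE i0) mulr0.
  have -> : w 0 0 = u 0 0 - 1 by rewrite /w !mxE !eqxx.
  by rewrite /w nrm2D linearN/= mulmxN [X in 2 * X]mxE eu nrm2N u1 e1; ring.
have -> : c * w 0 0 = -1.
  have w00 : w 0 0 = - nrm2 w / 2 by rewrite Nw; field.
  by rewrite /c w00; field; rewrite gt_eqF.
by rewrite scaleN1r opprK /w addrC subrK.
Qed.

(** Deflation: a maximizer [u] of the form on the sphere is an eigenvector, and in an orthogonal
    basis starting with [u] the matrix splits off the scalar [r]. Descending order comes for free,
    every diagonal entry being a value of the form at a unit vector, hence at most [r]. *)
Lemma sym_spectral n (A : 'M[R]_n) : A^T = A ->
  exists (P : 'M[R]_n) (d : 'rV[R]_n),
  [/\ P *m P^T = 1%:M, A = P^T *m diag_mx d *m P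
    & forall i j : 'I_n, (i <= j)%N -> d 0 j <= d 0 i].
Proof.
elim: n A => [|n IH] A sA.
  exists 1%:M, 0; split; [by rewrite trmx1 mulmx1|by apply/matrixP => -[]|by case].
have [u u1 umax] := exists_max_qf A.
set r := qf A u in umax.
have uA := max_qf_eigen sA u1 (erefl r) umax.
have [Q [QQ Qu]] := orthogonal_completion u1.
have QQ' : Q^T *m Q = 1%:M by apply: mulmx1C.
have [B [BE sB row0]] : exists B : 'M[R]_(1 + n),
    [/\ B = Q *m A *m Q^T, B^T = B & row 0 B = r *: delta_mx 0 0].
  exists (Q *m A *m Q^T); split => //; first by rewrite !trmx_mul trmxK sA mulmxA.
  by rewrite !row_mul Qu uA -scalemxAl -Qu -row_mul QQ row1.
have B0 j : B 0 j = r *+ (j == 0).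
  have /rowP/(_ j) := row0; rewrite !mxE eqxx /= => ->.
  by case: (j == 0); rewrite ?mulr1 ?mulr0.
have l0 : lshift n 0 = 0 :> 'I_(1 + n) by exact/val_inj.
have ur : ursubmx B = 0.
  by apply/matrixP => i j; rewrite !mxE ord1 l0 B0.
have dl : dlsubmx B = 0 by rewrite -[dlsubmx B]trmxK trmx_dlsub sB ur trmx0.
have ul : ulsubmx B = r%:M.
  by apply/matrixP => i j; rewrite !mxE !ord1 l0 B0 eqxx.
have [|P' [d' [PP' dr dmono]]] := IH (drsubmx B).
  by rewrite trmx_drsub sB.
pose P0 : 'M[R]_(1 + n) := block_mx 1%:M 0 0 P'.
have PP0 : P0 *m P0^T = 1%:M.
  rewrite /P0 tr_block_mx mulmx_block !trmx0 trmx1 !mulmx0 !mul0mx !addr0 !add0r.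
  by rewrite PP' mulmx1 -scalar_mx_block.
pose P : 'M[R]_n.+1 := P0 *m Q.
have PP : P *m P^T = 1%:M.
  by rewrite /P trmx_mul mulmxA -(mulmxA P0) QQ mulmx1.
pose d : 'rV[R]_(1 + n) := row_mx (r%:M) d'.
have Bd : B = P0^T *m diag_mx d *m P0.
  rewrite -[LHS]submxK ul ur dl dr /d diag_mx_row /P0 tr_block_mx.
  rewrite !trmx0 trmx1 !mulmx_block.
  rewrite !mulmx0 !mul0mx !addr0 !add0r ?mulmx1 ?mul1mx !mul0mx ?mulmx0 ?addr0 ?add0r.
  congr block_mx; apply/matrixP => i j; rewrite !ord1 !mxE.
  by rewrite !eqxx.
have Ad : A = P^T *m diag_mx d *m P.
  rewrite /P trmx_mul -!mulmxA !mulmxA -(mulmxA _ _ P0) -(mulmxA _ (P0^T)).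
  rewrite (mulmxA (P0^T)) -Bd BE !mulmxA QQ' mul1mx -mulmxA QQ' mulmx1 //.
exists P, d; split => // i j ij.
have PAP : P *m A *m P^T = diag_mx d.
  rewrite Ad; move: PP; clear; move: P d => P d PP.
  by rewrite !mulmxA PP mul1mx -mulmxA PP mulmx1.
have dE k : d 0 k = qf A (row k P).
  by rewrite rowE qfM PAP qf_diag_delta.
have P1 k : nrm2 (row k P) = 1.
  by rewrite rowE nrm2_isom// nrm2_delta.
have dR k : d 0 (rshift 1 k) = d' 0 k by rewrite /d row_mxEr.
have dL k : d 0 (lshift n k) = r by rewrite /d row_mxEl ord1 mxE eqxx mulr1n.
move: ij; case: (@split_ordP 1 n i) => i' ->; last first.
  case: (@split_ordP 1 n j) => j' ->; last first.
    by rewrite /= leq_add2l => ij; have := dmono _ _ ij; rewrite -!dR.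
  by rewrite /= ord1.
move=> _; apply: (@le_trans _ _ r); last by rewrite -(dL i').
rewrite dE.
by apply: le_trans (umax _) _; rewrite P1 mulr1.
Qed.

Lemma char_poly_orth n (P : 'M[R]_n) (d : 'rV[R]_n) : P *m P^T = 1%:M ->
  char_poly (P^T *m diag_mx d *m P) = \prod_(i < n) ('X - (d 0 i)%:P).
Proof.
move=> PP; have PP' : P^T *m P = 1%:M by apply: mulmx1C.
rewrite /char_poly.
have -> : char_poly_mx (P^T *m diag_mx d *m P) =
    map_mx polyC P^T *m char_poly_mx (diag_mx d) *m map_mx polyC P.
  rewrite /char_poly_mx mulmxBr mulmxBl !map_mxM; congr (_ - _).
  by rewrite scalar_mxC -mulmxA -map_mxM PP' map_mx1 mulmx1.
rewrite !det_mulmx mulrAC -det_mulmx -map_mxM PP' map_mx1 det1 mul1r.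
rewrite -/(char_poly _) char_poly_trig.
  by apply: eq_bigr => i _; rewrite mxE eqxx.
by apply/is_trig_mxP => i j ij; rewrite mxE -val_eqE ltn_eqF.
Qed.

(** [eigvals] is known only through its specification. The linear factors of a split polynomial are
    unique up to permutation, and sortedness makes the list unique. *)
Lemma eigvals_diag n (P : 'M[R]_n) (d : 'rV[R]_n) : P *m P^T = 1%:M ->
  (forall i j : 'I_n, (i <= j)%N -> d 0 j <= d 0 i) ->
  eigvals (P^T *m diag_mx d *m P) = [seq d 0 i | i <- enum 'I_n].
Proof.
move=> PP dm; set A := _ *m P; set s0 := [seq _ | _ <- _].
have s0P : sorted >=%R s0 /\ char_poly A = \prod_(x <- s0) ('X - x%:P).
  split; last by rewrite char_poly_orth// big_map big_enum.
  have : sorted leq (map val (enum 'I_n)) by rewrite val_enum_ord iota_sorted.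
  by rewrite !sorted_map; apply: sub_sorted => i j; exact: dm.
have [ss sE] : sorted >=%R (eigvals A) /\
    char_poly A = \prod_(x <- eigvals A) ('X - x%:P).
  have ex : exists s : seq R, [set s : seq R | sorted >=%R s /\
    char_poly A = \prod_(x <- s) ('X - x%:P)] s by exists s0.
  exact: (xgetPex [::] ex).
apply: (@sorted_eq _ >=%R) => //.
- by move=> x y z xy yz; exact: le_trans yz xy.
- by move=> x y; rewrite andbC; exact: le_anti.
- exact: s0P.1.
- by apply: prod_XsubC_eq; rewrite -sE s0P.2.
Qed.

Lemma nth_eigvals_diag n (P : 'M[R]_n) (d : 'rV[R]_n) (k : 'I_n) :
  P *m P^T = 1%:M -> (forall i j : 'I_n, (i <= j)%N -> d 0 j <= d 0 i) ->
  (eigvals (P^T *m diag_mx d *m P))`_k = d 0 k.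
Proof.
move=> PP dm; rewrite eigvals_diag// (nth_map k) ?size_enum_ord//.
by rewrite nth_ord_enum.
Qed.

Lemma kernel_row m n (M : 'M[R]_(m, n)) : (n < m)%N ->
  exists2 a : 'rV[R]_m, a != 0 & a *m M = 0.
Proof.
move=> nm; have : kermx M != 0.
  rewrite -mxrank_eq0 mxrank_ker -lt0n subn_gt0.
  exact: leq_ltn_trans (rank_leq_col M) nm.
case/rowV0Pn => a /sub_kermxP aM a0; by exists a.
Qed.

Lemma initial_mx n (k : 'I_n) : exists W : 'M[R]_(k.+1, n), W *m W^T = 1%:M /\
  forall (a : 'rV[R]_k.+1) (i : 'I_n), (k < i)%N -> (a *m W) 0 i = 0.
Proof.
pose W : 'M[R]_(k.+1, n) := \matrix_(i, j) (widen_ord (ltn_ord k) i == j)%:R.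
exists W; split.
  apply/matrixP => i j; rewrite !mxE (bigD1 (widen_ord (ltn_ord k) i))//= !mxE eqxx mul1r.
  rewrite big1 ?addr0 => [|l li].
    by congr (_%:R); rewrite -!val_eqE/= eq_sym.
  by rewrite !mxE eq_sym (negbTE li) mul0r.
move=> a i ik; rewrite mxE big1// => l _.
rewrite !mxE; case: eqP => [e|_]; last by rewrite mulr0.
by move: ik; rewrite -e /= ltnNge -ltnS ltn_ord.
Qed.

(** A space of dimension [k + 1] contains a nonzero vector orthogonal to the first [k] eigenvectors,
    and there the form is at most [d 0 k] times the squared norm. *)
Lemma minmax_ge n (A : 'M[R]_n) (k : 'I_n) (B : 'M[R]_(k.+1, n)) (mu : R) :
  A^T = A -> (forall a : 'rV[R]_k.+1, a != 0 -> a *m B != 0) ->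
  (forall a : 'rV[R]_k.+1, mu * nrm2 (a *m B) <= qf A (a *m B)) -> mu <= (eigvals A)`_k.
Proof.
move=> sA inj h; have [P [d [PP AE dm]]] := sym_spectral sA.
rewrite AE nth_eigvals_diag//.
have kn : (k <= n)%N by exact: ltnW.
pose M : 'M[R]_(k.+1, k) := \matrix_(i, j) (B *m P^T) i (widen_ord kn j).
have [a a0 aM] := kernel_row M (ltnSn k).
have PP' : P^T *m P = 1%:M by apply: mulmx1C.
pose c := a *m B *m P^T.
have cE : a *m B = c *m P by rewrite /c -!mulmxA PP' mulmx1.
have c0 (i : 'I_n) : (i < k)%N -> c 0 i = 0.
  move=> ik; have /rowP/(_ (Ordinal ik)) := aM; rewrite mxE [RHS]mxE => e.
  rewrite /c -mulmxA mxE -[RHS]e; apply: eq_bigr => l _; rewrite [M _ _]mxE.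
  have -> : widen_ord kn (Ordinal ik) = i by exact/val_inj.
  by [].
have PAP : P *m A *m P^T = diag_mx d by rewrite AE !mulmxA PP mul1mx -mulmxA PP mulmx1.
have cn : 0 < nrm2 c by rewrite -(nrm2_isom c PP) -cE nrm2_gt0 inj.
have := h a; rewrite cE nrm2_isom// qfM PAP qf_diag => /le_trans.
rewrite -(ler_pM2r cn); apply.
rewrite nrm2E mulr_sumr; apply: ler_sum => i _.
have [ik|ki] := ltnP i k; first by rewrite c0// expr0n !mulr0.
by rewrite ler_wpM2r ?sqr_ge0// dm.
Qed.

(** The dual count: the [k] equations [u *m C = 0] have a nonzero solution in the span of the first
    [k + 1] eigenvectors, where the form is at least [d 0 k] times the squared norm. *)
Lemma minmax_le n (A : 'M[R]_n) (k : 'I_n) (C : 'M[R]_(n, k)) (mu : R) :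
  A^T = A ->
  (forall u : 'rV[R]_n, u *m C = 0 -> qf A u <= mu * nrm2 u) -> (eigvals A)`_k <= mu.
Proof.
move=> sA h; have [P [d [PP AE dm]]] := sym_spectral sA.
rewrite AE nth_eigvals_diag//.
have [W [WW W0]] := initial_mx k.
have [a a0 aM] := kernel_row (W *m P *m C) (ltnSn k).
have PAP : P *m A *m P^T = diag_mx d by rewrite AE !mulmxA PP mul1mx -mulmxA PP mulmx1.
have an : 0 < nrm2 a by rewrite nrm2_gt0.
have := h (a *m W *m P); rewrite -!mulmxA (mulmxA W) aM => /(_ erefl).
rewrite !mulmxA qfM PAP !nrm2_isom// qf_diag => e.
rewrite -(ler_pM2r an); apply: le_trans e.
rewrite -(nrm2_isom a WW) nrm2E mulr_sumr; apply: ler_sum => i _.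
have [ik|ki] := ltnP k i; last by rewrite ler_wpM2r ?sqr_ge0// dm.
by rewrite W0// expr0n !mulr0.
Qed.

(** The span of the top [k + 1] eigenvectors is an optimal test space; it allows comparison with the
    eigenvalues of another matrix. *)
Lemma eigvals_test_space n (A : 'M[R]_n) (k : 'I_n) : A^T = A ->
  exists B : 'M[R]_(k.+1, n), B *m B^T = 1%:M /\
    forall a : 'rV[R]_k.+1, (eigvals A)`_k * nrm2 (a *m B) <= qf A (a *m B).
Proof.
move=> sA; have [P [d [PP AE dm]]] := sym_spectral sA.
rewrite {1}AE nth_eigvals_diag//.
have [W [WW W0]] := initial_mx k.
exists (W *m P); split; first by rewrite trmx_mul mulmxA -(mulmxA W) PP mulmx1.
have PAP : P *m A *m P^T = diag_mx d by rewrite AE !mulmxA PP mul1mx -mulmxA PP mulmx1.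
move=> a; rewrite mulmxA qfM PAP !nrm2_isom// qf_diag.
rewrite -(nrm2_isom a WW) nrm2E mulr_sumr; apply: ler_sum => i _.
have [ik|ki] := ltnP k i; last by rewrite ler_wpM2r ?sqr_ge0// dm.
by rewrite W0// expr0n !mulr0.
Qed.

End quadratic_forms.

(** * Perturbation of spiked eigenvalues *)

Section perturbation.
Context {R : realType}.

Lemma weighted_CS (I : finType) (Q : pred I) (w a b : I -> R) :
  (forall i, 0 < w i) ->
  (\sum_(i | Q i) a i * b i) ^+ 2 <=
  (\sum_(i | Q i) a i ^+ 2 / w i) * (\sum_(i | Q i) w i * b i ^+ 2).
Proof.
move=> w0; set A := \sum_(i | Q i) a i ^+ 2 / w i.
set B := \sum_(i | Q i) w i * b i ^+ 2; set C := \sum_(i | Q i) _.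
have A0 : 0 <= A by apply: sumr_ge0 => i _; rewrite divr_ge0 ?sqr_ge0// ltW.
(* The discriminant argument without division: at [s = A], [t = C] the right-hand side is
   [A * (A * B - C ^+ 2)]. *)
have key s t : 0 <= A * t ^+ 2 - 2 * s * t * C + s ^+ 2 * B.
  have -> : A * t ^+ 2 - 2 * s * t * C + s ^+ 2 * B =
      \sum_(i | Q i) (a i * t - s * w i * b i) ^+ 2 / w i.
    rewrite /A /B /C mulr_suml !mulr_sumr -sumrB -big_split/=.
    by apply: eq_bigr => i _; field; rewrite gt_eqF.
  by apply: sumr_ge0 => i _; rewrite divr_ge0 ?sqr_ge0// ltW.
have [A00|Ap] := eqVneq A 0.
  suff -> : C = 0 by rewrite A00 expr0n mul0r.
  rewrite /C big1// => i Qi.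
  have : a i ^+ 2 / w i == 0.
    move/eqP: A00; rewrite psumr_eq0 => [/allP/(_ i)|k _].
      by rewrite mem_index_enum Qi => /(_ isT).
    by rewrite divr_ge0 ?sqr_ge0// ltW.
  by rewrite mulf_eq0 invr_eq0 (gt_eqF (w0 i)) orbF sqrf_eq0 => /eqP ->; rewrite mul0r.
have A1 : 0 < A by rewrite lt_def Ap.
have := key A C => h.
have : 0 <= A * (A * B - C ^+ 2) by apply: le_trans h _; rewrite le_eqVlt; apply/orP; left; apply/eqP; ring.
by rewrite pmulr_rge0// subr_ge0.
Qed.

Lemma CS_rV n (u v : 'rV[R]_n) : (u *m v^T) 0 0 ^+ 2 <= nrm2 u * nrm2 v.
Proof.
have := @weighted_CS 'I_n xpredT (fun=> 1) (fun i => u 0 i) (fun i => v 0 i).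
move=> /(_ (fun=> ltr01)); rewrite !nrm2E mxE.
under [X in X ^+ 2]eq_bigr do [].
move=> h; apply: le_trans (le_trans _ h) _; rewrite le_eqVlt; apply/orP; left; apply/eqP.
  by congr (_ ^+ 2); apply: eq_bigr => i _; rewrite mxE.
by congr (_ * _); apply: eq_bigr => i _; rewrite ?divr1 ?mul1r.
Qed.

Lemma qf_gram n p (K : 'M[R]_(n, p)) (u : 'rV[R]_p) :
  qf (K^T *m K) u = nrm2 (u *m K^T).
Proof. by rewrite /qf /nrm2 trmx_mul trmxK !mulmxA. Qed.

Lemma gram_sym n p (K : 'M[R]_(n, p)) : (K^T *m K)^T = K^T *m K.
Proof. by rewrite trmx_mul trmxK. Qed.

Lemma eigvals_gram_ge0 n p (K : 'M[R]_(n, p)) (k : 'I_p) :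
  0 <= (eigvals (K^T *m K))`_k.
Proof.
have [W [WW _]] := @initial_mx R _ k.
apply: (minmax_ge (k := k) (B := W) (gram_sym K)).
  by move=> a a0; rewrite -nrm2_gt0 nrm2_isom// nrm2_gt0.
by move=> a; rewrite mul0r qf_gram nrm2_ge0.
Qed.

(** Test vectors [v] live in dimension [n], as for [K *m K^T]. Cauchy-Schwarz gives [nrm2 (v *m K)
    ^+ 2 <= nrm2 (v *m K *m K^T) * nrm2 v], so the bound passes to the vectors [v *m K] without any
    comparison of the two spectra. *)
Lemma eigvals_gram_ge n p (K : 'M[R]_(n, p)) (k : 'I_p) (V : 'M[R]_(k.+1, n)) (mu : R) :
  (forall a : 'rV[R]_k.+1, a != 0 -> a *m V != 0) ->
  (forall a : 'rV[R]_k.+1, mu * nrm2 (a *m V) <= nrm2 (a *m V *m K)) ->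
  mu <= (eigvals (K^T *m K))`_k.
Proof.
move=> inj h; have [mu0|mu0] := leP mu 0; first exact: le_trans mu0 (eigvals_gram_ge0 _ _).
apply: (minmax_ge (k := k) (B := V *m K) (gram_sym K)).
  move=> a a0; rewrite mulmxA -nrm2_gt0; apply: lt_le_trans (h a).
  by rewrite mulr_gt0// nrm2_gt0 inj.
move=> a; rewrite mulmxA qf_gram.
have [aV|aV] := eqVneq (a *m V) 0.
  by rewrite aV /nrm2 !mul0mx !mxE mulr0 lexx.
have nv : 0 < nrm2 (a *m V) by rewrite nrm2_gt0.
rewrite -(ler_pM2r nv).
have := CS_rV (a *m V *m K *m K^T) (a *m V); apply: le_trans.
have -> : (a *m V *m K *m K^T *m (a *m V)^T) 0 0 = nrm2 (a *m V *m K).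
  by rewrite /nrm2 (trmx_mul (a *m V)) !mulmxA.
rewrite mulrAC expr2 ler_wpM2r ?nrm2_ge0//.
Qed.

(** For [w = u *m K^T], Cauchy-Schwarz bounds [nrm2 w ^+ 2] by [nrm2 (w *m K) * nrm2 u], hence by
    [mu * nrm2 w * nrm2 u]; one factor [nrm2 w] cancels. *)
Lemma eigvals_gram_le n p (K : 'M[R]_(n, p)) (k : 'I_p) (C : 'M[R]_(n, k)) (mu : R) :
  0 <= mu ->
  (forall v : 'rV[R]_n, v *m C = 0 -> nrm2 (v *m K) <= mu * nrm2 v) ->
  (eigvals (K^T *m K))`_k <= mu.
Proof.
move=> mu0 h; apply: (minmax_le (k := k) (C := K^T *m C) (gram_sym K)).
move=> u; rewrite mulmxA qf_gram => uC.
have [->|w0] := eqVneq (u *m K^T) 0.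
  by rewrite {1}/nrm2 mul0mx mxE mulr_ge0 ?nrm2_ge0.
have nw : 0 < nrm2 (u *m K^T) by rewrite nrm2_gt0.
rewrite -(ler_pM2r nw) -expr2.
have -> : nrm2 (u *m K^T) = (u *m K^T *m K *m u^T) 0 0.
  by rewrite /nrm2 trmx_mul trmxK !mulmxA.
apply: le_trans (CS_rV _ _) _.
have -> : (u *m K^T *m K *m u^T) 0 0 = nrm2 (u *m K^T).
  by rewrite /nrm2 trmx_mul trmxK !mulmxA.
by rewrite mulrAC ler_wpM2r ?nrm2_ge0// h.
Qed.

Variables (m : nat) (G : 'M[R]_m) (eta delta : R).
Hypotheses (delta0 : 0 < delta) (eta0 : 0 <= eta).
Hypothesis Geta : forall i j, `|G i j - (i == j)%:R| <= eta.

Let C := 4 * m%:R / delta.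

(** The terms linear in [a 0 j] are at most [2 eta |a_j| s], with [s] the sum of the other moduli.
    AM-GM with weight [C] bounds them by [C eta^2 a_j^2 + s^2 / C], and [s^2 <= m N], with [N] the
    sum of the other squares, turns the last term into [delta / 4 * N]; this fixes [C]. The
    coefficient of [a_j^2] thus has an error quadratic in [eta]. *)
Lemma gram_expand (a : 'rV[R]_m) (j : 'I_m) :
  `|qf G a - G j j * a 0 j ^+ 2 - \sum_(l | l != j) a 0 l ^+ 2| <=
  C * eta ^+ 2 * a 0 j ^+ 2 +
  (delta / 4 + eta * m%:R) * \sum_(l | l != j) a 0 l ^+ 2.
Proof.
set N := \sum_(l | l != j) _; set s := \sum_(l | l != j) `|a 0 l|.
have s0 : 0 <= s by apply: sumr_ge0.
have m0 : 0 < (m%:R : R) by rewrite ltr0n (leq_ltn_trans _ (ltn_ord j)).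
have sN : s ^+ 2 <= m%:R * N.
  have := @weighted_CS 'I_m (fun l => l != j) (fun=> 1) (fun=> 1) (fun l => `|a 0 l|).
  move=> /(_ (fun=> ltr01)) h.
  have -> : s = \sum_(l | l != j) 1 * `|a 0 l| by apply: eq_bigr => l _; rewrite mul1r.
  apply: le_trans h _.
  have -> : \sum_(i < m | i != j) 1 * `|a 0 i| ^+ 2 = N.
    by apply: eq_bigr => i _; rewrite mul1r real_normK ?num_real.
  rewrite ler_wpM2r//; first by apply: sumr_ge0 => i _; exact: sqr_ge0.
  rewrite (eq_bigr (fun=> 1)) => [|i _]; last by rewrite expr1n divr1.
  by rewrite sumr_const ler_nat -[leqRHS](card_ord m) max_card.
pose D i k := a 0 i * (G i k - (i == k)%:R) * a 0 k.
have Dle i k : `|D i k| <= eta * (`|a 0 i| * `|a 0 k|).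
  by rewrite /D !normrM mulrAC mulrC ler_wpM2r ?mulr_ge0.
have e : qf G a - G j j * a 0 j ^+ 2 - N =
    \sum_(k | k != j) D j k + \sum_(i | i != j) (D i j + \sum_(k | k != j) D i k).
  have -> : qf G a = \sum_i a 0 i ^+ 2 + \sum_i \sum_k D i k.
    rewrite qfE -big_split/=; apply: eq_bigr => i _.
    rewrite /D [X in _ = _ + X](eq_bigr (fun k => a 0 i * G i k * a 0 k -
       a 0 i * (i == k)%:R * a 0 k)) => [|k _]; last by ring.
    rewrite sumrB [X in _ - X](bigD1 i)//= eqxx mulr1 [X in _ - (_ + X)]big1.
      by ring.
    by move=> k ki; rewrite eq_sym (negbTE ki) mulr0 mul0r.
  have -> : \sum_i a 0 i ^+ 2 = a 0 j ^+ 2 + N by rewrite (bigD1 j).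
  have -> : \sum_i \sum_k D i k = D j j + \sum_(k | k != j) D j k +
      \sum_(i | i != j) (D i j + \sum_(k | k != j) D i k).
    rewrite (bigD1 j)//= (bigD1 j)//=; congr (_ + _).
    by apply: eq_bigr => i _; rewrite (bigD1 j).
  by rewrite {1}/D eqxx mulr1n; ring.
have b1 : `|\sum_(k | k != j) D j k| <= eta * (`|a 0 j| * s).
  apply: le_trans (ler_norm_sum _ _ _) _; rewrite /s !mulr_sumr.
  by apply: ler_sum.
have b2 : `|\sum_(i | i != j) D i j| <= eta * (`|a 0 j| * s).
  apply: le_trans (ler_norm_sum _ _ _) _; rewrite /s !mulr_sumr.
  by apply: ler_sum => i _; rewrite (mulrC `|a 0 j|).
have b3 : `|\sum_(i | i != j) \sum_(k | k != j) D i k| <= eta * s ^+ 2.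
  rewrite expr2 {1}/s mulr_suml mulr_sumr.
  apply: le_trans (ler_norm_sum _ _ _) _; apply: ler_sum => i _.
  apply: le_trans (ler_norm_sum _ _ _) _; rewrite /s !mulr_sumr.
  by apply: ler_sum.
rewrite e big_split/=.
have am : 2 * eta * `|a 0 j| * s <= C * eta ^+ 2 * a 0 j ^+ 2 + delta / 4 * N.
  apply: (@le_trans _ _ (C * eta ^+ 2 * a 0 j ^+ 2 + s ^+ 2 / C)).
    have C0 : 0 < C by rewrite divr_gt0// mulr_gt0.
    rewrite -subr_ge0.
    have -> : C * eta ^+ 2 * a 0 j ^+ 2 + s ^+ 2 / C - 2 * eta * `|a 0 j| * s =
        (C * eta * `|a 0 j| - s) ^+ 2 / C.
      have -> : a 0 j ^+ 2 = `|a 0 j| ^+ 2 by rewrite real_normK ?num_real.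
      by field; rewrite gt_eqF.
    by rewrite divr_ge0 ?sqr_ge0// ltW.
  rewrite lerD2l.
  have -> : s ^+ 2 / C = delta / 4 * (s ^+ 2 / m%:R).
    by rewrite /C; field; rewrite !gt_eqF.
  by rewrite ler_pM2l ?divr_gt0// ler_pdivrMr// mulrC.
have b4 : eta * s ^+ 2 <= eta * m%:R * N by rewrite -mulrA ler_wpM2l.
move: b1 b2 b3 => /ler_normlP[b1 b1'] /ler_normlP[b2 b2'] /ler_normlP[b3 b3'].
by rewrite mulrDl; apply/ler_normlP; split; lra.
Qed.

End perturbation.

Section eig_perturbation.
Context {R : realType}.
Variables (m n p : nat) (K : 'M[R]_(n, p)) (y : 'M[R]_(m, n)) (l : 'I_m -> R).
Variables (eta delta theta t : R).
Hypotheses (delta0 : 0 < delta) (delta1 : delta <= 1) (eta0 : 0 <= eta).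
Hypothesis eta_small : 2 * eta * (m%:R + 2) <= delta.
Hypothesis l0 : forall i, 0 < l i.
Hypothesis lgap : forall i k : 'I_m, (i < k)%N -> l k <= (1 - delta) * l i.
Let G := y *m y^T.
Hypothesis Geta : forall i j, `|G i j - (i == j)%:R| <= eta.
Hypothesis Kt : forall v : 'rV[R]_n,
  `|nrm2 (v *m K) - \sum_i l i * (v *m y^T) 0 i ^+ 2 - t * nrm2 v| <= theta * nrm2 v.
Hypotheses (t0 : 0 <= t) (theta0 : 0 <= theta).

Let C := 4 * m%:R / delta.

Let nrm2_comb (a : 'rV[R]_m) : nrm2 (a *m y) = qf G a.
Proof. by rewrite /qf /G /nrm2 trmx_mul !mulmxA. Qed.

Let m0 (j : 'I_m) : 1 <= (m%:R : R).
Proof. by rewrite ler1n (leq_ltn_trans _ (ltn_ord j)). Qed.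

Let N_ge0 (a : 'rV[R]_m) (j : 'I_m) : 0 <= \sum_(i | i != j) a 0 i ^+ 2.
Proof. by apply: sumr_ge0 => i _; exact: sqr_ge0. Qed.

Let lK i x : l i * (x / l i) = x.
Proof. by rewrite mulrC divfK// gt_eqF. Qed.

(** Duality: for [a_i = l_i (v . y_i)] the form [S] equals both [(a *m y) . v] and the sum of the
    [a_i^2 / l_i]. Cauchy-Schwarz gives [S^2 <= qf G a * nrm2 v], so it suffices that
    [qf G a <= mu * S]. *)
Lemma top_form_le (j : 'I_m) (v : 'rV[R]_n) :
  (forall i : 'I_m, (i < j)%N -> (v *m y^T) 0 i = 0) ->
  \sum_i l i * (v *m y^T) 0 i ^+ 2 <= l j * (G j j + C * eta ^+ 2) * nrm2 v.
Proof.
move: (delta0) (delta1) (eta0) (eta_small) => d0 d1 e0 es hv; set S := \sum_i _; set mu := l j * _.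
pose a : 'rV[R]_m := \row_i (l i * (v *m y^T) 0 i).
have S0 : 0 <= S by apply: sumr_ge0 => i _; rewrite mulr_ge0 ?sqr_ge0// ltW.
have aS : (a *m y *m v^T) 0 0 = S.
  have -> : a *m y *m v^T = a *m (v *m y^T)^T by rewrite trmx_mul trmxK mulmxA.
  by rewrite mxE; apply: eq_bigr => i _; rewrite [a _ _]mxE [_^T _ _]mxE expr2 mulrA.
have SE : S = \sum_i a 0 i ^+ 2 / l i.
  by apply: eq_bigr => i _; rewrite [a _ _]mxE; field; rewrite gt_eqF.
have Gjj : 1 - eta <= G j j.
  have := Geta j j; rewrite eqxx => /ler_normlP[h1 h2]; move: h1 h2; rewrite /=; lra.
have mj := m0 j.
have c0 : 0 <= C * eta ^+ 2 by rewrite mulr_ge0 ?sqr_ge0// divr_ge0 ?mulr_ge0// ltW.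
have key : qf G a <= mu * S.
  set N := \sum_(i | i != j) a 0 i ^+ 2.
  have aN0 : 0 <= N := N_ge0 a j.
  (* For [i > j] the gap yields [l j / l i >= 1 + delta], because [(1 + delta) (1 - delta) <= 1].
     This surplus pays for the error terms of [gram_expand]. *)
  have SN : a 0 j ^+ 2 + (1 + delta) * N <= l j * S.
    rewrite SE (bigD1 j)//= mulrDr lK lerD2l /N !mulr_sumr.
    apply: ler_sum => i ij.
    have [ilj|jli] := ltnP i j; first by rewrite [a _ _]mxE hv// !mulr0 expr0n !mulr0 mul0r mulr0.
    have ji : (j < i)%N by rewrite ltn_neqAle jli eq_sym ij.
    rewrite mulrC mulrCA ler_wpM2l ?sqr_ge0// lter_pdivlMr//.
    have d2 : 0 <= 1 + delta by lra.
    apply: le_trans (ler_wpM2l d2 (lgap ji)) _.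
    have : 0 <= delta ^+ 2 * l j by rewrite mulr_ge0 ?sqr_ge0// ltW.
    lra.
  have := gram_expand delta0 eta0 Geta a j.
  rewrite -/N -/C => /ler_normlP[_ h].
  have a2 : 0 <= a 0 j ^+ 2 by exact: sqr_ge0.
  apply: (@le_trans _ _ ((G j j + C * eta ^+ 2) * (a 0 j ^+ 2 + (1 + delta) * N))).
    have : (1 + delta / 4 + eta * m%:R) * N <= (1 - eta) * (1 + delta) * N.
      by rewrite ler_wpM2r//; nra.
    have : (1 - eta) * (1 + delta) * N <= G j j * (1 + delta) * N.
      by rewrite ler_wpM2r// ler_wpM2r//; lra.
    have d3 : 0 <= 1 + delta by lra.
    have := mulr_ge0 c0 (mulr_ge0 d3 aN0).
    lra.
  have -> : mu * S = (G j j + C * eta ^+ 2) * (l j * S) by rewrite /mu; ring.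
  rewrite ler_wpM2l//; nra.
have [->|Sp] := eqVneq S 0.
  by rewrite mulr_ge0 ?nrm2_ge0// mulr_ge0 ?ltW//; nra.
have S1 : 0 < S by rewrite lt_def Sp.
rewrite -(ler_pM2r S1) -expr2 -[X in X ^+ 2]aS.
apply: le_trans (CS_rV _ _) _; rewrite nrm2_comb mulrAC.
by rewrite ler_wpM2r ?nrm2_ge0.
Qed.

(** With [v = a *m y], [nrm2 v] is the sum of the [a_i (v . y_i)], and the weighted Cauchy-Schwarz
    inequality gives [nrm2 v ^+ 2 <= A * S]. The remaining bound [mu * A <= nrm2 v] uses
    [l j / l i <= 1 - delta] for [i < j]. The first claim makes the span of the [y_i] a test space
    of full dimension. *)
Lemma top_form_ge (j : 'I_m) (a : 'rV[R]_m) :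
  (forall i : 'I_m, (j < i)%N -> a 0 i = 0) ->
  (a != 0 -> a *m y != 0) /\
  l j * (G j j - C * eta ^+ 2) * nrm2 (a *m y) <=
    \sum_i l i * (a *m y *m y^T) 0 i ^+ 2.
Proof.
move: (delta0) (delta1) (eta0) (eta_small) => d0 d1 e0 es ha; set v := a *m y; set S := \sum_i _; set mu := l j * _.
have mj := m0 j.
have Gjj : 1 - eta <= G j j <= 1 + eta.
  have := Geta j j; rewrite eqxx => /ler_normlP[h1 h2]; move: h1 h2; rewrite /=; lra.
set N := \sum_(i | i != j) a 0 i ^+ 2.
have aN0 : 0 <= N := N_ge0 a j.
have a2 : 0 <= a 0 j ^+ 2 by exact: sqr_ge0.
have := gram_expand delta0 eta0 Geta a j.
rewrite -/N -/C -nrm2_comb -/v => /ler_normlP[h _].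
have Ce : C * eta <= 2.
  rewrite /C mulrAC ler_pdivrMr//; nra.
have Cee : C * eta ^+ 2 <= 2 * eta by rewrite expr2 mulrA ler_wpM2r.
have e6 : 6 * eta <= 1 by nra.
have dm : eta * m%:R <= delta / 2 by nra.
split.
  apply: contra_neq => v0; apply/eqP; rewrite -nrm2_eq0 nrm2E (bigD1 j)//= -/N.
  move: h; rewrite v0 /nrm2 mul0mx mxE => h.
  have h1 : 0 <= (G j j - C * eta ^+ 2 - 1 / 3) * a 0 j ^+ 2 by rewrite mulr_ge0//; lra.
  have h2 : 0 <= (1 - delta / 4 - eta * m%:R - 1 / 4) * N by rewrite mulr_ge0//; lra.
  rewrite eq_le addr_ge0// andbT; lra.
set A := \sum_i a 0 i ^+ 2 / l i.
have nE : nrm2 v = \sum_i a 0 i * (v *m y^T) 0 i.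
  have -> : nrm2 v = (a *m (v *m y^T)^T) 0 0.
    by rewrite /nrm2 [(v *m y^T)^T]trmx_mul trmxK mulmxA.
  by rewrite mxE; apply: eq_bigr => i _; rewrite [_^T _ _]mxE.
have AS : nrm2 v ^+ 2 <= A * S by rewrite nE; exact: weighted_CS.
have key : mu * A <= nrm2 v.
  have AN : l j * A <= a 0 j ^+ 2 + (1 - delta) * N.
    rewrite /A (bigD1 j)//= mulrDr lK lerD2l /N !mulr_sumr.
    apply: ler_sum => i ij.
    have [jli|ilj] := ltnP j i; first by rewrite ha// expr0n mul0r !mulr0.
    have ji : (i < j)%N by rewrite ltn_neqAle ilj ij.
    rewrite mulrC -mulrA (mulrC (1 - delta)) ler_wpM2l ?sqr_ge0// mulrC ler_pdivrMr//.
    exact: lgap.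
  have g0 : 0 <= G j j - C * eta ^+ 2 by lra.
  apply: (@le_trans _ _ ((G j j - C * eta ^+ 2) * (a 0 j ^+ 2 + (1 - delta) * N))).
    have -> : mu * A = (G j j - C * eta ^+ 2) * (l j * A) by rewrite /mu; ring.
    by rewrite ler_wpM2l.
  have : (1 + eta) * (1 - delta) * N <= (1 - delta / 4 - eta * m%:R) * N.
    by rewrite ler_wpM2r//; nra.
  have : (G j j - C * eta ^+ 2) * (1 - delta) * N <= (1 + eta) * (1 - delta) * N.
    rewrite ler_wpM2r// ler_wpM2r//; first lra.
    have := mulr_ge0 (ltW delta0) eta0; have : 0 <= C * eta ^+ 2.
      by rewrite mulr_ge0 ?sqr_ge0// divr_ge0 ?mulr_ge0// ltW.
    lra.
  lra.
have [v0|vp] := eqVneq (nrm2 v) 0.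
  by rewrite v0 mulr0 sumr_ge0// => i _; rewrite mulr_ge0 ?sqr_ge0// ltW.
have v1 : 0 < nrm2 v by rewrite lt_def vp nrm2_ge0.
have S0 : 0 <= S by apply: sumr_ge0 => i _; rewrite mulr_ge0 ?sqr_ge0// ltW.
have A0 : 0 <= A by apply: sumr_ge0 => i _; rewrite divr_ge0 ?sqr_ge0// ltW.
have [mu0|mu0] := leP mu 0; first by apply: le_trans S0; rewrite mulr_le0_ge0 ?nrm2_ge0.
have : mu * nrm2 v ^+ 2 <= nrm2 v * S.
  apply: le_trans (ler_wpM2l (ltW mu0) AS) _.
  by rewrite mulrA ler_wpM2r.
by rewrite expr2 mulrA mulrC ler_pM2l.
Qed.

Lemma eig_perturb (j : 'I_m) (k : 'I_p) : k = j :> nat ->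
  `|(eigvals (K^T *m K))`_k - l j * G j j - t| <= theta + C * l j * eta ^+ 2.
Proof.
move: (delta0) (delta1) (eta0) (eta_small) (t0) (theta0) => d0 d1 e0 es tt th kj; have mj := m0 j.
have Gjj : 1 - eta <= G j j.
  have := Geta j j; rewrite eqxx => /ler_normlP[h1 h2]; move: h1 h2; rewrite /=; lra.
have c0 : 0 <= C * eta ^+ 2 by rewrite mulr_ge0 ?sqr_ge0// divr_ge0 ?mulr_ge0// ltW.
have up : (eigvals (K^T *m K))`_k <= l j * (G j j + C * eta ^+ 2) + t + theta.
  have km : (k <= m)%N by rewrite kj ltnW.
  apply: (eigvals_gram_le (k := k) (C := \matrix_(a, b) y (widen_ord km b) a)).
    have : 0 <= l j * (G j j + C * eta ^+ 2) by rewrite mulr_ge0 ?ltW//; nra.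
    lra.
  move=> v vC; have := Kt v => /ler_normlP[_].
  have := @top_form_le j v => /(_ _) h.
  rewrite !mulrDl => h'.
  have : \sum_i l i * (v *m y^T) 0 i ^+ 2 <= l j * (G j j + C * eta ^+ 2) * nrm2 v.
    apply: h => i; rewrite -kj => ik.
    have /rowP/(_ (Ordinal ik)) := vC; rewrite !mxE => e.
    rewrite -[RHS]e; apply: eq_bigr => b _; rewrite !mxE; congr (_ * _).
    have -> : widen_ord km (Ordinal ik) = i by exact/val_inj.
    by [].
  lra.
have dn : l j * (G j j - C * eta ^+ 2) + t - theta <= (eigvals (K^T *m K))`_k.
  have [W [WW W0]] := @initial_mx R _ j.
  move: k kj up; case=> k kp /= kj; subst k => up.
  have hW (a : 'rV[R]_j.+1) := @top_form_ge j (a *m W) (W0 a).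
  apply: (eigvals_gram_ge (k := Ordinal kp) (V := W *m y)) => a.
    move=> a0; rewrite mulmxA; apply: (hW a).1.
    by rewrite -nrm2_gt0 nrm2_isom// nrm2_gt0.
  rewrite mulmxA; have := (hW a).2; have := Kt (a *m W *m y) => /ler_normlP[h _].
  rewrite !mulrDl mulNr; lra.
apply/ler_normlP; split; lra.
Qed.

End eig_perturbation.

(** * Measurability of eigenvalues *)

Section eigvals_measurable.
Context {R : realType}.

Definition mx_dist p (A B : 'M[R]_p) : R := \sum_i \sum_j `|A i j - B i j|.

Lemma qf_dist p (A B : 'M[R]_p) (u : 'rV[R]_p) :
  qf A u - mx_dist A B * nrm2 u <= qf B u.
Proof.
have coord i : `|u 0 i| ^+ 2 <= nrm2 u.
  rewrite nrm2E real_normK ?num_real// (bigD1 i)//= lerDl sumr_ge0// => k _.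
  exact: sqr_ge0.
rewrite lerBlDl -lerBlDr !qfE /mx_dist mulr_suml -sumrB; apply: ler_sum => i _.
rewrite mulr_suml -sumrB; apply: ler_sum => j _.
have -> : u 0 i * A i j * u 0 j - u 0 i * B i j * u 0 j =
  (A i j - B i j) * (u 0 i * u 0 j) by ring.
apply: le_trans (ler_norm _) _; rewrite normrM ler_wpM2l// normrM.
have := coord i; have := coord j; have := sqr_ge0 (`|u 0 i| - `|u 0 j|).
lra.
Qed.

(** An optimal test space for [A] also serves for [B]: on it the forms differ by at most
    [mx_dist A B] times the squared norm. *)
Lemma eigvals_lipschitz p (A B : 'M[R]_p) (k : 'I_p) : A^T = A -> B^T = B ->
  (eigvals A)`_k - mx_dist A B <= (eigvals B)`_k.
Proof.
move=> sA sB; have [V [VV hV]] := eigvals_test_space k sA.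
apply: (minmax_ge (k := k) (B := V) sB) => a.
  by move=> a0; rewrite -nrm2_gt0 nrm2_isom// nrm2_gt0.
apply: le_trans (qf_dist A B _); rewrite mulrBl lerD2r; exact: hV.
Qed.

Lemma mx_dist_sym p (A B : 'M[R]_p) :
  mx_dist (A + A^T) (B + B^T) <= 2 * mx_dist A B.
Proof.
have -> : 2 * mx_dist A B = mx_dist A B + \sum_i \sum_j `|A j i - B j i|.
  by rewrite exchange_big/= mulr2n mulrDl mul1r.
rewrite /mx_dist -big_split/=; apply: ler_sum => i _.
rewrite -big_split/=; apply: ler_sum => j _.
rewrite !mxE; apply: le_trans _ (ler_normD _ _).
by rewrite opprD addrACA.
Qed.

Lemma mx_distC p (A B : 'M[R]_p) : mx_dist A B = mx_dist B A.
Proof. by apply: eq_bigr => i _; apply: eq_bigr => j _; rewrite distrC. Qed.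

Lemma mx_dist_rat p (A : 'M[R]_p) (e : R) : 0 < e ->
  exists q : 'M[rat]_p, mx_dist A (map_mx ratr q) < e.
Proof.
(* The successor makes the final inequality strict and covers [p = 0]. *)
move=> e0; pose d : R := e / (p * p).+1%:R.
have d0 : 0 < d by rewrite divr_gt0.
have h (x : R) : exists q : rat, `|x - ratr q| < d.
  have /rat_in_itvoo[q] : x - d < x + d by rewrite ltrD2l gtrN.
  rewrite inE /= => /itvP h; exists q; rewrite distrC ltr_distl.
  by rewrite !h.
exists (\matrix_(i, j) sval (cid (h (A i j)))).
apply: (@le_lt_trans _ _ (\sum_(i < p) \sum_(j < p) d)).
  apply: ler_sum => i _; apply: ler_sum => j _; rewrite !mxE.
  by case: cid => q /= /ltW.
rewrite !sumr_const !card_ord -mulrnA -[_ *+ _]mulr_natr /d mulrAC ltr_pdivrMr//.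
by rewrite ltr_pM2l// ltr_nat.
Qed.

(** A Lipschitz function is governed by its values on a countable dense set: the eigenvalue exceeds
    [c] exactly when some rational [q] satisfies [mx_dist (A w) q < f q - c]. Rational
    approximations need not be symmetric, hence [sym], which fixes [A w] and does not increase
    distances. *)
Lemma measurable_eigvals d (T : measurableType d) p (A : T -> 'M[R]_p) (k : 'I_p) :
  (forall i j, measurable_fun setT (fun w => A w i j)) -> (forall w, (A w)^T = A w) ->
  measurable_fun setT (fun w => (eigvals (A w))`_k).
Proof.
move=> mA sA.
pose sym (B : 'M[R]_p) := 2^-1 *: (B + B^T).
pose f (q : 'M[rat]_p) : R := (eigvals (sym (map_mx ratr q)))`_k.
have symq B : (sym B)^T = sym B.
  by rewrite /sym linearZ linearD/= trmxK addrC.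
have symA w : sym (A w) = A w.
  by rewrite /sym sA; apply/matrixP => i j; rewrite !mxE; field.
have dist2 B C : mx_dist (sym B) (sym C) <= mx_dist B C.
  have -> : mx_dist (sym B) (sym C) = 2^-1 * mx_dist (B + B^T) (C + C^T).
    rewrite /mx_dist mulr_sumr; apply: eq_bigr => i _; rewrite mulr_sumr.
    apply: eq_bigr => j _; rewrite !mxE -mulrBr normrM ger0_norm//.
  by rewrite ler_pdivrMl// mx_dist_sym.
have low w q : f q - mx_dist (A w) (map_mx ratr q) <= (eigvals (A w))`_k.
  apply: le_trans (_ : (eigvals (sym (A w)))`_k <= _); last by rewrite symA.
  apply: le_trans (eigvals_lipschitz k (symq (map_mx ratr q)) (symq (A w))).
  by rewrite lerD2l lerN2 (mx_distC (A w)) dist2.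
have upp w q : (eigvals (A w))`_k - mx_dist (A w) (map_mx ratr q) <= f q.
  rewrite -[X in (eigvals X)`_k - _]symA.
  apply: le_trans (eigvals_lipschitz k (symq (A w)) (symq (map_mx ratr q))).
  by rewrite lerD2l lerN2 dist2.
move=> mD; apply: (measurability _ (RGenOInfty.measurableE R)) => //.
move=> _ [_ [c ->] <-]; rewrite setTI.
have -> : (fun w => (eigvals (A w))`_k) @^-1` `]c, +oo[%classic =
    \bigcup_n [set w | match unpickle n with
      | Some q => mx_dist (A w) (map_mx ratr q) < f q - c | None => false end].
  apply/seteqP; split => [w /=|w [n _ /=]]; rewrite in_itv/= andbT.
    move=> cw; have e0 : 0 < ((eigvals (A w))`_k - c) / 2 by rewrite divr_gt0// subr_gt0.
    have [q hq] := mx_dist_rat (A w) e0.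
    exists (pickle q) => //=; rewrite pickleK ltrBrDr.
    apply: lt_le_trans (upp w q); rewrite ltrBrDr.
    by move: (mx_dist _ _) hq => x; lra.
  case: (unpickle n) => // q; rewrite ltrBrDr -ltrBrDl => /lt_le_trans; apply.
  exact: low.
apply: bigcupT_measurable => n; case: (unpickle n) => [q|]; last first.
  by rewrite (_ : [set _ | _] = set0)//; apply/seteqP; split.
rewrite (_ : [set _ | _] = setT `&` (fun w => mx_dist (A w) (map_mx ratr q)) @^-1` `]-oo, f q - c[%classic).
  have : measurable_fun setT (fun w => mx_dist (A w) (map_mx ratr q)); last by apply.
  apply: measurable_sum => i; apply: measurable_sum => j.
  by apply: measurableT_comp => //; exact: measurable_funB.
by rewrite setTI; apply/seteqP; split => w /=; rewrite in_itv.
Qed.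

End eigvals_measurable.

(** * Sub-Gaussian moment generating functions *)

Section series_domination.
Context {d} {T : measurableType d} {R : realType} (P : probability T R).

(** Tonelli for a dominating series. It serves for an exponential against its Taylor series and, in
    [exp_sq_of_mgf], against a series of exponentials. *)
Lemma intg_series (X : T -> R) (F : nat -> T -> R) (c : R) :
  0 < c -> measurable_fun setT X -> (forall w, 0 <= X w) ->
  (forall n, measurable_fun setT (F n)) -> (forall n w, 0 <= F n w) ->
  (forall w, ((X w)%:E <= \sum_(n <oo) (F n w)%:E)%E) ->
  (forall n, (\int[P]_w (F n w)%:E <= (c / 2 ^+ n)%:E)%E) ->
  intg P X /\ mean P X <= 2 * c.
Proof.
move=> c0 mX X0 mF F0 XF hF.
have key : (\int[P]_w (X w)%:E <= (2 * c)%:E)%E.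
  apply: (@le_trans _ _ (\int[P]_w \sum_(n <oo) (F n w)%:E)%E).
    apply: ge0_le_integral => //.
    - by move=> w _; rewrite lee_fin.
    - exact/measurable_EFinP.
    - apply: ge0_emeasurable_sum => [n w _ _|n _]; first by rewrite lee_fin.
      exact/measurable_EFinP.
  rewrite integral_nneseries//; last 2 first.
  - by move=> n; exact/measurable_EFinP.
  - by move=> n w _; rewrite lee_fin.
  have -> : (2 * c)%:E = (\sum_(n <oo) ((2 * c) / (2 ^ (n + 1))%:R)%:E)%E.
    apply/esym/cvg_lim => //.
    have := @cvg_geometric_eseries_half R (2 * c) 0%N; rewrite expr0 divr1.
    by under eq_fun do rewrite /eseries /=.
  apply: lee_nneseries => [n _ _|n _].
    by apply: integral_ge0 => w _; rewrite lee_fin.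
  apply: le_trans (hF n) _; rewrite lee_fin addn1 expnS natrM natrX.
  by rewrite le_eqVlt; apply/orP; left; apply/eqP; field; rewrite expf_neq0.
have iX : intg P X.
  apply/integrableP; split; first exact/measurable_EFinP.
  under eq_integral do rewrite gee0_abs ?lee_fin//.
  exact: le_lt_trans key (ltry _).
by split => //; rewrite -lee_fin mean_integral.
Qed.

End series_domination.

Section exp_moments.
Context {R : realType}.

(** At this rate the [n]-th Taylor term of the mean of [exp (a X^2)] is at most [2^(-n)]: the
    moments [(2 n C^2)^n] of [psi2_moment] meet [n^n <= e^n n!]. *)
Definition sq_rate (C : R) : R := (4 * expR 1 * C ^+ 2)^-1.

Lemma natpow_fact (n : nat) : (n%:R : R) ^+ n <= expR 1 ^+ n * n`!%:R.
Proof.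
case: n => [|n]; first by rewrite !expr0 fact0 mulr1.
have := @expR_ge1Dxn R n.+1%:R n (ler0n _ _).
rewrite -[X in expR X]mulr1 expRM_natl => h.
rewrite -ler_pdivrMr ?ltr0n ?fact_gt0//; apply: le_trans h.
by rewrite lerDr.
Qed.

Lemma psi2_moment d (T : measurableType d) (Q : probability T R) (X : T -> R) (C : R) (n : nat) :
  0 < C -> (0 < n)%N -> (psi2_norm Q X <= C%:E)%E ->
  (\int[Q]_w ((X w ^+ 2) ^+ n)%:E <= ((C ^+ 2 * (2 * n%:R)) ^+ n)%:E)%E.
Proof.
move=> C0 n0 h.
pose q : R := (2 * n)%:R.
have q1 : 1 <= q by rewrite ler1n muln_gt0.
have q0 : 0 < q by apply: lt_le_trans q1.
have hq : ('N[Q]_(q%:E)[EFin \o X] <= (C * q `^ 2^-1)%:E)%E.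
  have : ((q `^ (- 2^-1))%:E * 'N[Q]_(q%:E)[EFin \o X] <= C%:E)%E.
    by apply: le_trans h; apply: ereal_sup_ubound; exists q.
  rewrite powRN lee_pdivrMl ?powR_gt0// EFinM muleC; apply.
have := @powR_Lnorm _ T R Q (EFin \o X) q (lt0r_neq0 q0).
have -> : (\int[Q]_x `|(EFin \o X) x| `^ q = \int[Q]_w ((X w ^+ 2) ^+ n)%:E)%E.
  apply: eq_integral => w _ /=; rewrite ?poweR_EFin powR_mulrn// exprM real_normK//.
  exact: num_real.
move=> <-.
have -> : ((C ^+ 2 * (2 * n%:R)) ^+ n)%:E = ((C * q `^ 2^-1)%:E `^ q)%E.
  rewrite poweR_EFin powR_mulrn ?mulr_ge0 ?powR_ge0 ?(ltW C0)// exprM.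
  congr (_ ^+ _)%:E; rewrite exprMn.
  by rewrite powR12_sqrt ?(ltW q0)// sqr_sqrtr ?(ltW q0)// /q natrM.
apply: gt0_ler_poweR => //.
  by rewrite in_itv/= Lnorm_ge0 leey.
by rewrite in_itv/= leey andbT lee_fin mulr_ge0 ?powR_ge0// ltW.
Qed.

Lemma exp_sq_psi2 d (T : measurableType d) (Q : probability T R) (X : T -> R) (C : R) :
  0 < C -> measurable_fun setT X -> (psi2_norm Q X <= C%:E)%E ->
  intg Q (fun w => expR (sq_rate C * X w ^+ 2)) /\
  mean Q (fun w => expR (sq_rate C * X w ^+ 2)) <= 2.
Proof.
move=> C0 mX h; set a := sq_rate C.
have a0 : 0 < a by rewrite invr_gt0 !mulr_gt0 ?expR_gt0// exprn_gt0.
rewrite -[X in _ /\ _ <= X]mulr1.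
have mX2 : measurable_fun setT (fun w => X w ^+ 2) by exact: measurable_funX.
apply: (@intg_series _ _ _ _ _ (fun n w => (a * X w ^+ 2) ^+ n / n`!%:R)) => //.
- by apply: measurableT_comp => //; exact: measurable_funM.
- by move=> n; apply: measurable_funM => //; apply: measurable_funX; exact: measurable_funM.
- by move=> n w; rewrite divr_ge0// exprn_ge0// mulr_ge0 ?sqr_ge0// ltW.
- move=> w; rewrite le_eqVlt; apply/orP; left; apply/eqP/esym/cvg_lim => //.
  rewrite /expR; apply: cvg_EFin; first by apply: nearW => n; rewrite sumEFin.
  rewrite (_ : _ \o _ = series (exp_coeff (a * X w ^+ 2))).
    exact: is_cvg_series_exp_coeff.
  by apply/funext => n /=; rewrite sumEFin.
- case=> [|n].
    under eq_integral do rewrite expr0 fact0 divr1.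
    by rewrite integral_cst// mul1e expr0 divr1; apply: probability_le1.
  under eq_integral do rewrite exprMn mulrAC EFinM.
  rewrite ge0_integralZl//; last 3 first.
  - by apply/measurable_EFinP; exact: measurable_funX.
  - by move=> w _; rewrite lee_fin exprn_ge0// sqr_ge0.
  - by rewrite lee_fin divr_ge0// exprn_ge0// ltW.
  apply: le_trans (lee_wpmul2l _ (psi2_moment C0 (ltn0Sn n) h)) _.
    by rewrite lee_fin divr_ge0// exprn_ge0// ltW.
  rewrite -EFinM lee_fin mul1r.
  rewrite mulrAC -exprMn ler_pdivrMr ?ltr0n ?fact_gt0//.
  have -> : a * (C ^+ 2 * (2 * n.+1%:R)) = n.+1%:R / (2 * expR 1).
    rewrite /a /sq_rate; field; rewrite gt_eqF ?expR_gt0//= gt_eqF//.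
  rewrite exprMn exprVn ler_pdivrMr ?exprn_gt0 ?mulr_gt0 ?expR_gt0//.
  have -> : 2 ^- n.+1 * n.+1`!%:R * (2 * expR 1) ^+ n.+1 = expR 1 ^+ n.+1 * n.+1`!%:R :> R.
    have : (2 : R) ^+ n.+1 != 0 by rewrite expf_neq0.
    rewrite exprMn; move: (2 ^+ n.+1) (expR 1 ^+ n.+1) (n.+1`!%:R : R) => x y z x0.
    by field.
  exact: natpow_fact.
Qed.

End exp_moments.

(** * Elementary inequalities for the exponential *)

Section exp_inequalities.
Context {R : realType}.
Implicit Types x y s a : R.

Lemma expR_le_half x : `|x| <= 2^-1 -> expR x <= 1 + x + 2 * x ^+ 2.
Proof.
move=> /ler_normlP[x1 x2].
have h : 1 - x <= (expR x)^-1 by rewrite -expRN; exact: expR_ge1Dx.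
have p : 0 < 1 - x by lra.
have : expR x <= (1 - x)^-1 by rewrite -[leLHS]invrK lef_pV2 ?posrE ?invr_gt0 ?expR_gt0.
move=> /le_trans; apply; rewrite -[leLHS]mul1r ler_pdivrMr//.
have : 0 <= x ^+ 2 * (1 - 2 * x) by rewrite mulr_ge0 ?sqr_ge0//; lra.
lra.
Qed.

(** Under the mean of a centered variable the linear term disappears and only the exponential of a
    square is left. *)
Lemma expR_le_sq x : expR x <= x + expR (4 * x ^+ 2).
Proof.
have g := expR_ge1Dx (4 * x ^+ 2).
have [xle|xge] := leP `|x| 2^-1.
  by have := expR_le_half xle; have := sqr_ge0 x; lra.
have [x0|x0] := leP 0 x.
  rewrite ger0_norm// in xge.
  apply: (@le_trans _ _ (expR (4 * x ^+ 2))); last by lra.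
  rewrite ler_expR expr2; nra.
rewrite ltr0_norm// in xge.
apply: (@le_trans _ _ 1); first by rewrite -expR0 ler_expR ltW.
nra.
Qed.

Lemma expR_le_quad x : expR x <= 1 + x + 4 * x ^+ 2 * expR `|x|.
Proof.
have e1 : 1 <= expR `|x| by rewrite -expR0 ler_expR.
have x2 := sqr_ge0 x.
have [xle|xge] := leP `|x| 2^-1.
  have := expR_le_half xle.
  have : 4 * x ^+ 2 * 1 <= 4 * x ^+ 2 * expR `|x| by rewrite ler_wpM2l// mulr_ge0.
  lra.
have [x0|x0] := leP 0 x.
  rewrite ger0_norm// in xge e1 *.
  have : 1 * expR x <= 4 * x ^+ 2 * expR x by rewrite ler_wpM2r ?expR_ge0// expr2; nra.
  lra.
rewrite ltr0_norm// in xge e1 *.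
apply: (@le_trans _ _ 1); first by rewrite -expR0 ler_expR ltW.
have : 4 * x ^+ 2 * 1 <= 4 * x ^+ 2 * expR (- x) by rewrite ler_wpM2l// mulr_ge0.
rewrite expr2; nra.
Qed.

(** Convexity, obtained from [1 + u <= exp u] at [u = x - t x] and [u = - t x], weighted by
    [t = s / a] and [1 - t], where [x = a y]. *)
Lemma expR_chord a s y : 0 < a -> 0 <= s -> s <= a ->
  expR (s * y) <= 1 + s / a * (expR (a * y) - 1).
Proof.
move=> a0 s0 sa.
have t1 : s / a <= 1 by rewrite ler_pdivrMr// mul1r.
have t0 : 0 <= s / a by rewrite divr_ge0// ltW.
set t := s / a in t0 t1 *; have -> : s * y = t * (a * y).
  by rewrite /t; field; rewrite gt_eqF.
move: (a * y) => x.
have := expR_ge1Dx (- (t * x)); have := expR_ge1Dx (x - t * x).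
have ex : expR (- (t * x)) = (expR (t * x))^-1 by rewrite expRN.
have ex2 : expR (x - t * x) = expR x * (expR (t * x))^-1 by rewrite expRD expRN.
rewrite ex ex2; have := expR_gt0 (t * x); move: (expR (t * x)) (expR x) => u v u0 h1 h2.
have : t * (1 + (x - t * x)) + (1 - t) * (1 + - (t * x)) <= t * (v * u^-1) + (1 - t) * u^-1.
  by apply: lerD; rewrite ler_wpM2l//; lra.
have -> : t * (1 + (x - t * x)) + (1 - t) * (1 + - (t * x)) = 1 by ring.
have -> : t * (v * u^-1) + (1 - t) * u^-1 = (1 + t * (v - 1)) / u by ring.
by rewrite ler_pdivlMr// mul1r.
Qed.

Lemma sqr_le_expR y : 0 <= y -> y ^+ 2 <= 2 * expR y.
Proof.
move=> y0; have := @expR_ge1Dxn R y 1 y0.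
rewrite (_ : (2`!%:R : R) = 2)// => h.
have : 0 <= y ^+ 2 / 2 by rewrite divr_ge0 ?sqr_ge0.
lra.
Qed.

End exp_inequalities.

Section subgaussian.
Context {d} {T : measurableType d} {R : realType} (P : probability T R).

Definition mgf_le (X : T -> R) (K : R) := forall tau,
  intg P (fun w => expR (tau * X w)) /\
  mean P (fun w => expR (tau * X w)) <= expR (K * tau ^+ 2).

(** For [4 tau^2 <= a], [expR_le_sq] removes the linear term and the chord inequality compares the
    rate [4 tau^2] with [a]. For larger [tau], AM-GM leaves a factor [2 <= e], absorbed since
    [1 <= 4 tau^2 / a]; the total [4 + 1/4] fits below [5]. *)
Lemma mgf_of_exp_sq (X : T -> R) (a : R) : 0 < a -> intg P X -> mean P X = 0 ->
  intg P (fun w => expR (a * X w ^+ 2)) ->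
  mean P (fun w => expR (a * X w ^+ 2)) <= 2 -> mgf_le X (5 / a).
Proof.
move=> a0 iX X0 iE E2 tau.
have mX := intg_measurable iX.
have mE s : measurable_fun setT (fun w => expR (s * X w)).
  by apply: measurableT_comp => //; exact: measurable_funM.
have mS s : measurable_fun setT (fun w => expR (s * X w ^+ 2)).
  by apply: measurableT_comp => //; apply: measurable_funM => //; exact: measurable_funX.
have amgm w : tau * X w <= a * X w ^+ 2 + tau ^+ 2 / (4 * a).
  rewrite -subr_ge0.
  have -> : a * X w ^+ 2 + tau ^+ 2 / (4 * a) - tau * X w = a * (X w - tau / (2 * a)) ^+ 2.
    by field; rewrite gt_eqF.
  by rewrite mulr_ge0 ?sqr_ge0// ltW.
have dom w : expR (tau * X w) <= expR (tau ^+ 2 / (4 * a)) * expR (a * X w ^+ 2).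
  by rewrite -expRD ler_expR addrC.
have idom : intg P (fun w => expR (tau ^+ 2 / (4 * a)) * expR (a * X w ^+ 2)).
  exact: intgZ.
have iT : intg P (fun w => expR (tau * X w)).
  by apply: intg_le idom => // w; rewrite ger0_norm ?expR_ge0.
split => //.
have [small|big] := leP (4 * tau ^+ 2) a.
  have s0 : 0 <= 4 * tau ^+ 2 by rewrite mulr_ge0 ?sqr_ge0.
  pose Y w := tau * X w + (1 + 4 * tau ^+ 2 / a * (expR (a * X w ^+ 2) - 1)).
  have iY2 : intg P (fun w => 4 * tau ^+ 2 / a * (expR (a * X w ^+ 2) - 1)).
    by apply: intgZ; apply: intgB => //; exact: intg_cst.
  have iY1 : intg P (fun w => 1 + 4 * tau ^+ 2 / a * (expR (a * X w ^+ 2) - 1)).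
    by apply: intgD => //; exact: intg_cst.
  have iY0 : intg P (fun w => tau * X w) by exact: intgZ.
  have iY : intg P Y by exact: intgD.
  apply: (@le_trans _ _ (mean P Y)).
    apply: mean_le => // w; apply: le_trans (expR_le_sq _) _.
    by rewrite lerD2l exprMn mulrA; exact: expR_chord.
  rewrite /Y meanD// meanZ// X0 mulr0 add0r meanD//; last exact: intg_cst.
  rewrite mean_cst meanZ; last by apply: intgB => //; exact: intg_cst.
  rewrite meanB//; last exact: intg_cst.
  rewrite mean_cst; apply: le_trans (expR_ge1Dx _).
  rewrite lerD2l.
  have -> : 5 / a * tau ^+ 2 = 4 * tau ^+ 2 / a * 1 + tau ^+ 2 / a by field; rewrite gt_eqF.
  apply: (@le_trans _ _ (4 * tau ^+ 2 / a * 1)).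
    by rewrite ler_wpM2l//; [rewrite divr_ge0// ltW|lra].
  by rewrite lerDl divr_ge0 ?sqr_ge0// ltW.
apply: (@le_trans _ _ (expR (tau ^+ 2 / (4 * a)) * 2)).
  apply: (@le_trans _ _ (mean P (fun w => expR (tau ^+ 2 / (4 * a)) * expR (a * X w ^+ 2)))).
    exact: mean_le.
  by rewrite meanZ// ler_wpM2l// expR_ge0.
apply: (@le_trans _ _ (expR (tau ^+ 2 / (4 * a)) * expR 1)).
  by rewrite ler_wpM2l ?expR_ge0//; exact: expR_ge1Dx.
rewrite -expRD ler_expR.
have -> : 5 / a * tau ^+ 2 = tau ^+ 2 / (4 * a) + (4 * tau ^+ 2) / a + 3 / 4 * (tau ^+ 2 / a).
  by field; rewrite gt_eqF.
have : 1 <= (4 * tau ^+ 2) / a by rewrite ler_pdivlMr// mul1r ltW.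
have : 0 <= tau ^+ 2 / a by rewrite divr_ge0 ?sqr_ge0// ltW.
lra.
Qed.

Lemma mgf_lin (I : finType) (X : I -> T -> R) (c : I -> R) (K : R) :
  (forall i, measurable_fun setT (X i)) -> independent_family P X ->
  (forall i, mgf_le (X i) K) ->
  mgf_le (fun w => \sum_i c i * X i w) (K * \sum_i c i ^+ 2).
Proof.
move=> mX iX hX tau.
pose Y i w := expR (tau * (c i * X i w)).
have mY i : measurable_fun setT (Y i).
  by apply: measurableT_comp => //; apply: measurable_funM => //; exact: measurable_funM.
have iY : independent_family P Y.
  apply: (indep_blocks (g := id) mX iX) => i.
  apply: measurableT_comp => //; apply: measurable_funM => //; apply: measurable_funM => //.
  by apply: gen_sigma_fun.
have YE i : Y i = fun w => expR (tau * c i * X i w).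
  by apply/funext => w; rewrite /Y mulrA.
have e w : expR (tau * \sum_i c i * X i w) = \prod_(i <- enum I) Y i w.
  rewrite mulr_sumr expR_sum -big_enum.
  by apply: eq_bigr.
rewrite (eq_fun e).
have [|h1 h2] := indep_prod_mean mY iY (enum_uniq I).
  by move=> i _; rewrite YE; have [] := hX i (tau * c i).
split => //; rewrite h2 mulrAC mulr_sumr expR_sum.
rewrite big_enum/=; apply: ler_prod => i _; apply/andP; split.
  by apply: mean_ge0 => w; exact: expR_ge0.
rewrite YE; apply: le_trans (hX i (tau * c i)).2 _.
by rewrite exprMn mulrA.
Qed.

(** A discrete version of writing [exp (x^2 / (4 b))] as a Gaussian average of the [exp (t x)]: the
    single term at [k = trunc (|x| / (2 b))] already dominates, the factor [exp b] paying for the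
    rounding. The [1] in [b = K + 1] leaves the summable factor [exp (- k^2)]. *)
Lemma exp_sq_of_mgf (X : T -> R) (K : R) : 0 <= K -> measurable_fun setT X ->
  mgf_le X K ->
  intg P (fun w => expR (X w ^+ 2 / (4 * (K + 1)))) /\
  mean P (fun w => expR (X w ^+ 2 / (4 * (K + 1)))) <= 4 * expR (K + 1).
Proof.
move=> K0 mX h; set b := K + 1.
have b0 : 0 < b by rewrite /b; lra.
have -> : 4 * expR b = 2 * (2 * expR b) by ring.
have mE s : measurable_fun setT (fun w => expR (s * X w)).
  by apply: measurableT_comp => //; exact: measurable_funM.
pose F (k : nat) w := expR (b - b * k%:R ^+ 2) * (expR (k%:R * X w) + expR (- k%:R * X w)).
have mF k : measurable_fun setT (F k).
  by apply: measurable_funM => //; exact: measurable_funD.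
have F0 k w : 0 <= F k w by rewrite mulr_ge0 ?addr_ge0 ?expR_ge0.
apply: (@intg_series _ _ _ _ _ F) => //.
- by rewrite mulr_gt0// expR_gt0.
- apply: measurableT_comp => //; apply: measurable_funM => //; exact: measurable_funX.
- move=> w; pose k := Num.truncn (`|X w| / (2 * b)).
  have k0 : 0 <= `|X w| / (2 * b) by rewrite divr_ge0// mulr_ge0// ltW.
  have /andP[k1 k2] := truncn_itv k0; rewrite -/k in k1 k2.
  apply: (@le_trans _ _ (F k w)%:E).
    rewrite lee_fin /F.
    apply: (@le_trans _ _ (expR (b - b * k%:R ^+ 2) * expR (k%:R * `|X w|))).
      rewrite -expRD ler_expR -subr_ge0.
      have -> : b - b * k%:R ^+ 2 + k%:R * `|X w| - X w ^+ 2 / (4 * b) =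
          b * (1 - (`|X w| / (2 * b) - k%:R) ^+ 2).
        rewrite -[X w ^+ 2]real_normK ?num_real//.
        by field; rewrite gt_eqF.
      rewrite mulr_ge0 ?(ltW b0)// subr_ge0 expr_le1//; rewrite ?subr_ge0//.
      by rewrite lerBlDl natr1 ltW.
    rewrite ler_wpM2l ?expR_ge0//; have [x0|x0] := leP 0 (X w).
      by rewrite ger0_norm// lerDl expR_ge0.
    by rewrite ltr0_norm// mulrN -mulNr lerDr expR_ge0.
  apply: le_trans (nneseries_lim_ge k.+1 (m := 0%N) (P := xpredT) _); last first.
    by move=> n _ _; rewrite lee_fin.
  rewrite big_nat_recr//= leeDr// sume_ge0// => n _; by rewrite lee_fin.
- move=> k.
  have ik : intg P (F k).
    by apply: intgZ; apply: intgD; [have [] := h k%:R|have [] := h (- k%:R)].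
  rewrite -mean_integral// lee_fin meanZ; last first.
    by apply: intgD; [have [] := h k%:R|have [] := h (- k%:R)].
  rewrite meanD; [|by have [] := h k%:R|by have [] := h (- k%:R)].
  apply: (@le_trans _ _ (expR (b - b * k%:R ^+ 2) * (2 * expR (K * k%:R ^+ 2)))).
    rewrite ler_wpM2l ?expR_ge0//.
    have := (h k%:R).2; have := (h (- k%:R)).2; rewrite sqrrN; lra.
  have -> : expR (b - b * k%:R ^+ 2) * (2 * expR (K * k%:R ^+ 2)) =
      2 * expR b * expR (- k%:R ^+ 2).
    rewrite mulrCA -!mulrA -!expRD; congr (_ * expR _).
    by rewrite /b; ring.
  rewrite ler_wpM2l ?mulr_ge0 ?expR_ge0//.
  rewrite expRN lef_pV2 ?posrE ?expR_gt0 ?exprn_gt0//.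
  apply: (@le_trans _ _ (expR 1 ^+ k)).
    have e2 : 2 <= expR (1 : R) by have := expR_ge1Dx (1 : R); lra.
    by rewrite lerXn2r// nnegrE ?expR_ge0.
  rewrite -expRM_natl mulr1 ler_expR -natrX ler_nat.
  by case: (k) => // l; rewrite expnS expn1 leq_pmulr.
Qed.

(** After a Taylor expansion the linear term has mean zero. With [u = X^2 + r], the square and the
    exponential in the remainder cost a multiple of [exp (b u / 2)] each, and together [exp (b u)],
    which is at most [exp b * exp (b X^2)] as [r <= 1]. *)
Lemma mgf_centered_sq (X : T -> R) (b B r tau : R) :
  0 < b -> measurable_fun setT X -> r <= 1 ->
  intg P (fun w => expR (b * X w ^+ 2)) ->
  mean P (fun w => expR (b * X w ^+ 2)) <= B ->
  intg P (fun w => X w ^+ 2) -> mean P (fun w => X w ^+ 2) = r ->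
  `|tau| <= b / 2 ->
  intg P (fun w => expR (tau * (X w ^+ 2 - r))) /\
  mean P (fun w => expR (tau * (X w ^+ 2 - r))) <=
    expR (32 * expR b * B / b ^+ 2 * tau ^+ 2).
Proof.
move=> b0 mX r1 iE EB i2 E2 taub.
have r0 : 0 <= r by rewrite -E2; apply: mean_ge0 => w; exact: sqr_ge0.
pose C := 32 * expR b / b ^+ 2.
have mS s : measurable_fun setT (fun w => expR (s * (X w ^+ 2 - r))).
  apply: measurableT_comp => //; apply: measurable_funM => //.
  by apply: measurable_funB => //; exact: measurable_funX.
pose Y w := 1 + tau * (X w ^+ 2 - r) + C * tau ^+ 2 * expR (b * X w ^+ 2).
have i0 : intg P (fun w => X w ^+ 2 - r) by apply: intgB => //; exact: intg_cst.
have i1 : intg P (fun w => 1 + tau * (X w ^+ 2 - r)).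
  by apply: intgD; [exact: intg_cst|exact: intgZ].
have i3 : intg P (fun w => C * tau ^+ 2 * expR (b * X w ^+ 2)) by exact: intgZ.
have iY : intg P Y by exact: intgD.
have dom w : expR (tau * (X w ^+ 2 - r)) <= Y w.
  apply: le_trans (expR_le_quad _) _; rewrite lerD2l.
  set u := X w ^+ 2 + r.
  have u0 : 0 <= u by rewrite addr_ge0 ?sqr_ge0.
  have xu : `|X w ^+ 2 - r| <= u.
    by apply/ler_normlP; rewrite /u; have := sqr_ge0 (X w); split; lra.
  have tu : `|tau * (X w ^+ 2 - r)| <= b / 2 * u by rewrite normrM ler_pM.
  have -> : (tau * (X w ^+ 2 - r)) ^+ 2 = tau ^+ 2 * `|X w ^+ 2 - r| ^+ 2.
    by rewrite exprMn real_normK ?num_real.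
  have h1 : `|X w ^+ 2 - r| ^+ 2 <= 8 / b ^+ 2 * expR (b / 2 * u).
    apply: (@le_trans _ _ (u ^+ 2)); first by rewrite lerXn2r// nnegrE.
    have bu : 0 <= b / 2 * u by rewrite mulr_ge0// divr_ge0// ltW.
    have := sqr_le_expR bu; rewrite -(ler_pM2l (_ : 0 < 4 / b ^+ 2)); last first.
      by rewrite divr_gt0// exprn_gt0.
    have -> : 4 / b ^+ 2 * (b / 2 * u) ^+ 2 = u ^+ 2 by field; rewrite gt_eqF.
    move=> /le_trans; apply; rewrite le_eqVlt; apply/orP; left; apply/eqP.
    by field; rewrite gt_eqF.
  apply: (@le_trans _ _ (4 * (tau ^+ 2 * (8 / b ^+ 2 * expR (b / 2 * u))) * expR (b / 2 * u))).
    apply: ler_pM; rewrite ?expR_ge0 ?ler_expR//.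
      by apply: mulr_ge0 => //; apply: mulr_ge0; exact: sqr_ge0.
    by rewrite ler_wpM2l// ler_wpM2l ?sqr_ge0.
  have -> : 4 * (tau ^+ 2 * (8 / b ^+ 2 * expR (b / 2 * u))) * expR (b / 2 * u) =
      32 / b ^+ 2 * tau ^+ 2 * (expR (b / 2 * u) * expR (b / 2 * u)) by ring.
  rewrite -expRD.
  have -> : C * tau ^+ 2 * expR (b * X w ^+ 2) = 32 / b ^+ 2 * tau ^+ 2 * expR (b + b * X w ^+ 2).
    by rewrite /C expRD; ring.
  rewrite ler_wpM2l ?ler_expR//; last by rewrite /u; nra.
  by rewrite mulr_ge0 ?sqr_ge0// divr_ge0// sqr_ge0.
have iT : intg P (fun w => expR (tau * (X w ^+ 2 - r))).
  by apply: intg_le iY => // w; rewrite ger0_norm ?expR_ge0.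
split => //; apply: (@le_trans _ _ (mean P Y)); first exact: mean_le.
rewrite /Y meanD// meanD; [|exact: intg_cst|exact: intgZ].
rewrite mean_cst meanZ// meanB//; last exact: intg_cst.
rewrite E2 mean_cst subrr mulr0 addr0 meanZ//.
apply: le_trans (expR_ge1Dx _); rewrite lerD2l.
have -> : 32 * expR b * B / b ^+ 2 * tau ^+ 2 = C * tau ^+ 2 * B by rewrite /C; ring.
rewrite ler_wpM2l// mulr_ge0 ?sqr_ge0// divr_ge0 ?sqr_ge0// mulr_ge0// expR_ge0.
Qed.

End subgaussian.

(** * Operator norm of the noise *)

Section second_moments.
Context {d} {T : measurableType d} {R : realType} (P : probability T R).
Variables (I : finType) (X : I -> T -> R).
Hypothesis mX : forall i, measurable_fun setT (X i).
Hypothesis iX : independent_family P X.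

Lemma indep_pair_mean i j (f g : R -> R) : i != j ->
  measurable_fun setT f -> measurable_fun setT g ->
  intg P (f \o X i) -> intg P (g \o X j) ->
  intg P (fun w => f (X i w) * g (X j w)) /\
  mean P (fun w => f (X i w) * g (X j w)) = mean P (f \o X i) * mean P (g \o X j).
Proof.
move=> ij mf mg ii ij'; apply: indep2_mean => //.
apply: (@indep2_disjoint _ _ _ _ _ _ mX iX (fun k => k == i) (fun k => k == j)).
- by move=> k /eqP -> /eqP e; rewrite e eqxx in ij.
- by apply: measurableT_comp => //; apply: gen_sigma_fun => /=.
- by apply: measurableT_comp => //; apply: gen_sigma_fun => /=.
Qed.

Hypothesis intX : forall i, intg P (X i).
Hypothesis X0 : forall i, mean P (X i) = 0.
Hypothesis intX2 : forall i, intg P (fun w => X i w ^+ 2).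
Hypothesis X1 : forall i, mean P (fun w => X i w ^+ 2) = 1.

Lemma mean_sq_lin (c : I -> R) :
  intg P (fun w => (\sum_i c i * X i w) ^+ 2) /\
  mean P (fun w => (\sum_i c i * X i w) ^+ 2) = \sum_i c i ^+ 2.
Proof.
have pair i j : intg P (fun w => X i w * X j w) /\
    mean P (fun w => X i w * X j w) = (i == j)%:R.
  have [<-|ij] := eqVneq i j; first by split; [exact: intX2|exact: X1].
  have [h1 h2] := @indep_pair_mean i j id id ij (@measurable_id _ _ _)
    (@measurable_id _ _ _) (intX i) (intX j).
  by split => //; rewrite h2 X0 mul0r.
have e w : (\sum_i c i * X i w) ^+ 2 = \sum_i \sum_j (c i * c j) * (X i w * X j w).
  rewrite expr2 mulr_suml; apply: eq_bigr => i _; rewrite mulr_sumr.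
  by apply: eq_bigr => j _; ring.
rewrite (eq_fun e).
have ij i j : intg P (fun w => (c i * c j) * (X i w * X j w)).
  by apply: intgZ; have [] := pair i j.
have ii i : intg P (fun w => \sum_j (c i * c j) * (X i w * X j w)) by exact: intg_sum.
split; first exact: intg_sum.
rewrite mean_sum//; apply: eq_bigr => i _; rewrite mean_sum// (bigD1 i)//=.
rewrite meanZ ?(pair _ _).2 ?eqxx ?mulr1; last by have [] := pair i i.
rewrite big1 ?addr0 ?expr2// => j ji.
rewrite meanZ ?(pair _ _).2 1?eq_sym ?(negbTE ji) ?mulr0//; by have [] := pair i j.
Qed.

End second_moments.

Section union_bound.
Context {d} {T : measurableType d} {R : realType} (P : probability T R).

Lemma prob_le (A B : set T) : measurable A -> measurable B -> A `<=` B ->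
  (P A <= P B)%E.
Proof. by move=> mA mB AB; apply: le_measure; rewrite ?inE. Qed.

Lemma union_bound (I : finType) (Q : pred I) (F : I -> set T) (c : R) :
  0 <= c -> (forall i, measurable (F i)) -> (forall i, Q i -> (P (F i) <= c%:E)%E) ->
  measurable [set w | exists2 i, Q i & F i w] /\
  (P [set w | exists2 i, Q i & F i w] <= (\sum_(i | Q i) c)%:E)%E.
Proof.
move=> c0 mF hF.
have e : [set w | exists2 i, Q i & F i w] = \big[setU/set0]_(i <- enum Q) F i.
  rewrite -bigcup_seq; apply/seteqP; split => w /=.
    by move=> [i Qi Fi]; exists i => //=; rewrite mem_enum.
  by move=> [i /=]; rewrite mem_enum => Qi Fi; exists i.
rewrite e -big_enum/=.
have : all Q (enum Q) by apply/allP => i; rewrite mem_enum.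
elim: (enum Q) => [_|i r IH /= /andP[Qi /IH[m1 m2]]].
  by rewrite !big_nil measure0; split => //; exact: measurable0.
rewrite !big_cons; split; first exact: measurableU.
apply: le_trans (measureU2 P (mF i) m1) _.
by rewrite EFinD leeD// hF.
Qed.

End union_bound.

(** * A grid as a net of the unit sphere *)

Section net.
Context {R : realType}.

Lemma qf_polar n (A : 'M[R]_n) (theta : R) (a b : 'rV[R]_n) : A^T = A ->
  (forall v, `|qf A v| <= theta * nrm2 v) ->
  `|2 * (a *m A *m b^T) 0 0| <= theta * (nrm2 a + nrm2 b).
Proof.
move=> sA h.
have := h (a + b); have := h (a - b); rewrite !nrm2D !qfD// linearN/= !mulmxN nrm2N.
have -> : qf A (- b) = qf A b by rewrite -scaleN1r qfZ sqrrN expr1n mul1r.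
have neg (M : 'M[R]_1) : (- M) 0 0 = - M 0 0 by rewrite mxE.
rewrite !neg; move: ((a *m A *m b^T) 0 0) ((a *m b^T) 0 0) => x y.
move=> /ler_normlP[h1 h2] /ler_normlP[h3 h4]; apply/ler_normlP; split; lra.
Qed.

(* A maximizer u of |qf A| over the sphere is replaced by a grid point x within
   distance 1/4; the error is absorbed since 2 (1/4) + (1/4)^2 < 2/3. *)
Lemma net_bound n (A : 'M[R]_n) (mu : R) (S : set 'rV[R]_n) : (0 < n)%N -> A^T = A ->
  (forall v, nrm2 v = 1 -> exists x, [/\ S x, nrm2 x <= 1 & nrm2 (v - x) <= 16^-1]) ->
  (forall x, S x -> nrm2 x <= 1 -> `|qf A x| <= mu) ->
  forall v, `|qf A v| <= 3 * mu * nrm2 v.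
Proof.
case: n A S => // n A S _ sA net hS.
have [u1 n1 h1] := exists_max_qf A; have [u2 n2 h2] := exists_max_qf (- A).
have qN v : qf (- A) v = - qf A v by rewrite /qf mulmxN mulNmx mxE.
pose t := Num.max (qf A u1) (- qf A u2).
have ht v : `|qf A v| <= t * nrm2 v.
  have hv := nrm2_ge0 v; apply/ler_normlP; split.
    by rewrite -qN; apply: le_trans (h2 v) _; rewrite qN ler_wpM2r// le_max lexx orbT.
  by apply: le_trans (h1 v) _; rewrite ler_wpM2r// le_max lexx.
have [u nu tu] : exists2 u, nrm2 u = 1 & t <= `|qf A u|.
  rewrite /t; case: leP => _; first by exists u2 => //; rewrite -normrN ler_norm.
  by exists u1 => //; exact: ler_norm.
have t0 : 0 <= t by have := le_trans (normr_ge0 _) (ht u); rewrite nu mulr1.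
have [x [Sx nx ne]] := net u nu.
set e := u - x in ne.
have ue : u = x + e by rewrite /e addrC subrK.
have b1 := hS x Sx nx.
have b2 : `|2 * (x *m A *m e^T) 0 0| <= t / 2.
  have := qf_polar x (4 *: e) sA ht; rewrite nrm2Z linearZ/= -scalemxAr [X in 2 * X]mxE => h.
  have h' : `|2 * (4 * (x *m A *m e^T) 0 0)| <= t * 2.
    by apply: le_trans h _; rewrite ler_wpM2l//; lra.
  move: h' => /ler_normlP[p1 p2]; apply/ler_normlP; split; lra.
have b3 : `|qf A e| <= t / 16 by apply: le_trans (ht e) _; rewrite ler_wpM2l.
have key : t <= 3 * mu.
  have : t <= `|qf A x| + `|2 * (x *m A *m e^T) 0 0| + `|qf A e|.
    apply: le_trans tu _; rewrite ue qfD//.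
    by apply: le_trans (ler_normD _ _) _; rewrite lerD2r ler_normD.
  lra.
by move=> v; apply: le_trans (ht v) _; rewrite ler_wpM2r ?nrm2_ge0.
Qed.

Variable n : nat.
Hypothesis n0 : (0 < n)%N.
Let N := (4 * n)%N.
Let h : R := (4 * Num.sqrt n%:R)^-1.

(** A sign and a multiple of the mesh [h] per coordinate. As [n h^2 = 1/16], an error of [h] in each
    coordinate stays within the radius of [net_bound]; multiples up to [N = 4 n] suffice since
    [1 / h = 4 sqrt n]. *)
Definition grid_index : finType := {ffun 'I_n -> bool * 'I_N.+1}.
Definition grid_point (f : grid_index) : 'rV[R]_n :=
  \row_i ((-1) ^+ (f i).1 * ((f i).2)%:R * h).

Let sn0 : 0 < Num.sqrt (n%:R : R).
Proof. by rewrite sqrtr_gt0 ltr0n. Qed.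
Let h0 : 0 < h.
Proof. by rewrite invr_gt0 mulr_gt0. Qed.
Let h2 : h ^+ 2 = (16 * n%:R)^-1.
Proof. by rewrite exprVn exprMn sqr_sqrtr// -natrX. Qed.

(** Coordinates are rounded towards zero, so the grid point does not leave the unit ball. *)
Lemma grid_net (v : 'rV[R]_n) : nrm2 v = 1 ->
  exists f, nrm2 (grid_point f) <= 1 /\ nrm2 (v - grid_point f) <= 16^-1.
Proof.
move=> v1.
have vi i : `|v 0 i| <= 1.
  rewrite -(@expr_le1 _ 2)// real_normK ?num_real// -v1 nrm2E (bigD1 i)//= lerDl.
  by rewrite sumr_ge0// => j _; exact: sqr_ge0.
pose k i := Num.truncn (`|v 0 i| / h).
have kh i : (k i)%:R * h <= `|v 0 i| < (k i)%:R * h + h.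
  have p : 0 <= `|v 0 i| / h by rewrite divr_ge0// ltW.
  have /andP[k1 k2] := truncn_itv p.
  rewrite -/(k i) in k1 k2; rewrite -ler_pdivlMr// k1/=.
  by rewrite -[X in _ < _ + X]mul1r -mulrDl natr1 -ltr_pdivrMr.
have kN i : (k i < N.+1)%N.
  rewrite ltnS -(ler_nat R) -(ler_pM2r h0); have /andP[k1 _] := kh i.
  apply: le_trans k1 (le_trans (vi i) _).
  rewrite /h ler_pdivlMr ?mulr_gt0// mul1r /N natrM ler_pM2l//.
  rewrite -[leRHS]ger0_norm// -sqrtr_sqr ler_wsqrtr// -natrX ler_nat.
  by case: (n) n0 => // l _; rewrite expnS expn1 leq_pmulr.
exists [ffun i => (v 0 i < 0, Ordinal (kN i))].
set x := grid_point _.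
have xi i : x 0 i = (-1) ^+ (v 0 i < 0)%R * ((k i)%:R * h) by rewrite !mxE ffunE /= mulrA.
split.
  rewrite -v1 !nrm2E; apply: ler_sum => i _; rewrite xi exprMn sqrr_sign mul1r.
  have kh0 : 0 <= (k i)%:R * h by rewrite mulr_ge0 ?ler0n// ltW.
  rewrite -[leRHS]real_normK ?num_real// lerXn2r ?nnegrE//.
  by have /andP[] := kh i.
apply: (@le_trans _ _ (\sum_(i < n) h ^+ 2)); last first.
  by rewrite sumr_const card_ord h2 -[_ *+ n]mulr_natr invfM -mulrA mulVf ?mulr1 ?pnatr_eq0 -?lt0n.
rewrite nrm2E; apply: ler_sum => i _.
have -> : (v - x) 0 i = v 0 i - x 0 i by rewrite mxE [X in _ + X]mxE.
rewrite xi.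
rewrite -[leLHS]real_normK ?num_real// lerXn2r ?nnegrE ?(ltW h0)//.
have /andP[k1 k2] := kh i.
have [v0|v0] := ltP (v 0 i) 0.
  rewrite ltr0_norm// in k1 k2.
  by rewrite expr1 mulN1r opprK; apply/ltW/ltr_normlP; split; lra.
rewrite ger0_norm// in k1 k2.
by rewrite expr0 mul1r; apply/ltW/ltr_normlP; split; lra.
Qed.

(* Counting by exponential weights: sum_i k_i <= 16 n on the grid points of the
   unit ball, and the weights 2^(- k_i) sum up to at most 4 in each coordinate. *)
Lemma grid_card (c : R) : 0 <= c ->
  \sum_(f : grid_index | nrm2 (grid_point f) <= 1) c <= (2 ^+ 18) ^+ n * c.
Proof.
move=> c0.
pose g (x : bool * 'I_N.+1) : R := 2^-1 ^+ x.2.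
have gs : \sum_x g x <= 4.
  rewrite -(pair_bigA _ (fun (b : bool) (l : 'I_N.+1) => g (b, l)))/=.
  have s2 : \sum_(l < N.+1) 2^-1 ^+ l <= 2 :> R.
    have := @subrX1 R 2^-1 N.+1; rewrite -(big_mkord xpredT (fun l => 2^-1 ^+ l)).
    rewrite big_mkord => e.
    have : 0 <= 2^-1 ^+ N.+1 :> R by rewrite exprn_ge0.
    lra.
  rewrite big_bool /g/=; lra.
have key (f : grid_index) : nrm2 (grid_point f) <= 1 -> 1 <= 2 ^+ (16 * n) * \prod_i g (f i).
  move=> fb.
  have : (\sum_i (f i).2 <= 16 * n)%N.
    rewrite -(ler_nat R) natr_sum.
    have : \sum_i ((f i).2%:R : R) ^+ 2 <= 16 * n%:R.
      move: fb; rewrite nrm2E.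
      rewrite (eq_bigr (fun i => ((f i).2%:R : R) ^+ 2 * h ^+ 2)) => [|i _]; last first.
        by rewrite mxE -mulrA exprMn sqrr_sign mul1r exprMn.
      by rewrite -mulr_suml h2 ler_pdivrMr ?mul1r// mulr_gt0// ltr0n.
    rewrite natrM; apply: le_trans; apply: ler_sum => i _.
    by rewrite -natrX ler_nat; case: (nat_of_ord _) => // l; rewrite expnS expn1 leq_pmulr.
  move=> s16; rewrite /g -expr_sum exprVn ler_pdivlMr ?exprn_gt0// mul1r.
  by rewrite ler_eXn2l// ltr1n.
apply: (@le_trans _ _ (\sum_(f : grid_index) 2 ^+ (16 * n) * \prod_i g (f i) * c)).
  rewrite big_mkcond/=; apply: ler_sum => f _; case: ifP => fb.
    by rewrite -[leLHS]mul1r ler_wpM2r// key.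
  by rewrite mulr_ge0// mulr_ge0 ?exprn_ge0// prodr_ge0// => i _; rewrite exprn_ge0.
rewrite -mulr_suml ler_wpM2r// -mulr_sumr.
have -> : \sum_(f : grid_index) \prod_i g (f i) = \prod_(i < n) \sum_x g x.
  by rewrite bigA_distr_bigA.
rewrite prodr_const card_ord.
rewrite (_ : (2 ^+ 18) ^+ n = 2 ^+ (16 * n) * 4 ^+ n :> R).
  rewrite ler_wpM2l ?exprn_ge0// lerXn2r ?nnegrE//.
  by rewrite sumr_ge0// => x _; rewrite exprn_ge0.
have e4 : 4 = 2 ^+ 2 :> R by rewrite -natrX.
by rewrite exprM -exprMn e4 -exprD.
Qed.

End net.

Lemma pair_sum {R : realType} (I J : finType) (F : I * J -> R) :
  \sum_x F x = \sum_i \sum_j F (i, j).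
Proof. by rewrite pair_bigA; apply: eq_bigr => -[]. Qed.

(** * The noise matrix *)

Section operator_norm.
Context {d} {T : measurableType d} {R : realType} (P : probability T R).
Variables (n p : nat) (z : 'I_n * 'I_p -> T -> R) (l : 'I_p -> R) (K C : R).
Hypothesis mz : forall x, measurable_fun setT (z x).
Hypothesis iz : independent_family P z.
Hypothesis intz : forall x, intg P (z x).
Hypothesis z0 : forall x, mean P (z x) = 0.
Hypothesis intz2 : forall x, intg P (fun w => z x w ^+ 2).
Hypothesis z1 : forall x, mean P (fun w => z x w ^+ 2) = 1.
Hypotheses (K0 : 0 <= K) (C0 : 0 < C).
Hypothesis hz : forall x, mgf_le P (z x) K.
Hypothesis l0 : forall k, 0 <= l k <= C.

Let b := (4 * (K + 1))^-1.
(** The constant of [mgf_centered_sq], with [4 * expR (K + 1)] from [exp_sq_of_mgf] as the bound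
    [B]. *)
Definition quad_const : R := 32 * expR b * (4 * expR (K + 1)) / b ^+ 2.
Let Cq := quad_const.

Let b0 : 0 < b.
Proof. by rewrite invr_gt0 mulr_gt0// ltr_wpDl. Qed.

(** The matrix [z diag(l) z^T] minus its mean, which is the sum of the [l k] times the identity. *)
Definition noise (w : T) : 'M[R]_n :=
  \matrix_(i, j) \sum_k l k * (z (i, k) w * z (j, k) w - (i == j)%:R).

Let xi (v : 'rV[R]_n) (k : 'I_p) w := \sum_i v 0 i * z (i, k) w.

Lemma noise_sym w : (noise w)^T = noise w.
Proof.
apply/matrixP => i j; rewrite !mxE; apply: eq_bigr => k _.
by rewrite mulrC [z _ _ * _]mulrC eq_sym mulrC.
Qed.

Lemma qf_noise w v : qf (noise w) v = \sum_k l k * (xi v k w ^+ 2 - nrm2 v).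
Proof.
rewrite qfE.
transitivity (\sum_i \sum_j \sum_k l k * (v 0 i * z (i, k) w * (v 0 j * z (j, k) w)
    - v 0 i * (i == j)%:R * v 0 j)).
  apply: eq_bigr => i _; apply: eq_bigr => j _; rewrite mxE mulr_sumr mulr_suml.
  by apply: eq_bigr => k _; ring.
rewrite (eq_bigr (fun i => \sum_k \sum_j l k * (v 0 i * z (i, k) w * (v 0 j * z (j, k) w)
    - v 0 i * (i == j)%:R * v 0 j))); last by move=> i _; rewrite exchange_big.
rewrite exchange_big/=; apply: eq_bigr => k _.
under eq_bigr do rewrite -mulr_sumr.
rewrite -mulr_sumr; congr (_ * _).
under eq_bigr do rewrite sumrB.
rewrite sumrB; congr (_ - _).
  rewrite /xi expr2 mulr_suml; apply: eq_bigr => i _.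
  by rewrite mulr_sumr.
rewrite nrm2E; apply: eq_bigr => i _; rewrite (bigD1 i)//= eqxx mulr1 big1 ?addr0 ?expr2//.
by move=> j ji; rewrite eq_sym (negbTE ji) mulr0 mul0r.
Qed.

Let col_coef (v : 'rV[R]_n) (k : 'I_p) (x : 'I_n * 'I_p) : R := if x.2 == k then v 0 x.1 else 0.

Let xiE v k w : xi v k w = \sum_x col_coef v k x * z x w.
Proof.
rewrite pair_sum.
apply: eq_bigr => i _; rewrite (bigD1 k)//= /col_coef/= eqxx big1 ?addr0// => j jk.
by rewrite (negbTE jk) mul0r.
Qed.

Let col_coef2 v k : \sum_x col_coef v k x ^+ 2 = nrm2 v.
Proof.
rewrite pair_sum nrm2E.
apply: eq_bigr => i _; rewrite (bigD1 k)//= /col_coef/= eqxx big1 ?addr0// => j jk.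
by rewrite (negbTE jk) expr0n.
Qed.

Let mxi v k : measurable_fun setT (xi v k).
Proof. by apply: measurable_sum => i; exact: measurable_funM. Qed.

Let xi_mean v k : intg P (fun w => xi v k w ^+ 2) /\ mean P (fun w => xi v k w ^+ 2) = nrm2 v.
Proof.
rewrite -(col_coef2 v k); under eq_fun do rewrite xiE.
exact: (mean_sq_lin mz iz intz z0 intz2 z1).
Qed.

Let xi_mgf v k : nrm2 v <= 1 -> mgf_le P (xi v k) K.
Proof.
move=> v1 tau; rewrite (_ : xi v k = fun w => \sum_x col_coef v k x * z x w); last first.
  by apply/funext => w; rewrite xiE.
have [h1 h2] := mgf_lin (col_coef v k) mz iz hz tau.
split => //; apply: le_trans h2 _; rewrite ler_expR col_coef2 ler_wpM2r ?sqr_ge0//.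
by rewrite ler_piMr.
Qed.

(** The variables [xi v k] use disjoint columns of [z], so the moment generating function factors
    over [k]. *)
Lemma mgf_noise v t : nrm2 v <= 1 -> `|t| * C <= b / 2 ->
  intg P (fun w => expR (t * qf (noise w) v)) /\
  mean P (fun w => expR (t * qf (noise w) v)) <= expR (Cq * t ^+ 2 * C ^+ 2 * p%:R).
Proof.
move=> v1 tC.
pose Y k w := expR (t * l k * (xi v k w ^+ 2 - nrm2 v)).
have mY k : measurable_fun setT (Y k).
  apply: measurableT_comp => //; apply: measurable_funM => //.
  by apply: measurable_funB => //; exact: measurable_funX.
have iY : independent_family P Y.
  apply: (indep_blocks (g := fun x : 'I_n * 'I_p => x.2) mz iz) => k.
  apply: measurableT_comp => //; apply: measurable_funM => //.
  apply: measurable_funB => //; apply: measurable_funX.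
  apply: measurable_sum => i; apply: measurable_funM => //.
  by apply: gen_sigma_fun.
have e w : expR (t * qf (noise w) v) = \prod_(k <- enum 'I_p) Y k w.
  rewrite qf_noise mulr_sumr expR_sum -big_enum.
  by apply: eq_bigr => k _; rewrite /Y mulrA.
have hk k : intg P (Y k) /\ mean P (Y k) <= expR (Cq * (t * l k) ^+ 2).
  have [e1 e2] := exp_sq_of_mgf K0 (mxi v k) (xi_mgf k v1).
  have [m1 m2] := xi_mean v k.
  have be w : expR (xi v k w ^+ 2 / (4 * (K + 1))) = expR (b * xi v k w ^+ 2) by rewrite mulrC.
  rewrite (eq_fun be) in e1 e2.
  apply: (mgf_centered_sq b0 (mxi v k) v1 e1 e2 m1 m2).
  have /andP[lk lC] := l0 k.
  by apply: le_trans tC; rewrite normrM ler_wpM2l// ger0_norm.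
rewrite (eq_fun e).
have [|h1 h2] := indep_prod_mean mY iY (enum_uniq 'I_p); first by move=> k _; exact: (hk k).1.
split => //; rewrite h2 big_enum/=.
apply: (@le_trans _ _ (\prod_(k < p) expR (Cq * t ^+ 2 * C ^+ 2))).
  apply: ler_prod => k _; apply/andP; split; first by apply: mean_ge0 => w; exact: expR_ge0.
  apply: le_trans (hk k).2 _; rewrite ler_expR exprMn mulrA.
  have /andP[lk lC] := l0 k.
  rewrite ler_wpM2l//; last by rewrite lerXn2r// nnegrE// ltW.
  by rewrite mulr_ge0 ?sqr_ge0// /Cq /quad_const divr_ge0 ?sqr_ge0// !mulr_ge0// expR_ge0.
by rewrite prodr_const card_ord -expRM_natr.
Qed.

Lemma measurable_qf_noise v : measurable_fun setT (fun w => qf (noise w) v).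
Proof.
under eq_fun do rewrite qf_noise.
apply: measurable_sum => k; apply: measurable_funM => //.
by apply: measurable_funB => //; exact: measurable_funX.
Qed.

Lemma noise_tail v tau s : nrm2 v <= 1 -> 0 <= tau -> tau * C <= b / 2 ->
  measurable [set w | s <= `|qf (noise w) v|] /\
  (P [set w | (s <= `|qf (noise w) v|)%R] <=
    (2 * expR (- (tau * s) + Cq * tau ^+ 2 * C ^+ 2 * p%:R))%:E)%E.
Proof.
move=> v1 t0 tC.
have mq := measurable_qf_noise v.
have side t : t ^+ 2 = tau ^+ 2 -> `|t| * C <= b / 2 ->
    let A := [set w | expR (tau * s) <= expR (t * qf (noise w) v)] in
    measurable A /\ (P A <= (expR (- (tau * s) + Cq * tau ^+ 2 * C ^+ 2 * p%:R))%:E)%E.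
  move=> t2 ht A; have [h1 h2] := mgf_noise v1 ht.
  split.
    rewrite /A -[X in measurable X]setTI; apply: measurable_fun_le => //.
    exact: intg_measurable h1.
  apply: le_trans (markov_mean (expR_gt0 _) h1 (fun w => expR_ge0 _)) _.
  by rewrite lee_fin ler_pdivrMr ?expR_gt0// -expRD addrAC addNr add0r -t2.
have tC1 : `|tau| * C <= b / 2 by rewrite ger0_norm.
have tC2 : `|- tau| * C <= b / 2 by rewrite normrN ger0_norm.
have [mA hA] := side tau erefl tC1.
have [mB hB] := side (- tau) (sqrrN _) tC2.
have mS : measurable [set w | s <= `|qf (noise w) v|].
  by rewrite -[X in measurable X]setTI; apply: measurable_fun_le => //; exact: measurableT_comp.
split => //.
apply: le_trans (prob_le P mS (measurableU _ _ mA mB) _) _.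
  move=> w /= sw; rewrite !ler_expR mulNr -mulrN.
  have [q0|q0] := leP 0 (qf (noise w) v).
    by left; rewrite ler_wpM2l// -[leRHS]ger0_norm.
  by right; rewrite ler_wpM2l// -[leRHS]ltr0_norm.
apply: le_trans (measureU2 P mA mB) _.
rewrite mulr_natl mulr2n EFinD; exact: leeD.
Qed.

Let tau0 := b / (2 * C).
(** Chosen so that at [tau = tau0 * sqrt (n / p)] the Chernoff exponent is exactly [- 20 n]; [tau0]
    is the largest admissible parameter and [n <= p]. As [2 <= e], [exp (- 20 n)] beats the
    [2^(18 n)] grid points with [2^(- n)] to spare. *)
Definition opnorm_const : R := (20 + Cq * tau0 ^+ 2 * C ^+ 2) / tau0.

Lemma opnorm_const_ge0 : 0 <= opnorm_const.
Proof.
have t0 : 0 <= tau0 by rewrite divr_ge0 ?mulr_ge0// ltW.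
have q0 : 0 <= Cq by rewrite /Cq /quad_const divr_ge0 ?sqr_ge0// !mulr_ge0// expR_ge0.
apply: divr_ge0 t0; apply: addr_ge0 (ler0n R 20) _.
exact: mulr_ge0 (mulr_ge0 q0 (sqr_ge0 _)) (sqr_ge0 _).
Qed.

Lemma noise_opnorm : (0 < n)%N -> (n <= p)%N ->
  exists B : set T, [/\ measurable B, (P B <= (2 / 2 ^+ n)%:E)%E &
    forall w, ~ B w -> forall v,
      `|qf (noise w) v| <= 3 * (opnorm_const * Num.sqrt (n%:R * p%:R)) * nrm2 v].
Proof.
move=> n0 np.
have t00 : 0 < tau0 by rewrite divr_gt0// mulr_gt0.
have p0 : (0 < p)%N by exact: leq_trans n0 np.
have np0 : 0 < (n%:R * p%:R : R) by rewrite mulr_gt0// ltr0n.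
pose s := opnorm_const * Num.sqrt (n%:R * p%:R).
pose r : R := Num.sqrt (n%:R * p%:R) / p%:R.
pose tau := tau0 * r.
have r0 : 0 <= r by rewrite divr_ge0.
have r2 : r ^+ 2 * p%:R = n%:R.
  by rewrite expr_div_n sqr_sqrtr ?ltW//; field; rewrite pnatr_eq0 -lt0n.
have r1 : r <= 1.
  rewrite ler_pdivrMr ?ltr0n// mul1r -[leRHS]ger0_norm// -sqrtr_sqr ler_wsqrtr//.
  by rewrite expr2 ler_wpM2r// ler_nat.
have rs : r * Num.sqrt (n%:R * p%:R) = n%:R.
  by rewrite /r mulrAC -expr2 sqr_sqrtr ?ltW//; field; rewrite pnatr_eq0 -lt0n.
have tC : tau * C <= b / 2.
  have -> : tau * C = b / 2 * r by rewrite /tau /tau0; field; rewrite gt_eqF.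
  by rewrite ler_piMr// divr_ge0// ltW.
have tau00 : 0 <= tau by rewrite mulr_ge0// ltW.
have exponent : - (tau * s) + Cq * tau ^+ 2 * C ^+ 2 * p%:R = - 20 * n%:R.
  have -> : tau * s = tau0 * opnorm_const * (r * Num.sqrt (n%:R * p%:R)).
    by rewrite /tau /s; ring.
  rewrite rs /tau exprMn.
  have -> : Cq * (tau0 ^+ 2 * r ^+ 2) * C ^+ 2 * p%:R =
     Cq * tau0 ^+ 2 * C ^+ 2 * (r ^+ 2 * p%:R) by ring.
  rewrite r2 /opnorm_const; move: (Cq * tau0 ^+ 2 * C ^+ 2) => x.
  by field; rewrite gt_eqF.
pose gp : grid_index n -> 'rV[R]_n := @grid_point R n.
(* The second factor makes [F f] empty outside the ball, hence measurable for every [f], as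
   [union_bound] demands. *)
pose F (f : grid_index n) := [set w | s <= `|qf (noise w) (gp f)|] `&`
  [set w | nrm2 (gp f) <= 1].
have FE (f : grid_index n) : nrm2 (gp f) <= 1 ->
    F f = [set w | s <= `|qf (noise w) (gp f)|].
  by move=> f1; apply/seteqP; split => w //= [].
have mF f : measurable (F f).
  have [f1|f1] := pselect (nrm2 (gp f) <= 1).
    by rewrite FE//; have [] := noise_tail s f1 tau00 tC.
  by rewrite (_ : F f = set0)//; apply/seteqP; split => w //= [].
have hF f : nrm2 (gp f) <= 1 -> (P (F f) <= (2 * expR (- 20 * n%:R))%:E)%E.
  by move=> f1; rewrite FE//; have [_] := noise_tail s f1 tau00 tC; rewrite exponent.
have e0 : 0 <= 2 * expR (- 20 * n%:R) :> R by rewrite mulr_ge0// expR_ge0.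
have [mB hB] := union_bound (Q := fun f => nrm2 (gp f) <= 1) e0 mF hF.
eexists; split; [exact: mB| |].
  apply: le_trans hB _; rewrite lee_fin.
  apply: le_trans (grid_card n0 e0) _.
  rewrite mulrCA ler_pM2l// mulNr expRN.
  rewrite ler_pdivrMr ?expR_gt0// ler_pdivlMl ?exprn_gt0//.
  rewrite -exprMn expRM_natr lerXn2r ?nnegrE ?mulr_ge0 ?exprn_ge0 ?expR_ge0//.
  have e2 : 2 <= expR (1 : R) by have := expR_ge1Dx (1 : R); lra.
  have -> : expR 20 = expR 1 ^+ 20 :> R by rewrite -expRM_natl mulr1.
  apply: (@le_trans _ _ (expR 1 ^+ 19)); last first.
    by rewrite ler_eXn2l// (lt_le_trans _ e2)// ltr1n.
  by rewrite -exprS lerXn2r// nnegrE ?expR_ge0.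
move=> w nB v.
apply: (net_bound (S := range gp) n0 (noise_sym w)).
  move=> u u1; have [f [f1 f2]] := grid_net n0 u1.
  by exists (gp f); split => //; exists f.
move=> _ [f _ <-] f1; rewrite leNgt; apply/negP => h; apply: nB; exists f => //.
by rewrite FE//= ltW.
Qed.

End operator_norm.

(** * The Gaussian distribution function *)

Section taylor.
Context {R : realType}.

Lemma mvt_between (f f1 : R -> R) (a b : R) : (forall x : R, is_derive x 1 f (f1 x)) ->
  exists c, [/\ f b - f a = f1 c * (b - a), Num.min a b <= c & c <= Num.max a b].
Proof.
move=> df.
have cf : continuous f.
  by move=> x; apply/differentiable_continuous/derivable1_diffP; have [] := df x.
have [ab|ba] := leP a b.
  have [c cab e] := MVT_segment ab (fun x _ => df x) (continuous_subspaceT cf).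
  by exists c; move: cab; rewrite in_itv/= => /andP[].
have [c cab e] := MVT_segment (ltW ba) (fun x _ => df x) (continuous_subspaceT cf).
exists c; move: cab; rewrite in_itv/= => /andP[]; split => //.
by rewrite -opprB e; ring.
Qed.

Lemma between_dist (a b c : R) : Num.min a b <= c -> c <= Num.max a b ->
  `|c - a| <= `|b - a|.
Proof.
rewrite ge_min le_max => /orP[h1|h1] /orP[h2|h2].
- by rewrite (_ : c = a) ?subrr ?normr0//; lra.
- by rewrite !ger0_norm ?subr_ge0 ?lerD2r// (le_trans h1).
- by rewrite distrC (distrC b) !ger0_norm ?subr_ge0 ?lerD2l ?lerN2// (le_trans h1).
- by rewrite (_ : c = b)//; lra.
Qed.

Lemma taylor2 (f f1 f2 : R -> R) (a b M : R) :
  (forall x : R, is_derive x 1 f (f1 x)) -> (forall x : R, is_derive x 1 f1 (f2 x)) ->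
  (forall x, Num.min a b <= x -> x <= Num.max a b -> `|f2 x| <= M) ->
  `|f b - f a - f1 a * (b - a)| <= M * `|b - a| ^+ 2.
Proof.
move=> d1 d2 hM; have [c [-> c1 c2]] := mvt_between a b d1.
have [e [h e1 e2]] := mvt_between a c d2.
rewrite -mulrBl h !normrM expr2 mulrA ler_wpM2r//.
have eM : `|f2 e| <= M.
  apply: hM.
    by apply: le_trans e1; rewrite le_min c1 ge_min lexx.
  by apply: le_trans e2 _; rewrite ge_max c2 le_max lexx.
by rewrite ler_pM// between_dist.
Qed.

(** The mean value theorem for the remainder [h]: its derivative is the Taylor remainder of [f1],
    which [taylor2] bounds. *)
Lemma taylor3 (f f1 f2 f3 : R -> R) (a b M : R) :
  (forall x : R, is_derive x 1 f (f1 x)) -> (forall x : R, is_derive x 1 f1 (f2 x)) ->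
  (forall x : R, is_derive x 1 f2 (f3 x)) -> (forall x, `|f3 x| <= M) ->
  `|f b - f a - f1 a * (b - a) - f2 a / 2 * (b - a) ^+ 2| <= M * `|b - a| ^+ 3.
Proof.
move=> d1 d2 d3 hM.
pose h x := f x - f1 a * (x - a) - f2 a / 2 * (x - a) ^+ 2.
pose h1 x := f1 x - f1 a - f2 a * (x - a).
have dh (x : R) : is_derive x 1 h (h1 x).
  apply: is_deriveB; first apply: is_deriveB.
  - by apply: is_derive_eq; rewrite /GRing.scale/=; ring.
  - by apply: is_derive_eq; rewrite /GRing.scale/=; field.
have [c [e c1 c2]] := mvt_between a b dh.
have -> : f b - f a - f1 a * (b - a) - f2 a / 2 * (b - a) ^+ 2 = h b - h a.
  by rewrite /h; ring.
rewrite e normrM exprSr mulrA ler_wpM2r//.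
apply: le_trans (taylor2 d2 d3 (fun x _ _ => hM x)) _.
have M0 : 0 <= M by apply: le_trans (hM 0).
by rewrite ler_wpM2l// lerXn2r ?nnegrE// between_dist.
Qed.

End taylor.

Section gaussian.
Context {R : realType}.
Implicit Types x : R.
Notation mu := (@lebesgue_measure R).

Definition ncdf (s x : R) : R := \int[mu]_(t in `]-oo, x]) normal_pdf 0 s t.
Definition gpdf x : R := normal_pdf 0 1 x.
Definition gcdf x : R := ncdf 1 x.

Let o0 : (1 : R) != 0. Proof. exact: oner_neq0. Qed.

Lemma gpdfE x : gpdf x = normal_peak 1 * expR (- x ^+ 2 / 2).
Proof. by rewrite /gpdf normal_pdfE// /normal_fun subr0 expr1n. Qed.

Lemma gpdf_gt0 x : 0 < gpdf x.
Proof. by rewrite gpdfE mulr_gt0 ?expR_gt0// normal_peak_gt0. Qed.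

Lemma peak_le1 : normal_peak (1 : R) <= 1.
Proof.
rewrite /normal_peak expr1n mul1r.
have h := pi_ge2 R.
have : 1 <= Num.sqrt (pi *+ 2 : R).
  by rewrite -[leLHS]sqrtr1 ler_wsqrtr//; move: h; rewrite mulr2n; lra.
by move=> h1; rewrite invf_le1// (lt_le_trans ltr01).
Qed.

(** The bound behind all estimates on derivatives of [gcdf]: [8] is the inequality [u^2 <= 2 exp u]
    at [u = x^2 / 2], and [1] covers the lower powers. *)
Lemma gpdf_pow k x : (k <= 4)%N -> `|x| ^+ k * gpdf x <= 9.
Proof.
move=> k4.
have h : x ^+ 4 * expR (- x ^+ 2 / 2) <= 8.
  have := sqr_le_expR (divr_ge0 (sqr_ge0 x) (ler0n R 2)); rewrite mulNr expRN => h.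
  by rewrite ler_pdivrMr ?expR_gt0// (_ : x ^+ 4 = 4 * (x ^+ 2 / 2) ^+ 2)//; lra.
have h2 : expR (- x ^+ 2 / 2) <= 1 by rewrite expR_le1; have := sqr_ge0 x; lra.
have h1 : `|x| ^+ k <= 1 + x ^+ 4.
  have -> : x ^+ 4 = `|x| ^+ 4 by rewrite -normrX ger0_norm ?exprn_even_ge0.
  have [x1|x1] := leP `|x| 1.
    by rewrite (le_trans (exprn_ile1 k (normr_ge0 x) x1))// lerDl exprn_ge0.
  by rewrite (le_trans (ler_weXn2l (ltW x1) k4))// lerDr.
rewrite gpdfE mulrCA.
have e0 := expR_gt0 (- x ^+ 2 / 2).
apply: le_trans (_ : 1 * ((1 + x ^+ 4) * expR (- x ^+ 2 / 2)) <= _); last by lra.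
apply: ler_pM => //; first exact: normal_peak_ge0.
- exact: peak_le1.
- by rewrite ler_wpM2r// ltW.
Qed.

Lemma gpdf_derive (x : R) : is_derive x 1 gpdf (- x * gpdf x).
Proof.
rewrite (_ : gpdf = fun x => normal_peak 1 * expR (- x ^+ 2 / 2)); last first.
  by apply/funext => y; rewrite gpdfE.
apply: is_derive_eq.
by rewrite /GRing.scale/=; field.
Qed.

Lemma gpdf_derive2 (x : R) :
  is_derive x 1 (fun x => - x * gpdf x) ((x ^+ 2 - 1) * gpdf x).
Proof.
have h := gpdf_derive x.
by apply: is_derive_eq; rewrite /GRing.scale/=; ring.
Qed.

Lemma ncdf_derive (s x : R) : s != 0 -> is_derive x 1 (ncdf s) (normal_pdf 0 s x).
Proof.
move=> s0.
have [] := @continuous_FTC1 R (normal_pdf 0 s) -oo%O x (x + 1) _ _ _ _.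
- by rewrite ltrDl.
- by apply: integrableS (integrable_normal_pdf 0 s).
- by rewrite ltNyr.
- exact: continuous_normal_pdf.
by rewrite derive1E => h1 <-; exact: (DeriveDef h1 (erefl _)).
Qed.

Lemma ncdfE (s x : R) : (ncdf s x)%:E = normal_prob 0 s `]-oo, x]%classic.
Proof.
rewrite /ncdf /Rintegral fineK//.
by rewrite [X in X \is a _](_ : _ = normal_prob 0 s `]-oo, x]%classic)// fin_num_measure.
Qed.

Lemma gcdf_derive x : is_derive x 1 gcdf (gpdf x).
Proof. exact: ncdf_derive. Qed.

Lemma gcdf_diff (a b : R) : a < b -> gcdf a < gcdf b /\ gcdf b - gcdf a <= b - a.
Proof.
move=> ab; have [c [e _ _]] := mvt_between a b gcdf_derive.
have c0 := gpdf_gt0 c; have ba : 0 < b - a by rewrite subr_gt0.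
split; first by rewrite -subr_gt0 e mulr_gt0.
rewrite e -[leRHS]mul1r ler_wpM2r ?(ltW ba)//.
by rewrite (le_trans (normal_pdf_ub 0 c o0))// peak_le1.
Qed.

Lemma gcdf_le : {mono gcdf : a b / a <= b}.
Proof. by apply: le_mono => a b ab; have [] := gcdf_diff ab. Qed.

Lemma gcdf_lip (a b : R) : `|gcdf a - gcdf b| <= `|a - b|.
Proof.
wlog ab : a b / a < b => [h|].
  have [/h//|/h|->] := ltgtP a b; last by rewrite !subrr.
  by rewrite distrC (distrC a).
rewrite distrC (distrC a) !gtr0_norm ?subr_gt0//; last by have [] := gcdf_diff ab.
by have [] := gcdf_diff ab.
Qed.

Lemma gcdf_itv x : 0 < gcdf x < 1.
Proof.
have h y : 0 <= gcdf y <= 1.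
  by rewrite -!lee_fin ncdfE measure_ge0 probability_le1.
have /andP[h1 _] := h (x - 1); have /andP[_ h2] := h (x + 1).
have h3 : x - 1 < x by rewrite ltrBlDr ltrDl.
have h4 : x < x + 1 by rewrite ltrDl.
by rewrite (le_lt_trans h1 (gcdf_diff h3).1) (lt_le_trans (gcdf_diff h4).1 h2).
Qed.

End gaussian.

Section cdf.
Context {R : realType}.

Lemma cdf_unique (mu1 mu2 : probability (R : measurableType _) R) :
  (forall x : R, mu1 `]-oo, x]%classic = mu2 `]-oo, x]%classic) ->
  forall A : set R, measurable A -> mu1 A = mu2 A.
Proof.
move=> h A mA; refine (@measure_unique _ R (R : measurableType _) (@RGenOInfty.G R) (fun k => `](- k%:R), +oo[%classic) _ _ _ _ mu1 mu2 _ _ A mA).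
- exact: RGenOInfty.measurableE.
- move=> _ _ [a ->] [b ->]; exists (Num.max a b).
  by apply/seteqP; split => x /=; rewrite !in_itv/= !andbT gt_max => /andP.
- by move=> k; exists (- k%:R).
- apply/seteqP; split => // x _; exists (Num.truncn `|x|).+1 => //=.
  rewrite in_itv/= andbT ltrNl (le_lt_trans (ler_norm _))// normrN.
  exact: truncnS_gt.
- have e (mu : probability (R : measurableType _) R) (x : R) :
      mu `]x, +oo[%classic = (1 - mu `]-oo, x]%classic)%E.
    by rewrite -setCitvl; apply: probability_setC.
  move=> _ [x ->]; apply: etrans (e mu1 x) _.
  by rewrite h; exact/esym/e.
- by move=> k; rewrite (le_lt_trans (probability_le1 _ _))// ltry.
Qed.

Lemma cdf_limits (mu : probability (R : measurableType _) R) (e : R) : 0 < e ->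
  (exists a, (mu `]-oo, a]%classic < e%:E)%E) /\
  (exists b, ((1 - e)%:E < mu `]-oo, b]%classic)%E).
Proof.
move=> e0.
have mid : measurable_fun setT (@idfun R) by exact: measurable_id.
pose X : {RV mu >-> R} :=
  MeasurableFun.Pack (MeasurableFun.Class (isMeasurableFun.Build _ _ _ _ _ mid)).
have fE x : fine (mu `]-oo, x]%classic) = fine (cdf X x) by [].
have ff x : (fine (mu `]-oo, x]%classic))%:E = mu `]-oo, x]%classic.
  by rewrite fineK// fin_num_measure.
split.
  have /fine_cvg/cvgr_lt/(_ _ e0)/filter_ex[a ha] := cvg_cdfNy0 X.
  by exists a; rewrite -ff lte_fin fE.
have e1 : 1 - e < 1 by rewrite ltrBlDr ltrDl.
have /fine_cvg/cvgr_gt/(_ _ e1)/filter_ex[a ha] := cvg_cdfy1 X.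
by exists a; rewrite -ff lte_fin fE.
Qed.

Let mid : measurable_fun setT (@idfun R : measurableTypeR R -> R).
Proof. exact: measurable_id. Qed.

(* normal_prob lives on the alias measurableTypeR R, whose display differs from
   that of R; this is the same law on R itself. *)
Definition normal_distr (s : R) : probability (R : measurableType _) R :=
  distribution (normal_prob 0 s : probability (measurableTypeR R) R)
    (MeasurableFun.Pack (MeasurableFun.Class (isMeasurableFun.Build _ _ _ _ _ mid))).

Lemma ncdf_gcdf (s x : R) : 0 < s -> ncdf s x = gcdf (x / s).
Proof.
move=> s0; have sn : s != 0 by rewrite gt_eqF.
pose h x := ncdf s x - gcdf (x / s).
have dh (y : R) : is_derive y 1 h 0.
  have h1 := ncdf_derive y sn.
  have h2 : is_derive y 1 (gcdf \o (fun x => x / s)) (gpdf (y / s) / s).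
    have h3 : is_derive y 1 (fun x : R => x / s) s^-1.
      by apply: is_derive_eq; rewrite /GRing.scale/=; ring.
    have h4 := gcdf_derive (y / s).
    by apply: is_derive1_comp.
  rewrite (_ : 0 = normal_pdf 0 s y - gpdf (y / s) / s); first exact: is_deriveB.
  rewrite gpdfE normal_pdfE// /normal_fun subr0 /normal_peak expr1n mul1r.
  have -> : Num.sqrt (s ^+ 2 * pi *+ 2) = s * Num.sqrt (pi *+ 2).
    by rewrite -mulrnAr sqrtrM ?sqr_ge0// sqrtr_sqr gtr0_norm.
  have p0 : Num.sqrt (pi *+ 2 : R) != 0.
    by rewrite gt_eqF// sqrtr_gt0 mulrn_wgt0// pi_gt0.
  have -> : - (y / s) ^+ 2 / 2 = - y ^+ 2 / (s ^+ 2 *+ 2) by field.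
  by field; rewrite sn p0.
have hc a b : h a = h b.
  have [c [e _ _]] := mvt_between b a dh.
  by apply/eqP; rewrite -subr_eq0 e mul0r.
apply/eqP; rewrite -subr_eq0 -/(h x) -normr_eq0; apply/eqP/le_anti/andP; split => //.
apply/ler_addgt0Pl => e e0; rewrite addr0.
have [[a ha] _] := cdf_limits (normal_distr s) e0.
have [[b hb] _] := cdf_limits (normal_distr 1) e0.
pose c := Num.min a (s * b).
rewrite (hc x c).
have sub (nu : probability (R : measurableType _) R) (u v : R) : u <= v ->
    (nu `]-oo, u]%classic <= nu `]-oo, v]%classic)%E.
  move=> uv; apply: le_measure; rewrite ?inE//.
  by move=> z /=; rewrite !in_itv/= => zu; exact: le_trans zu uv.
have h1 : 0 <= ncdf s c < e.
  rewrite -lee_fin -lte_fin ncdfE measure_ge0 (le_lt_trans _ ha)//.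
  by apply: sub; rewrite ge_min lexx.
have h2 : 0 <= gcdf (c / s) < e.
  rewrite -lee_fin -lte_fin ncdfE measure_ge0 (le_lt_trans _ hb)//.
  by apply: sub; rewrite ler_pdivrMr// mulrC ge_min lexx orbT.
by rewrite /h ler_norml; lra.
Qed.

End cdf.

(** * Lindeberg replacement *)

Section gaussian_steps.
Context {R : realType}.

Lemma gcdf_taylor (a b : R) :
  `|gcdf b - gcdf a - gpdf a * (b - a) - (- a * gpdf a) / 2 * (b - a) ^+ 2|
    <= 18 * `|b - a| ^+ 3.
Proof.
apply: (taylor3 a b gcdf_derive gpdf_derive gpdf_derive2) => x.
have g0 := ltW (gpdf_gt0 x).
rewrite normrM (ger0_norm g0).
have h0 := @gpdf_pow R 0 x isT; have h2 := @gpdf_pow R 2 x isT.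
apply: le_trans (_ : (`|x| ^+ 2 + `|x| ^+ 0) * gpdf x <= _); last by lra.
by rewrite ler_wpM2r// (le_trans (ler_normB _ _))// normr1 normrX.
Qed.

(** Here [t^(-2) - 1] will be the added variance relative to [r^2]. The first-order term is half the
    second derivative [- c * gpdf c] times that variance, as in the heat equation, so it matches the
    quadratic term of [gcdf_taylor]. *)
Lemma gcdf_scale (c t : R) : 0 < t -> t <= 1 ->
  `|gcdf (c * t) - gcdf c + c * gpdf c * (t ^- 2 - 1) / 2| <= 23 * (t ^- 2 - 1) ^+ 2.
Proof.
move=> t0 t1; pose s := (1 - t) / t.
have ti : t != 0 by rewrite gt_eqF.
have s0 : 0 <= s by rewrite divr_ge0 ?subr_ge0// ltW.
have ls : t ^- 2 - 1 = s * (2 + s) by rewrite /s; field.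
pose f1 x := c * gpdf (c * x); pose f2 x := - (c ^+ 3 * x * gpdf (c * x)).
have d0 (x : R) : is_derive x 1 (fun x => c * x) c.
  by apply: is_derive_eq; rewrite /GRing.scale/= mulr1.
have d1 (x : R) : is_derive x 1 (fun x => gcdf (c * x)) (f1 x).
  have h := d0 x; have h' := gcdf_derive (c * x).
  rewrite /f1 mulrC; exact: (@is_derive1_comp R gcdf (fun x => c * x)).
have d2 (x : R) : is_derive x 1 f1 (f2 x).
  have h := d0 x; have h' := gpdf_derive (c * x).
  have h'' := @is_derive1_comp R gpdf (fun x => c * x) x _ _ h' h.
  rewrite /f1; have -> : f2 x = c * (- (c * x) * gpdf (c * x) * c) by rewrite /f2; ring.
  exact: is_deriveZ.
have hb x : Num.min 1 t <= x -> x <= Num.max 1 t -> `|f2 x| <= 9 / t ^+ 2.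
  rewrite (min_idPr t1) => tx _; have x0 : 0 < x by apply: lt_le_trans tx.
  have h3 := @gpdf_pow R 3 (c * x) isT.
  rewrite ler_pdivlMr ?exprn_gt0//.
  apply: le_trans h3; have g0 := ltW (gpdf_gt0 (c * x)).
  rewrite normrN (normrM _ (gpdf _)) (normrM _ x) normrX (normrM c) exprMn.
  rewrite (ger0_norm g0) (ger0_norm (ltW x0)).
  have -> : `|c| ^+ 3 * x * gpdf (c * x) * t ^+ 2 =
    `|c| ^+ 3 * gpdf (c * x) * x * t ^+ 2 by ring.
  have -> : `|c| ^+ 3 * x ^+ 3 * gpdf (c * x) =
    `|c| ^+ 3 * gpdf (c * x) * x * x ^+ 2 by ring.
  by rewrite ler_wpM2l ?lerXn2r ?nnegrE ?(ltW t0) ?(ltW x0)// !mulr_ge0// ltW.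
have h := taylor2 (a := 1) (b := t) d1 d2 hb.
have hc := @gpdf_pow R 1 c isT.
have hc' : `|c * gpdf c| <= 9 by rewrite normrM (ger0_norm (ltW (gpdf_gt0 c))).
have -> : gcdf (c * t) - gcdf c + c * gpdf c * (t ^- 2 - 1) / 2 =
  (gcdf (c * t) - gcdf (c * 1) - f1 1 * (t - 1)) +
  (c * gpdf c) * (s ^+ 2 * (1 + 2 * t) / 2).
  by rewrite /f1 mulr1 /s; field.
have e1 : 9 / t ^+ 2 * `|t - 1| ^+ 2 = 9 * s ^+ 2.
  by rewrite real_normK ?num_real// /s; field.
rewrite e1 in h.
have q0 : 0 <= s ^+ 2 * (1 + 2 * t) / 2.
  by rewrite divr_ge0// mulr_ge0 ?sqr_ge0// addr_ge0// mulr_ge0// ltW.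
have h2 : `|c * gpdf c * (s ^+ 2 * (1 + 2 * t) / 2)| <= 9 * (s ^+ 2 * (1 + 2 * t) / 2).
  by rewrite normrM (ger0_norm q0) ler_wpM2r.
apply: le_trans (ler_normD _ _) _; apply: le_trans (lerD h h2) _.
rewrite ls.
have s2 := sqr_ge0 s.
have b1 : s ^+ 2 * (1 + 2 * t) / 2 <= s ^+ 2 * 3 / 2 by nra.
have -> : (s * (2 + s)) ^+ 2 = s ^+ 2 * (4 + 4 * s + s ^+ 2) by ring.
have b2 : s ^+ 2 * 4 <= s ^+ 2 * (4 + 4 * s + s ^+ 2) by rewrite ler_wpM2l//; nra.
by lra.
Qed.

End gaussian_steps.

Section lindeberg.
Context {d} {T : measurableType d} {R : realType} (P : probability T R).

Lemma indep2_comp (X Y : T -> R) (f g : R -> R) : indep2 P X Y ->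
  measurable_fun setT f -> measurable_fun setT g ->
  indep2 P (f \o X) (g \o Y).
Proof.
move=> XY mf mg A B mA mB.
apply: (XY (f @^-1` A) (g @^-1` B)); rewrite -[_ @^-1` _]setTI; [exact: mf|exact: mg].
Qed.

Lemma gpdf_measurable : measurable_fun setT (@gpdf R).
Proof. exact: measurable_normal_pdf. Qed.

Lemma gcdf_measurable : measurable_fun setT (@gcdf R).
Proof.
apply: nondecreasing_measurable => // x y.
by rewrite gcdf_le.
Qed.

(** One replacement: [X] is traded for an increase of the smoothing variance from [r^2] to
    [r^2 + v]. First and second moments agree, so only third-order terms in [X] and second-order
    terms in [v] survive. *)
Lemma lindeberg_step (S X : T -> R) (y r v b : R) :
  0 < r -> 0 <= v -> measurable_fun setT S -> measurable_fun setT X -> indep2 P S X ->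
  intg P X -> intg P (fun w => X w ^+ 2) -> intg P (fun w => `|X w| ^+ 3) ->
  mean P X = 0 -> mean P (fun w => X w ^+ 2) = v ->
  mean P (fun w => `|X w| ^+ 3) <= b ->
  `|mean P (fun w => gcdf ((y - (S w + X w)) / r)) -
    mean P (fun w => gcdf ((y - S w) / Num.sqrt (r ^+ 2 + v)))|
  <= 18 * b / r ^+ 3 + 23 * (v / r ^+ 2) ^+ 2.
Proof.
move=> r0 v0 mS mX SX i1 i2 i3 m1 m2 m3.
have rn : r != 0 by rewrite gt_eqF.
set r1 := Num.sqrt _.
have r12 : r1 ^+ 2 = r ^+ 2 + v by rewrite sqr_sqrtr// addr_ge0// sqr_ge0.
have r10 : 0 < r1 by rewrite sqrtr_gt0 ltr_pwDl ?exprn_gt0.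
pose t := r / r1.
have t0 : 0 < t by rewrite divr_gt0.
have t1 : t <= 1.
  rewrite ler_pdivrMr// mul1r -(@ler_pXn2r _ 2)// ?nnegrE ?(ltW r0) ?(ltW r10)//.
  by rewrite r12 lerDl.
have tv : t ^- 2 - 1 = v / r ^+ 2.
  rewrite (_ : v = r1 ^+ 2 - r ^+ 2); last by rewrite r12; ring.
  by rewrite /t; field; rewrite rn gt_eqF.
pose c w := (y - S w) / r.
have mc : measurable_fun setT c.
  by apply: measurable_funM => //; apply: measurable_funB.
pose A w := gcdf ((y - (S w + X w)) / r).
pose B w := gcdf ((y - S w) / r1).
pose U w := gpdf (c w) * X w.
pose V w := (c w * gpdf (c w)) * (X w ^+ 2 - v).
have g1 (x : R) : 0 <= gcdf x <= 1 by have := gcdf_itv x; lra.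
have iA : intg P A.
  apply: (@intg_bounded _ _ _ _ _ 1) => [|w].
    apply: measurableT_comp; first exact: gcdf_measurable.
    by apply: measurable_funM => //; apply: measurable_funB => //; apply: measurable_funD.
  by have := g1 ((y - (S w + X w)) / r); rewrite ler_norml /A; lra.
have iB : intg P B.
  apply: (@intg_bounded _ _ _ _ _ 1) => [|w].
    apply: measurableT_comp; first exact: gcdf_measurable.
    by apply: measurable_funM => //; apply: measurable_funB.
  by have := g1 ((y - S w) / r1); rewrite ler_norml /B; lra.
have mcf : measurable_fun setT (fun x : R => (y - x) / r).
  by apply: measurable_funM => //; apply: measurable_funB.
have ipc : intg P (fun w => gpdf (c w)).
  apply: (@intg_bounded _ _ _ _ _ 9) => [|w].
    by apply: measurableT_comp => //; exact: gpdf_measurable.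
  have := @gpdf_pow R 0 (c w) isT; rewrite expr0 mul1r.
  by rewrite ger0_norm// ltW// gpdf_gt0.
have icpc : intg P (fun w => c w * gpdf (c w)).
  apply: (@intg_bounded _ _ _ _ _ 9) => [|w].
    apply: measurable_funM => //.
    by apply: measurableT_comp => //; exact: gpdf_measurable.
  have := @gpdf_pow R 1 (c w) isT; rewrite expr1.
  by rewrite (normrM (c w)) (ger0_norm (ltW (gpdf_gt0 (c w)))).
have [iU eU] : intg P U /\ mean P U = 0.
  have [|iU ->] := @indep2_mean _ _ _ P (fun w => gpdf (c w)) X _ ipc i1.
    apply: (indep2_comp (f := fun x => gpdf ((y - x) / r)) (g := id) SX) => //.
    by apply: measurableT_comp => //; exact: gpdf_measurable.
  by rewrite m1 mulr0.
have iX2 : intg P (fun w => X w ^+ 2 - v) by apply: intgB => //; exact: intg_cst.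
have [iV eV] : intg P V /\ mean P V = 0.
  have [|iV ->] := @indep2_mean _ _ _ P _ _ _ icpc iX2.
    apply: (indep2_comp (f := fun x => (y - x) / r * gpdf ((y - x) / r))
                        (g := fun x => x ^+ 2 - v) SX).
      apply: measurable_funM => //.
      by apply: measurableT_comp => //; exact: gpdf_measurable.
    by apply: measurable_funB => //; exact: measurable_funX.
  by rewrite meanB ?mean_cst// ?m2 ?subrr ?mulr0//; exact: intg_cst.
rewrite -[leLHS]/(`|mean P A - mean P B|).
(* Adding the mean-zero [U] and [V] cancels the terms of [gcdf_taylor] and [gcdf_scale] pointwise,
   so no conditional expectation is needed. *)
pose D w := A w - B w + r^-1 * U w + r ^- 2 / 2 * V w.
have iD : intg P D by apply: intgD; [apply: intgD; [exact: intgB|exact: intgZ]|exact: intgZ].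
have -> : mean P A - mean P B = mean P D.
  rewrite /D meanD; [|by apply: intgD; [exact: intgB|exact: intgZ]|exact: intgZ].
  rewrite meanD; [|exact: intgB|exact: intgZ].
  by rewrite (meanB iA iB) (meanZ _ iU) (meanZ _ iV) eU eV !mulr0 !addr0.
apply: le_trans (mean_norm_le iD) _.
pose E w := (18 / r ^+ 3) * `|X w| ^+ 3 + 23 * (v / r ^+ 2) ^+ 2.
have iE : intg P E by apply: intgD; [exact: intgZ|exact: intg_cst].
apply: le_trans (mean_le (intg_norm iD) iE _) _ => [w|]; last first.
  rewrite meanD; [|exact: intgZ|exact: intg_cst].
  rewrite (meanZ _ i3) (mean_cst P) lerD2r -mulrA (mulrC b) mulrA ler_wpM2l//.
  by rewrite divr_ge0// exprn_ge0// ltW.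
have hA := gcdf_taylor (c w) (c w - X w / r).
have hB := gcdf_scale (c w) t0 t1; rewrite tv in hB.
have eA : (y - (S w + X w)) / r = c w - X w / r by rewrite /c; field.
have eB : (y - S w) / r1 = c w * t by rewrite /c /t; field; rewrite rn gt_eqF.
have e3 : `|c w - X w / r - c w| ^+ 3 = `|X w| ^+ 3 / r ^+ 3.
  rewrite (_ : c w - X w / r - c w = - (X w / r)); last by ring.
  by rewrite normrN normrM normfV (gtr0_norm r0) exprMn exprVn.
rewrite e3 in hA.
have -> : D w = (gcdf (c w - X w / r) - gcdf (c w) - gpdf (c w) * (c w - X w / r - c w) -
        - c w * gpdf (c w) / 2 * (c w - X w / r - c w) ^+ 2) -
   (gcdf (c w * t) - gcdf (c w) + c w * gpdf (c w) * (v / r ^+ 2) / 2).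
  by rewrite /D /A /B /U /V eA eB; field.
have -> : E w = 18 * (`|X w| ^+ 3 / r ^+ 3) + 23 * (v / r ^+ 2) ^+ 2.
  by rewrite /E; ring.
apply: le_trans (ler_normB _ _) _.
exact: lerD hA hB.
Qed.

End lindeberg.

Lemma scaled_sum_measurable {R : realType} d (T : measurableType d) (I : finType)
  (Q : pred I) (X : I -> T -> R) (c : R) :
  (forall i, Q i -> measurable_fun setT (X i)) ->
  measurable_fun setT (fun w => c * \sum_(i | Q i) X i w).
Proof.
move=> mX; apply: measurable_funM; first exact: measurable_cst.
under eq_fun do rewrite big_mkcond.
by apply: measurable_sum => i; case: (boolP (Q i)) => // /mX.
Qed.

Section telescoping.
Context {d} {T : measurableType d} {R : realType} (P : probability T R).
Variables (n : nat) (X : 'I_n -> T -> R) (v b sg : R).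
Hypothesis n0 : (0 < n)%N.
Hypothesis mX : forall i, measurable_fun setT (X i).
Hypothesis iX : independent_family P X.
Hypothesis i1 : forall i, intg P (X i).
Hypothesis i2 : forall i, intg P (fun w => X i w ^+ 2).
Hypothesis i3 : forall i, intg P (fun w => `|X i w| ^+ 3).
Hypothesis m1 : forall i, mean P (X i) = 0.
Hypothesis m2 : forall i, mean P (fun w => X i w ^+ 2) = v.
Hypothesis m3 : forall i, mean P (fun w => `|X i w| ^+ 3) <= b.
Hypothesis sg0 : 0 < sg.

Definition nsum w : R := (Num.sqrt n%:R)^-1 * \sum_i X i w.

Lemma nsum_measurable : measurable_fun setT nsum.
Proof. by apply: scaled_sum_measurable => i _. Qed.

(** [S k] collects the first [k] terms, and [r k ^+ 2] is [sg ^+ 2] plus the variance of the terms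
    still missing. At [k = 0] everything is Gaussian, at [k = n] only the smoothing is left; each of
    the [n] steps costs at most [C]. *)
Lemma lindeberg_smooth (y : R) :
  `|mean P (fun w => gcdf ((y - nsum w) / sg)) - gcdf (y / Num.sqrt (sg ^+ 2 + v))|
  <= 18 * b / (Num.sqrt n%:R * sg ^+ 3) + 23 * v ^+ 2 / (n%:R * sg ^+ 4).
Proof.
have s0 := sg0.
have n0' : 0 < n%:R :> R by rewrite ltr0n.
have [q qE] : exists q, q = Num.sqrt (n%:R : R) by eexists.
rewrite -qE.
have q0 : 0 < q by rewrite qE sqrtr_gt0.
have q2 : q ^+ 2 = n%:R by rewrite qE sqr_sqrtr// ltW.
have v0 : 0 <= v by rewrite -(m2 (Ordinal n0)) mean_ge0// => w; exact: sqr_ge0.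
have b0 : 0 <= b.
  by apply: le_trans (m3 (Ordinal n0)); apply: mean_ge0 => w; rewrite exprn_ge0.
pose S k w := q^-1 * \sum_(i < n | (i < k)%N) X i w.
have [r rE] : exists r : nat -> R, forall k, r k = Num.sqrt (sg ^+ 2 + (n - k)%:R * (v / n%:R)).
  by eexists.
have vn0 : 0 <= v / n%:R by rewrite divr_ge0// ltW.
have r2 k : r k ^+ 2 = sg ^+ 2 + (n - k)%:R * (v / n%:R).
  by rewrite rE sqr_sqrtr// addr_ge0 ?sqr_ge0// mulr_ge0.
have rsg k : sg <= r k.
  by rewrite rE -[leLHS]ger0_norm ?(ltW s0)// -sqrtr_sqr ler_wsqrtr// lerDl mulr_ge0.
have r0 k : 0 < r k by apply: lt_le_trans (rsg k).
pose C := 18 * (b / q ^+ 3) / sg ^+ 3 + 23 * (v / n%:R / sg ^+ 2) ^+ 2.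
have e2 x : (q^-1 * x) ^+ 2 = n%:R^-1 * x ^+ 2 by rewrite exprMn exprVn q2.
have e3 x : `|q^-1 * x| ^+ 3 = q ^- 3 * `|x| ^+ 3.
  have h : 0 <= q^-1 by rewrite invr_ge0 ltW.
  by rewrite normrM exprMn (ger0_norm h) exprVn.
have q3 : 0 <= q ^- 3 by rewrite invr_ge0; exact: exprn_ge0 (ltW q0).
have step k : (k <= n)%N ->
    `|mean P (fun w => gcdf ((y - S k w) / r k)) - gcdf (y / r 0)| <= k%:R * C.
  elim: k => [_|k IH kn].
    rewrite mul0r (_ : (fun w => _) = fun=> gcdf (y / r 0)) ?mean_cst ?subrr ?normr0//.
    apply/funext => w; rewrite /S big_pred0 ?mulr0 ?subr0// => i.
  have := IH (ltnW kn); pose i0 := Ordinal kn; set A := mean _ _ => hA.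
  have -> : S k.+1 = fun w => S k w + q^-1 * X i0 w.
    apply/funext => w; rewrite /S (bigD1 i0)//= mulrDr addrC; congr (_ * _ + _).
    by apply: eq_bigl => i; rewrite ltnS (leq_eqVlt i k) -val_eqE/=; case: eqP => [->|];
      rewrite ?ltnn ?andbF//= andbT.
  have eA : A = mean P (fun w => gcdf ((y - S k w) / Num.sqrt (r k.+1 ^+ 2 + v / n%:R))).
    congr mean; apply/funext => w; congr (gcdf (_ / _)).
    rewrite -[LHS]ger0_norm ?(ltW (r0 k))// -sqrtr_sqr; congr Num.sqrt.
    by rewrite !r2 -addrA; congr (_ + _); rewrite -[in LHS](subnSK kn) -natr1; ring.
  have mS : measurable_fun setT (S k) by apply: scaled_sum_measurable => i _.
  have mX0 : measurable_fun setT (fun w => q^-1 * X i0 w) by exact: measurable_funM.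
  have SX : indep2 P (S k) (fun w => q^-1 * X i0 w).
    apply: (indep2_disjoint mX iX (J1 := fun i => (i < k)%N) (J2 := fun i => i == i0)).
    - by move=> i ik /eqP ii; move: ik; rewrite ii ltnn.
    - by apply: scaled_sum_measurable => i ik; apply: gen_sigma_fun.
    - apply: measurable_funM; first exact: measurable_cst.
      exact: (@gen_sigma_fun _ _ _ _ [set i | i == i0] X i0 (eqxx i0)).
  have := @lindeberg_step _ T R P (S k) (fun w => q^-1 * X i0 w) y (r k.+1) (v / n%:R) (b / q ^+ 3)
    (r0 _) vn0 mS mX0 SX (intgZ _ (i1 i0)).
  under [X in intg P X -> _]eq_fun do rewrite e2.
  under [X in _ -> intg P X -> _]eq_fun do rewrite e3.
  under [X in _ -> _ -> _ -> mean P X = _ -> _]eq_fun do rewrite e2.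
  under [X in _ -> _ -> _ -> _ -> is_true (mean P X <= _) -> _]eq_fun do rewrite e3.
  rewrite -eA => /(_ (intgZ _ (i2 i0)) (intgZ _ (i3 i0))).
  rewrite (meanZ _ (i1 i0)) (meanZ _ (i2 i0)) (meanZ _ (i3 i0)) m1 mulr0 m2 (mulrC _ v).
  move=> /(_ (erefl _) (erefl _)) hB.
  have {}hB := hB _; rewrite -natr1 mulrDl mul1r.
  have {}hB := hB (_ : _ <= _).
  have hBC : 18 * (b / q ^+ 3) / r k.+1 ^+ 3 + 23 * (v / n%:R / r k.+1 ^+ 2) ^+ 2 <= C.
    have rr m : sg ^+ m <= r k.+1 ^+ m.
      by apply: lerXn2r (rsg _); rewrite nnegrE ltW.
    have ri m : (r k.+1 ^+ m)^-1 <= (sg ^+ m)^-1.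
      by rewrite lef_pV2 ?posrE ?exprn_gt0.
    have h0 : 0 <= 18 * (b / q ^+ 3).
      by apply: mulr_ge0; [exact: ler0n|apply: divr_ge0; rewrite ?exprn_ge0 ?(ltW q0)].
    have h m : 0 < m -> 0 <= v / n%:R / m by move=> m0; apply: divr_ge0; rewrite ?(ltW m0).
    apply: lerD; first exact: (ler_wpM2l h0 (ri 3%N)).
    have hr : v / n%:R / r k.+1 ^+ 2 \in Num.nneg by rewrite nnegrE; exact/h/exprn_gt0/r0.
    have hs : v / n%:R / sg ^+ 2 \in Num.nneg by rewrite nnegrE; exact/h/exprn_gt0/s0.
    have hrs := lerXn2r 2 hr hs (ler_wpM2l vn0 (ri 2%N)).
    exact: (ler_wpM2l (ler0n R 23) hrs).
  rewrite [leRHS]addrC; apply: le_trans (ler_distD A _ _) _; apply: lerD; last exact: hA.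
  apply: le_trans (hB _) hBC.
  by rewrite [leLHS]mulrC; exact: (ler_wpM2r q3 (m3 i0)).
have := step n (leqnn n).
have -> : r n = sg by rewrite rE subnn mul0r addr0 sqrtr_sqr gtr0_norm.
have -> : r 0 = Num.sqrt (sg ^+ 2 + v).
  by rewrite rE subn0; congr (Num.sqrt (_ + _)); field; rewrite gt_eqF.
have -> : S n = nsum.
  by apply/funext => w; rewrite /S /nsum -qE; congr (_ * _); apply: eq_bigl => i; rewrite ltn_ord.
move=> /le_trans; apply; rewrite le_eqVlt; apply/orP; left; apply/eqP.
by rewrite /C -q2; field; rewrite !gt_eqF.
Qed.

End telescoping.

(** * Coupling with exact Gaussians *)

Lemma fine_prob {R : realType} d (T : measurableType d) (P : probability T R) (A : set T) :
  measurable A -> (fine (P A))%:E = P A.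
Proof. by move=> mA; rewrite fineK// fin_num_measure. Qed.

Section gaussian_extension.
Context {R : realType}.

(* g j, j < m, are i.i.d. standard Gaussian and jointly independent of pi. *)
Definition gaussian_ext (m : nat) d (T : measurableType d) (P : probability T R)
    d' (T' : measurableType d') (P' : probability T' R) (pi : T' -> T)
    (g : nat -> T' -> R) := [/\ measurable_fun setT pi,
  forall j, measurable_fun setT (g j) &
  forall (A : set T) (B : nat -> set R), measurable A ->
    (forall j, measurable (B j)) ->
    P' (pi @^-1` A `&` [set w | forall j, (j < m)%N -> B j (g j w)]) =
    (P A * (\prod_(j < m) fine (normal_prob 0 1 (B j)))%:E)%E].

(** One product with the standard Gaussian law per variable. Indexing [g] by [nat] keeps its type
    fixed along the induction on [m]. *)
Lemma gaussian_ext_exists (m : nat) d (T : measurableType d) (P : probability T R) :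
  exists d' (T' : measurableType d') (P' : probability T' R) (pi : T' -> T) g,
    gaussian_ext m P P' pi g.
Proof.
elim: m => [|m [d' [T' [P' [pi [g [mpi mg h]]]]]]].
  exists d, T, P, id, (fun _ _ => 0); split => // A B mA mB.
  by rewrite big_ord0 mule1; congr (P _); apply/seteqP; split => [w []|w Aw].
exists _, (T' * measurableTypeR R)%type, (P' \x normal_prob 0 1)%E, (pi \o fst),
  (fun j w => if j == m then w.2 else g j w.1); split.
- exact: measurableT_comp.
- by move=> j; case: eqP => _; [exact: measurable_snd|exact: measurableT_comp].
move=> A B mA mB; rewrite big_ord_recr/= EFinM muleA -h//.
have mS : measurable (pi @^-1` A `&` [set w | forall j, (j < m)%N -> B j (g j w)]).
  apply: measurableI; first by rewrite -[_ @^-1` _]setTI; exact: mpi.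
  rewrite (_ : [set _ | _] = \bigcap_(j in [set j | (j < m)%N]) (g j @^-1` B j)).
    apply: fin_bigcap_measurable => [|j _]; first exact: finite_II.
    rewrite -[_ @^-1` _]setTI; exact: mg.
  by apply/seteqP; split.
set S0 := _ `&` _ in mS *.
have e : (P' \x normal_prob 0 1)%E (S0 `*` B m) = (P' S0 * normal_prob 0 1 (B m))%E.
  refine (@product_measure1E _ _ _ _ _ P' (normal_prob 0 1) _ _ mS (mB m)).
transitivity ((P' \x normal_prob 0 1)%E (S0 `*` B m)); last first.
  apply: (etrans e); congr (_ * _)%E; apply/esym.
  exact: (fine_prob (normal_prob 0 1 : probability (measurableTypeR R) R) (mB m)).
congr ((P' \x normal_prob 0 1)%E _); rewrite /S0.
apply/seteqP; split => [[w x]/= [Aw hB]|[w x]/= [[Aw hB] Bx]].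
  split; last by have := hB m (ltnSn m); rewrite eqxx.
  split => // j jm; have := hB j (ltnW jm); case: eqP => // jm'.
  by move: jm; rewrite jm' ltnn.
split => // j; rewrite ltnS leq_eqVlt; case: eqP => [->//|_ /=].
exact: hB.
Qed.

End gaussian_extension.

Section gaussian_ext_theory.
Context {R : realType} (m : nat) d (T : measurableType d) (P : probability T R)
  d' (T' : measurableType d') (P' : probability T' R) (pi : T' -> T)
  (g : nat -> T' -> R).
Hypothesis ext : gaussian_ext m P P' pi g.

Lemma gaussian_ext_pi (A : set T) : measurable A -> P' (pi @^-1` A) = P A.
Proof.
case: ext => _ _ h mA; have := h A (fun=> setT) mA (fun=> measurableT).
rewrite big1 ?mule1 => [|j _]; last by rewrite probability_setT.
by move=> <-; congr (P' _); apply/seteqP; split => w //= -[].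
Qed.

Lemma gaussian_ext_g (j : nat) (B : set R) : (j < m)%N -> measurable B ->
  P' (g j @^-1` B) = normal_prob 0 1 B.
Proof.
case: ext => _ _ h jm mB.
have mB' i : measurable (if i == j then B else setT) by case: ifP.
have := h setT (fun i => if i == j then B else setT) measurableT mB'.
rewrite probability_setT mul1e (bigD1 (Ordinal jm))//= eqxx big1 ?mulr1.
  rewrite fineK ?fin_num_measure// => <-; congr (P' _); apply/seteqP; split => w /=.
    by move=> Bw; split => // i _; case: eqP => // ->.
  by move=> [_ /(_ j jm)]; rewrite eqxx.
by move=> i; rewrite -val_eqE /= => /negbTE ->; rewrite probability_setT.
Qed.

Lemma gaussian_ext_indep (I : finType) (X : I -> T -> R) :
  (forall i, measurable_fun setT (X i)) -> independent_family P X ->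
  independent_family P' (fun k : I + 'I_m =>
    match k with inl i => X i \o pi | inr j => g j end).
Proof.
case: (ext) => mpi mg h mX iX A mA.
pose B j := if insub j is Some j' then A (inr j') else setT.
have mB j : measurable (B j) by rewrite /B; case: insub.
pose C := [set w | forall i, A (inl i) (X i w)].
have mC : measurable C.
  rewrite (_ : C = \bigcap_(i in setT) (X i @^-1` A (inl i))).
    apply: fin_bigcap_measurable => [|i _]; first exact: finite_finset.
    by rewrite -[_ @^-1` _]setTI; exact: mX.
  by apply/seteqP; split => [w h' i _|w h' i]; exact: h'.
have := h C B mC mB.
rewrite big_sumType /= EFinM.
have -> : \prod_(j < m) fine (normal_prob 0 1 (B j)) =
    \prod_(j < m) fine (P' (g j @^-1` A (inr j))).
  apply: eq_bigr => j _; rewrite gaussian_ext_g//; congr (fine (_ _)).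
  by rewrite /B valK.
rewrite -/C => hC.
have -> : \prod_i fine (P' ((X i \o pi) @^-1` A (inl i))) =
    \prod_i fine (P (X i @^-1` A (inl i))).
  apply: eq_bigr => i _; congr fine.
  apply: (gaussian_ext_pi (A := X i @^-1` A (inl i))).
  by rewrite -[_ @^-1` _]setTI; exact: mX.
rewrite -(iX _ (fun i => mA (inl i))) -hC; congr (P' _).
apply/seteqP; split => [w /= hw|w /= [h1 h2] [i|j]].
- split => [i|j jm]; first exact: (hw (inl i)).
  by rewrite /B insubT; exact: (hw (inr (Ordinal jm))).
- exact: h1.
- by have := h2 j (ltn_ord j); rewrite /B valK.
Qed.

End gaussian_ext_theory.

Section coupling_prelim.
Context {R : realType}.

Lemma continuous_onto (f : R -> R) (a b u : R) : continuous f ->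
  f a < u -> u < f b -> exists x, f x = u.
Proof.
move=> cf au ub.
have [ab|ba] := leP a b.
  have [|c _ fc] := @IVT R f a b u ab (continuous_subspaceT cf); last by exists c.
  by rewrite ge_min le_max (ltW au) (ltW ub) orbT.
have [|c _ fc] := @IVT R f b a u (ltW ba) (continuous_subspaceT cf); last by exists c.
by rewrite ge_min le_max (ltW au) (ltW ub) orbT.
Qed.

Lemma lipschitz_continuous (f : R -> R) (k : R) :
  (forall x y, `|f x - f y| <= k * `|x - y|) -> continuous f.
Proof.
move=> fk x; apply/cvgrPdist_lt => e e0.
have k1 : 0 < `|k| + 1 by rewrite ltr_wpDl.
near=> y.
apply: le_lt_trans (fk x y) _.
apply: le_lt_trans (_ : (`|k| + 1) * `|x - y| < _).
  by rewrite ler_wpM2r// (le_trans (ler_norm k))// lerDl.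
rewrite mulrC -ltr_pdivlMr//.
near: y; apply: cvgr_dist_lt => //; first exact: divr_gt0.
Unshelve. all: by end_near. Qed.

Lemma gcdf_onto (u : R) : 0 < u -> u < 1 -> exists x, gcdf x = u.
Proof.
move=> u0 u1; have cg : continuous (@gcdf R).
  by apply: (@lipschitz_continuous _ 1) => x y; rewrite mul1r gcdf_lip.
have [[a ha] _] := cdf_limits (normal_distr 1) u0.
have [_ [b hb]] := cdf_limits (normal_distr 1) (e := 1 - u) ltac:(by rewrite subr_gt0).
apply: (@continuous_onto gcdf a b u cg).
  by rewrite -lte_fin ncdfE.
by rewrite -lte_fin ncdfE (_ : u = 1 - (1 - u))//; ring.
Qed.

Lemma normal_tail (e : R) : 0 < e ->
  exists2 K : R, 0 < K & (normal_prob 0 1 [set x : R | (K < `|x|)%R] <= e%:E)%E.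
Proof.
move=> e0; have e2 : 0 < e / 2 by rewrite divr_gt0.
have [[a ha] [b hb]] := cdf_limits (normal_distr 1) e2.
exists (1 + `|a| + `|b|); first by rewrite -addrA ltr_wpDr// addr_ge0.
have key (x : R) : 1 + `|a| + `|b| < `|x| -> a < x -> b < x.
  move=> hx ax; have := ler_norm a; have := ler_norm (- a); have := ler_norm b.
  have := normr_ge0 a; have := normr_ge0 b; rewrite normrN => *.
  by have [x0|x0] := lerP 0 x; [rewrite (ger0_norm x0) in hx|rewrite (ltr0_norm x0) in hx]; lra.
have mab : measurable (`]-oo, a]%classic `|` ~` `]-oo, b]%classic : set R).
  by apply: measurableU => //; exact: measurableC.
apply: (@le_trans _ _ (normal_prob 0 1 (`]-oo, a]%classic `|` ~` `]-oo, b]%classic))).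
  apply: prob_le => //.
    rewrite (_ : [set _ | _] = (fun x : R => `|x|) @^-1` `]1 + `|a| + `|b|, +oo[%classic).
      by rewrite -[_ @^-1` _]setTI; exact: normr_measurable.
    by apply/seteqP; split => x /=; rewrite in_itv/= andbT.
  move=> x /= hx; rewrite !in_itv/=.
  have [xa|ax] := leP x a; [by left|right].
  apply/negP; rewrite -ltNge.
  exact: key.
apply: le_trans (@measureU2 _ _ _ (normal_prob 0 1) _ _ _ _) _ => //.
  exact: measurableC.
have -> : e = e / 2 + e / 2 by field.
rewrite EFinD; apply: leeD; first exact: ltW.
have pC : normal_prob 0 1 (~` `]-oo, b]%classic) = (1 - normal_prob 0 1 `]-oo, b]%classic)%E.
  exact: probability_setC.
apply: (@le_trans _ _ (1 - normal_prob 0 1 `]-oo, b]%classic)%E).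
  by rewrite le_eqVlt; apply/orP; left; apply/eqP/pC.
by rewrite leeBlDr ?fin_num_measure// -leeBlDl// -EFinB; apply: ltW.
Qed.

Lemma gpdf_min (K x : R) : `|x| <= K -> gpdf K <= gpdf x.
Proof.
move=> xK; rewrite !gpdfE ler_wpM2l ?normal_peak_ge0// ler_expR.
have : `|x| ^+ 2 <= K ^+ 2 by rewrite lerXn2r ?nnegrE// (le_trans _ xK).
by rewrite real_normK ?num_real//; lra.
Qed.

(** Quantitative continuity of the inverse: if [b] were further than [eta] from [a], the interval of
    length [eta] from [a] towards [b] would lie where the density is at least [gpdf (K + eta)]. *)
Lemma gcdf_close (K eta e a b : R) : 0 < eta -> `|a| <= K ->
  `|gcdf a - gcdf b| <= e -> e < eta * gpdf (K + eta) -> `|a - b| <= eta.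
Proof.
move=> eta0 aK ab he; rewrite leNgt; apply/negP => hab.
have incr (x : R) : `|x| <= K + eta -> `|x + eta| <= K + eta ->
    eta * gpdf (K + eta) <= gcdf (x + eta) - gcdf x.
  move=> h1 h2; have [c [-> c1 c2]] := mvt_between x (x + eta) gcdf_derive.
  rewrite mulrC (addrC x) addrK ler_wpM2r ?(ltW eta0)// gpdf_min//.
  have xe : x <= x + eta by rewrite lerDl ltW.
  rewrite (min_idPl xe) in c1; rewrite (max_idPr xe) in c2.
  by move: h1 h2; rewrite !ler_norml; lra.
move: ab aK; rewrite !ler_norml => /andP[h1 h2] /andP[h3 h4].
have [e1|e1] := lerP 0 (a - b).
  rewrite ger0_norm// in hab.
  have hb : gcdf b <= gcdf (a - eta) by rewrite gcdf_le; lra.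
  have := incr (a - eta); rewrite subrK !ler_norml => h.
  have {}h := h ltac:(apply/andP; split; lra) ltac:(apply/andP; split; lra); lra.
rewrite ltr0_norm// in hab.
have hb : gcdf (a + eta) <= gcdf b by rewrite gcdf_le; lra.
have := incr a; rewrite !ler_norml => h.
have {}h := h ltac:(apply/andP; split; lra) ltac:(apply/andP; split; lra); lra.
Qed.

Lemma normal_law_scale (v : R) (d : measure_display) (T : measurableType d)
    (P : probability T R) (G : T -> R) : measurable_fun setT G -> 0 <= v ->
  (forall B : set R, measurable B -> P (G @^-1` B) = normal_prob 0 1 B) ->
  forall B : set R, measurable B ->
    P ((fun w => Num.sqrt v * G w) @^-1` B) = normal_law 0 v B.
Proof.
move=> mG v0 law B mB; rewrite /normal_law; case: eqVneq => [->|vn].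
  rewrite diracE sqrtr0 (_ : _ @^-1` _ = if 0 \in B then setT else set0).
    by case: ifP => _; [exact: probability_setT|exact: measure0].
  case: ifP => B0; apply/seteqP; split => w //=; rewrite mul0r.
    by move=> _; exact: set_mem.
  by move=> /mem_set; rewrite B0.
have s0 : 0 < Num.sqrt v by rewrite sqrtr_gt0 lt_neqAle eq_sym vn.
have mvG : measurable_fun setT (fun w => Num.sqrt v * G w) by exact: measurable_funM.
pose D : probability (R : measurableType _) R := distribution P
  (MeasurableFun.Pack (MeasurableFun.Class (isMeasurableFun.Build _ _ _ _ _ mvG))).
apply: (@cdf_unique _ D (normal_distr (Num.sqrt v))) => // x.
apply: etrans (ncdfE _ x); rewrite ncdf_gcdf// ncdfE -law//.
congr (P _); apply/seteqP; split => w /=; rewrite !in_itv/= ler_pdivlMr// mulrC//.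
Qed.

End coupling_prelim.

Section mean_gt0.
Context {d} {T : measurableType d} {R : realType} (P : probability T R).

(** With mean zero, Markov's inequality would make all the sets where [X] is at least [1 / (k + 1)]
    null, yet they cover the space. This yields strict monotonicity of [smooth_cdf]. *)
Lemma mean_gt0 (X : T -> R) : intg P X -> (forall w, 0 < X w) -> 0 < mean P X.
Proof.
move=> iX X0; rewrite lt_neqAle mean_ge0 ?andbT// => [|w]; last exact/ltW.
apply/negP => /eqP m0.
have mX := intg_measurable iX.
have h k : P [set w | (k.+1%:R^-1 <= X w)%R] = 0%E.
  apply/eqP; rewrite -measure_le0.
  have := @markov_mean _ _ _ P X (k.+1%:R^-1) _ iX (fun w => ltW (X0 w)).
  by rewrite -m0 mul0r; apply; rewrite invr_gt0.
have mS k : measurable [set w | (k.+1%:R^-1 <= X w)%R].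
  rewrite (_ : [set _ | _] = X @^-1` `[k.+1%:R^-1, +oo[%classic).
    by rewrite -[_ @^-1` _]setTI; exact: mX.
  by apply/seteqP; split => x /=; rewrite in_itv/= andbT.
have : (P (\bigcup_k [set w | (k.+1%:R^-1 <= X w)%R]) <= 0)%E.
  apply: le_trans (measure_sigma_subadditive _ mS _ (@subset_refl _ _)) _.
    exact: bigcupT_measurable.
  by rewrite eseries0// => k _ _; exact: h.
rewrite (_ : \bigcup_k _ = setT) ?probability_setT ?lee_fin ?ler10//.
apply/seteqP; split => // w _.
exists (Num.truncn (X w)^-1) => //=.
by rewrite invf_ple ?posrE// ltW// truncnS_gt.
Qed.

End mean_gt0.

(** * Quantile coupling of a smoothed variable *)

Section quantile_coupling.
Context {d} {T : measurableType d} {R : realType} (P : probability T R).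
Variables (W g : T -> R) (sg : R).
Hypotheses (mW : measurable_fun setT W) (mg : measurable_fun setT g).
Hypothesis Wg : indep2 P W g.
Hypothesis lawg : forall B : set R, measurable B -> P (g @^-1` B) = normal_prob 0 1 B.
Hypothesis sg0 : 0 < sg.

(** The distribution function of [smoothed] with the Gaussian integrated out. As [g] does not
    appear, its value is the same on the original space and on an extension. *)
Definition smooth_cdf (y : R) : R := mean P (fun w => gcdf ((y - W w) / sg)).
Definition smoothed (w : T) : R := W w + sg * g w.

Let ig y : intg P (fun w => gcdf ((y - W w) / sg)).
Proof.
apply: (@intg_bounded _ _ _ _ _ 1) => [|w].
  apply: measurableT_comp; first exact: gcdf_measurable.
  by apply: measurable_funM => //; apply: measurable_funB.
by have := @gcdf_itv R ((y - W w) / sg); rewrite ler_norml; lra.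
Qed.

Lemma measurable_smoothed : measurable_fun setT smoothed.
Proof. by apply: measurable_funD => //; apply: measurable_funM. Qed.

Lemma smoothed_cdf (y : R) : P (smoothed @^-1` `]-oo, y]%classic) = (smooth_cdf y)%:E.
Proof.
have s0 := sg0.
pose pW : {mfun T >-> R} :=
  MeasurableFun.Pack (MeasurableFun.Class (isMeasurableFun.Build _ _ _ _ _ mW)).
pose pg : {mfun T >-> R} :=
  MeasurableFun.Pack (MeasurableFun.Class (isMeasurableFun.Build _ _ _ _ _ mg)).
have mWg : measurable_fun setT (fun w => (W w, g w)) by exact/measurable_fun_pairP.
pose pWg : {mfun T >-> (R * R)%type} :=
  MeasurableFun.Pack (MeasurableFun.Class (isMeasurableFun.Build _ _ _ _ _ mWg)).
pose D := (distribution P pW \x distribution P pg)%E.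
have DE A : measurable A -> D A = distribution P pWg A.
  by apply: product_measure_unique => A1 A2 mA1 mA2; exact: Wg.
pose A : set (R * R) := [set z | z.1 + sg * z.2 <= y].
have mA : measurable A.
  rewrite (_ : A = (fun z : R * R => z.1 + sg * z.2) @^-1` `]-oo, y]%classic).
    rewrite -[_ @^-1` _]setTI; apply: measurable_funD => //.
    by apply: measurable_funM => //.
  by apply/seteqP; split => z /=; rewrite in_itv.
have -> : P (smoothed @^-1` `]-oo, y]%classic) = D A.
  have e : smoothed @^-1` `]-oo, y]%classic = (fun w => (W w, g w)) @^-1` A.
    by apply/seteqP; split => w /=; rewrite in_itv.
  by rewrite DE// e.
rewrite /D /product_measure1 /smooth_cdf mean_integral//.
have -> : (\int[P]_w (gcdf ((y - W w) / sg))%:E =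
   \int[distribution P pW]_x (gcdf ((y - x) / sg))%:E)%E.
  rewrite ge0_integral_distribution//.
    apply/measurable_EFinP/measurableT_comp; first exact: gcdf_measurable.
    by apply: measurable_funM => //; apply: measurable_funB.
  by move=> x; rewrite lee_fin ltW//; have /andP[] := @gcdf_itv R ((y - x) / sg).
apply: eq_integral => x _ /=.
have -> : xsection A x = `]-oo, (y - x) / sg]%classic.
  apply/seteqP; split => z; rewrite /xsection/= inE /A/= in_itv/= ler_pdivlMr//; lra.
by rewrite ncdfE; exact: lawg.
Qed.

Lemma smooth_cdf_strict (x y : R) : x < y -> smooth_cdf x < smooth_cdf y.
Proof.
have s0 := sg0; move=> xy; rewrite -subr_gt0 /smooth_cdf -meanB//.
apply: mean_gt0; first exact: intgB.
move=> w; rewrite subr_gt0 (leW_mono gcdf_le) ltr_pM2r ?invr_gt0//.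
by rewrite ltrD2r.
Qed.

Lemma smooth_cdf_le : {mono smooth_cdf : x y / x <= y}.
Proof. by apply: le_mono => x y; exact: smooth_cdf_strict. Qed.

Lemma smooth_cdf_itv y : 0 < smooth_cdf y < 1.
Proof.
apply/andP; split.
  by apply: mean_gt0 => // w; have /andP[] := @gcdf_itv R ((y - W w) / sg).
rewrite -subr_gt0 -[X in X - _](mean_cst P) -meanB//; last exact: intg_cst.
apply: mean_gt0; first by apply: intgB => //; exact: intg_cst.
by move=> w; rewrite subr_gt0; have /andP[] := @gcdf_itv R ((y - W w) / sg).
Qed.

Lemma smooth_cdf_onto (u : R) : 0 < u -> u < 1 -> exists y, smooth_cdf y = u.
Proof.
have s0 := sg0; move=> u0 u1.
have cF : continuous smooth_cdf.
  apply: (@lipschitz_continuous _ _ sg^-1) => x y.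
  rewrite /smooth_cdf -meanB//.
  have iB : intg P (fun w => gcdf ((x - W w) / sg) - gcdf ((y - W w) / sg)) by exact: intgB.
  apply: le_trans (mean_norm_le iB) _.
  rewrite -[leRHS](mean_cst P); apply: mean_le; [exact: intg_norm|exact: intg_cst|move=> w].
  apply: le_trans (gcdf_lip _ _) _.
  rewrite (_ : _ - _ = sg^-1 * (x - y)); last by field; rewrite gt_eqF.
  by rewrite normrM gtr0_norm ?invr_gt0.
pose pS : {mfun T >-> R} :=
  MeasurableFun.Pack (MeasurableFun.Class (isMeasurableFun.Build _ _ _ _ _ measurable_smoothed)).
pose D : probability (R : measurableType _) R := distribution P pS.
have [[a ha] _] := cdf_limits D u0.
have [_ [b hb]] := cdf_limits D (e := 1 - u) ltac:(by rewrite subr_gt0).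
apply: (@continuous_onto _ smooth_cdf a b u cF).
  by rewrite -lte_fin -smoothed_cdf.
by rewrite -lte_fin -smoothed_cdf (_ : u = 1 - (1 - u))//; ring.
Qed.

(** For each [x] there is [y] with [smooth_cdf y = gcdf x], and then [q (smoothed w) <= x] and
    [smoothed w <= y] are the same event, of probability [gcdf x]. *)
Lemma quantile_coupling_exists : exists q : R -> R,
  [/\ forall y, gcdf (q y) = smooth_cdf y, measurable_fun setT q &
   forall B : set R, measurable B -> P ((q \o smoothed) @^-1` B) = normal_prob 0 1 B].
Proof.
have ex y : exists x, gcdf x = smooth_cdf y.
  by have /andP[u0 u1] := smooth_cdf_itv y; exact: gcdf_onto.
have [q qE] := choice ex; exists q.
have mq : measurable_fun setT q.
  apply: nondecreasing_measurable => // x y xy.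
  by rewrite -gcdf_le !qE smooth_cdf_le.
split => // B mB.
have mqS : measurable_fun setT (q \o smoothed).
  by apply: measurableT_comp => //; exact: measurable_smoothed.
pose pG : {mfun T >-> R} :=
  MeasurableFun.Pack (MeasurableFun.Class (isMeasurableFun.Build _ _ _ _ _ mqS)).
pose D : probability (R : measurableType _) R := distribution P pG.
apply: (@cdf_unique _ D (normal_distr 1)) => // x.
have /andP[u0 u1] := @gcdf_itv R x.
have [y yE] := smooth_cdf_onto u0 u1.
have eS : (q \o smoothed) @^-1` `]-oo, x]%classic = smoothed @^-1` `]-oo, y]%classic.
  have eq w : (q (smoothed w) <= x) = (smoothed w <= y).
    by rewrite -gcdf_le qE -yE smooth_cdf_le.
  by apply/seteqP; split => w /=; rewrite !in_itv/= eq.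
by apply: etrans (ncdfE 1 x); rewrite -/(gcdf x) -yE -smoothed_cdf -eS.
Qed.

(** With [G = q (smoothed w)], [r = sqrt v] and [x = smoothed w / s], the difference [r G - W] is
    [(r - s) G + s (G - x) + sg g]. As [|s - r| <= sg], the outer terms cost [sg K] each when [|G|]
    and [|g|] are at most [K], and [gcdf_close] controls the middle one. The two tails are those of
    [G] and [g]. *)
Lemma gaussian_coupling (q : R -> R) (v e K eta : R) :
  (forall y, gcdf (q y) = smooth_cdf y) -> measurable_fun setT q ->
  (forall B : set R, measurable B -> P ((q \o smoothed) @^-1` B) = normal_prob 0 1 B) ->
  0 <= v -> 0 < K -> 0 < eta ->
  (forall y, `|smooth_cdf y - gcdf (y / Num.sqrt (sg ^+ 2 + v))| <= e) ->
  e < eta * gpdf (K + eta) ->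
  (P [set w | (2 * sg * K + Num.sqrt (sg ^+ 2 + v) * eta <
               `|Num.sqrt v * q (smoothed w) - W w|)%R] <=
   normal_prob 0 1 [set x : R | (K < `|x|)%R] + normal_prob 0 1 [set x : R | (K < `|x|)%R])%E.
Proof.
have s0 := sg0; move=> qE mq law v0 K0 eta0 hF he.
set s := Num.sqrt _.
have sp : 0 < s by rewrite sqrtr_gt0 ltr_pwDl// exprn_gt0.
have s2 : s ^+ 2 = sg ^+ 2 + v by rewrite sqr_sqrtr// addr_ge0// sqr_ge0.
have [r [r0 r2 rE]] : exists r, [/\ 0 <= r, r ^+ 2 = v & r = Num.sqrt v].
  by exists (Num.sqrt v); split => //; rewrite sqr_sqrtr.
rewrite -rE.
have rs : r <= s by rewrite -(@ler_pXn2r _ 2) ?nnegrE ?(ltW sp)// r2 s2 lerDr sqr_ge0.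
have sr : s <= r + sg.
  rewrite -(@ler_pXn2r _ 2) ?nnegrE ?(ltW sp) ?addr_ge0 ?(ltW s0)//.
  have rg : 0 <= r * sg by rewrite mulr_ge0// ltW.
  by rewrite s2 sqrrD r2; lra.
pose Kt : set R := [set x : R | (K < `|x|)%R].
have mKt : measurable Kt.
  rewrite (_ : Kt = (fun x : R => `|x|) @^-1` `]K, +oo[%classic).
    by rewrite -[_ @^-1` _]setTI; exact: normr_measurable.
  by apply/seteqP; split => x /=; rewrite in_itv/= andbT.
have mS := measurable_smoothed.
have mG : measurable_fun setT (q \o smoothed) by exact: measurableT_comp.
rewrite -[X in (_ <= X + _)%E](law _ mKt) -[X in (_ <= _ + X)%E](lawg mKt).
have m1 : measurable ((q \o smoothed) @^-1` Kt) by rewrite -[_ @^-1` _]setTI; exact: mG.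
have m2 : measurable (g @^-1` Kt) by rewrite -[_ @^-1` _]setTI; exact: mg.
apply: le_trans (measureU2 P m1 m2).
apply: prob_le.
- set f := fun w => `|r * q (smoothed w) - W w|.
  have mf : measurable_fun setT f.
    apply: measurableT_comp; first exact: normr_measurable.
    apply: measurable_funB => //; apply: measurable_funM; first exact: measurable_cst.
    exact: mG.
  rewrite (_ : [set _ | _] = f @^-1` `](2 * sg * K + s * eta), +oo[%classic).
    by rewrite -[_ @^-1` _]setTI; exact: mf.
  by apply/seteqP; split => x /=; rewrite in_itv/= andbT.
- exact: measurableU.
move=> w hw; apply: contrapT => /not_orP[/negP + /negP].
rewrite -!leNgt /= => hG hg; move: hw => /=; apply/negP; rewrite -leNgt.
have hx := gcdf_close eta0 hG (_ : _ <= _) he.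
have {}hx := hx (smoothed w / s) _; rewrite qE in hx.
have {}hx := hx (hF _).
set G := q (smoothed w) in hG hx *; set x := smoothed w / s in hx.
have -> : r * G - W w = (r - s) * G + (s * (G - x) + sg * g w).
  by rewrite /x /smoothed; field; rewrite gt_eqF.
have h1 : `|(r - s) * G| <= sg * K.
  by rewrite normrM ler_pM// ler_norml; apply/andP; split; lra.
have h2 : `|s * (G - x)| <= s * eta by rewrite normrM (gtr0_norm sp) ler_pM2l.
have h3 : `|sg * g w| <= sg * K by rewrite normrM (gtr0_norm s0) ler_pM2l.
apply: le_trans (ler_normD _ _) _.
have := ler_normD (s * (G - x)) (sg * g w); lra.
Qed.

End quantile_coupling.

Section measurable_mx.
Context {R : realType} (p q : nat).

Lemma measurable_entry d (T : measurableType d) (f : T -> 'M[R]_(p, q))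
  (i : 'I_p) (j : 'I_q) : measurable_fun setT f ->
  measurable_fun setT (fun w => f w i j).
Proof.
have h : measurable_fun setT (fun M : 'M[R]_(p, q) => M i j).
  by move=> _ B mB; rewrite setTI; apply: sub_sigma_algebra; exists i, j, B.
by move=> mf; exact: (measurableT_comp h mf).
Qed.

Lemma measurable_mxP d (T : measurableType d) (f : T -> 'M[R]_(p, q)) :
  (forall i j, measurable_fun setT (fun w => f w i j)) -> measurable_fun setT f.
Proof.
move=> mf; apply: (measurability (@mx_cylinders R p q)) => //.
move=> _ [_ [i [j [B [mB ->]]]] <-]; rewrite setTI.
by have := mf i j measurableT B mB; rewrite setTI.
Qed.

End measurable_mx.

Section coupled_vector.
Context {R : realType} (n m : nat) d (T : measurableType d) (P : probability T R).
Variables (X : 'I_n * 'I_m -> T -> R) (v : 'I_m -> R) (sg : R).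
Hypothesis mX : forall ij, measurable_fun setT (X ij).
Hypothesis iX : independent_family P X.
Hypothesis v0 : forall j, 0 <= v j.
Hypothesis sg0 : 0 < sg.

Let W j := nsum (fun i => X (i, j)).

(** A record, because the extended space is itself chosen anew for each [n]. [cb_close] quantifies
    over [e], [K] and [eta] so that a single coupling serves every accuracy. *)
Record coupling := Coupling {
  cdisp : measure_display;
  cT : measurableType cdisp;
  cP : probability cT R;
  cpi : {mfun cT >-> T};
  cb : {RV cP >-> 'cV[R]_m};
  cpiP : forall A : set T, measurable A -> cP (cpi @^-1` A) = P A;
  cb_indep : independent_family cP (fun (j : 'I_m) w => cb w j 0);
  cb_law : forall (j : 'I_m) (B : set R), measurable B ->
    cP [set w | B (cb w j 0)] = normal_law 0 (v j) B;
  cb_close : forall (j : 'I_m) (e K eta : R), 0 < K -> 0 < eta ->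
    (forall y, `|smooth_cdf P (W j) sg y - gcdf (y / Num.sqrt (sg ^+ 2 + v j))| <= e) ->
    e < eta * gpdf (K + eta) ->
    (cP [set w | (2 * sg * K + Num.sqrt (sg ^+ 2 + v j) * eta <
             `|cb w j 0 - W j (cpi w)|)%R] <=
     normal_prob 0 1 [set x : R | (K < `|x|)%R] +
     normal_prob 0 1 [set x : R | (K < `|x|)%R])%E }.

Lemma coupling_exists : inhabited coupling.
Proof.
have [d' [T' [P' [pi [g ext]]]]] := gaussian_ext_exists m P.
have [mpi mg _] := ext.
have iXg := gaussian_ext_indep ext mX iX.
set F := (fun k : 'I_n * 'I_m + 'I_m => _) in iXg.
have mF k : measurable_fun setT (F k).
  by case: k => [ij|j] /=; [exact: measurableT_comp|exact: mg].
have mW j : measurable_fun setT (W j) by exact: nsum_measurable.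
have mWp j : measurable_fun setT (W j \o pi) by exact: measurableT_comp.
have lawg (j : 'I_m) (B : set R) : measurable B -> P' (g j @^-1` B) = normal_prob 0 1 B.
  by move=> mB; exact: (gaussian_ext_g ext (ltn_ord j)).
have mFi (J : set ('I_n * 'I_m + 'I_m)) j : (forall i, J (inl (i, j))) ->
   measurable_fun setT ((W j \o pi) : g_sigma_algebraType (gen_sys J F) -> R).
  move=> hJ; pose TJ := g_sigma_algebraType (gen_sys J F).
  have h (i : 'I_n) : measurable_fun setT (F (inl (i, j)) : TJ -> R).
    exact: (gen_sigma_fun (X := F) (hJ i)).
  exact: (@scaled_sum_measurable R _ TJ 'I_n xpredT
    (fun i => F (inl (i, j))) (Num.sqrt n%:R)^-1 (fun i _ => h i)).
pose isl (k : 'I_n * 'I_m + 'I_m) := if k is inl _ then true else false.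
pose isr (k : 'I_n * 'I_m + 'I_m) := if k is inr _ then true else false.
have mFg (J : set ('I_n * 'I_m + 'I_m)) (j : 'I_m) : J (inr j) ->
   measurable_fun setT (g j : g_sigma_algebraType (gen_sys J F) -> R).
  by move=> Jj; exact: (gen_sigma_fun (X := F) Jj).
have Wg (j : 'I_m) : indep2 P' (W j \o pi) (g j).
  apply: (indep2_disjoint mF iXg (J1 := isl) (J2 := isr)).
  - by case.
  - by apply: mFi => i.
  - exact: mFg.
have hq (j : 'I_m) := quantile_coupling_exists (mWp j) (mg j) (Wg j) (lawg j) sg0.
have [q hq'] := choice hq.
pose S (j : 'I_m) := smoothed (W j \o pi) (g j) sg.
pose B w : 'cV[R]_m := \col_j (Num.sqrt (v j) * q j (S j w)).
have BE w j : B w j 0 = Num.sqrt (v j) * q j (S j w) by rewrite mxE.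
have mS (j : 'I_m) : measurable_fun setT (S j) by exact: measurable_smoothed.
have mqS (j : 'I_m) : measurable_fun setT (q j \o S j).
  by have [_ mq _] := hq' j; exact: measurableT_comp.
have mB : measurable_fun setT B.
  apply: measurable_mxP => j k; rewrite (ord1 k).
  under eq_fun do rewrite BE.
  by apply: measurable_funM; [exact: measurable_cst|exact: mqS].
pose pi' : {mfun T' >-> T} :=
  MeasurableFun.Pack (MeasurableFun.Class (isMeasurableFun.Build _ _ _ _ _ mpi)).
pose b' : {RV P' >-> 'cV[R]_m} :=
  MeasurableFun.Pack (MeasurableFun.Class (isMeasurableFun.Build _ _ _ _ _ mB)).
constructor; apply: (@Coupling d' T' P' pi' b').
- exact: (gaussian_ext_pi ext).
- have -> : (fun (j : 'I_m) w => b' w j 0) = fun j w => Num.sqrt (v j) * q j (S j w).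
    by apply/funext => j; apply/funext => w; rewrite -BE.
  (* Block [j] consists of column [j] of [X] and the Gaussian [g j]. *)
  apply: (indep_blocks (g := fun k : 'I_n * 'I_m + 'I_m =>
     match k with inl ij => ij.2 | inr j => j end) mF iXg) => j.
  apply: measurable_funM; first exact: measurable_cst.
  have [_ mq _] := hq' j; apply: measurableT_comp; first exact: mq.
  apply: measurable_funD; first by apply: mFi.
  apply: measurable_funM; first exact: measurable_cst.
  exact: mFg.
- move=> j A mA; rewrite (_ : [set w | _] = (fun w => Num.sqrt (v j) * q j (S j w)) @^-1` A).
    have [_ mq law] := hq' j; exact: (normal_law_scale (mqS j)).
  by apply/seteqP; split => w /=; rewrite mxE.
- move=> j e K eta K0 eta0 hF he.
  have [qE mq law] := hq' j.
  have sl : same_law P' P pi id by move=> A mA; exact: (gaussian_ext_pi ext).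
  have cdfE y : smooth_cdf P' (W j \o pi) sg y = smooth_cdf P (W j) sg y.
    have mcW : measurable_fun setT (fun w => gcdf ((y - W j w) / sg)).
      apply: measurableT_comp; first exact: gcdf_measurable.
      by apply: measurable_funM => //; apply: measurable_funB.
    apply: (same_law_mean mpi (@measurable_id _ _ _) sl mcW).
    apply: (@intg_bounded _ _ _ _ _ 1) => [|w]; first exact: mcW.
    by have := @gcdf_itv R ((y - W j w) / sg); rewrite /= ler_norml; lra.
  have hF' y : `|smooth_cdf P' (W j \o pi) sg y - gcdf (y / Num.sqrt (sg ^+ 2 + v j))| <= e.
    by rewrite cdfE.
  have := gaussian_coupling (mWp j) (mg j) (lawg j) sg0 qE mq law (v0 j) K0 eta0 hF' he.
  rewrite (_ : [set w | _] = [set w | (2 * sg * K + Num.sqrt (sg ^+ 2 + v j) * eta <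
        `|b' w j 0 - W j (pi' w)|)%R])//.
  by apply/seteqP; split => w /=; rewrite mxE.
Qed.

End coupled_vector.

(** * Joint asymptotic normality *)

Section asymptotic_normality.
Context {R : realType}.

Lemma enorm_le (m : nat) (x : 'cV[R]_m) (t : R) : 0 <= t ->
  (forall j, `|x j 0| <= t) -> enorm x <= m%:R * t.
Proof.
move=> t0 xt; have mt0 : 0 <= m%:R * t by rewrite mulr_ge0.
rewrite /enorm -[leRHS]ger0_norm// -sqrtr_sqr ler_wsqrtr//.
apply: (@le_trans _ _ (\sum_(j < m) t ^+ 2)).
  by apply: ler_sum => j _; rewrite -real_normK ?num_real// lerXn2r ?nnegrE.
rewrite sumr_const card_ord -[X in X <= _]mulr_natl exprMn; apply: ler_wpM2r; first exact: sqr_ge0.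
by rewrite -natrX ler_nat; case: (m) => // k; rewrite expnS leq_pmulr.
Qed.

Lemma enorm_measurable (m : nat) d (T : measurableType d) (f : T -> 'cV[R]_m) :
  (forall j, measurable_fun setT (fun w => f w j 0)) ->
  measurable_fun setT (fun w => enorm (f w)).
Proof.
move=> mf; have ms : measurable_fun setT (@Num.sqrt R).
  by apply: continuous_measurable_fun; exact: sqrt_continuous.
apply: (measurableT_comp ms (g := fun w => \sum_(j < m) f w j 0 ^+ 2)).
by apply: measurable_sum => j; exact: measurable_funX.
Qed.

Lemma ecvg0P (u : nat -> \bar R) : (forall n, 0 <= u n)%E ->
  (forall e : R, 0 < e -> \forall n \near \oo, (u n <= e%:E)%E) ->
  u n @[n --> \oo] --> 0%E.
Proof.
move=> u0 hu; apply/fine_cvgP; split.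
  near=> n; rewrite ge0_fin_numE//; apply: (@le_lt_trans _ _ 1%:E); last exact: ltry.
  by near: n; exact: hu.
apply/cvgr0Pnorm_le => e e0; near=> n.
have h : (u n <= e%:E)%E by near: n; exact: hu.
have fu : u n \is a fin_num.
  by rewrite ge0_fin_numE// (le_lt_trans h)// ltry.
by rewrite ger0_norm ?fine_ge0// -lee_fin fineK.
Unshelve. all: by end_near. Qed.

(** [n^(1/8)], of which all rates below are integer powers; [maxn 1 n] keeps it at least [1] at
    [n = 0]. *)
Definition root8 (n : nat) : R := Num.sqrt (Num.sqrt (Num.sqrt (maxn 1 n)%:R)).

Lemma root8_ge1 n : 1 <= root8 n.
Proof.
have h (x : R) : 1 <= x -> 1 <= Num.sqrt x.
  by move=> x1; rewrite -[leLHS]sqrtr1 ler_wsqrtr.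
by rewrite !h// ler1n leq_max.
Qed.

Lemma root8_pow4 n : (0 < n)%N -> root8 n ^+ 4 = Num.sqrt n%:R.
Proof.
move=> n0; rewrite /root8 (maxn_idPr n0) -[4%N]/(2 * 2)%N exprM.
by rewrite !sqr_sqrtr ?sqrtr_ge0.
Qed.

Lemma root8_inv_small (e : R) : 0 < e -> \forall n \near \oo, (root8 n)^-1 <= e.
Proof.
move=> e0; near=> n.
have n0 : (0 < n)%N by near: n; exact: nbhs_infty_gt.
have x1 := root8_ge1 n; have x0 : 0 < root8 n by apply: lt_le_trans x1.
have x8 : root8 n ^+ 8 = n%:R.
  by rewrite -[8%N]/(4 * 2)%N exprM root8_pow4// sqr_sqrtr.
rewrite -[leRHS]invrK lef_pV2 ?posrE ?invr_gt0//.
rewrite -(@ler_pXn2r _ 8) ?nnegrE ?invr_ge0 ?(ltW e0) ?(ltW x0)// x8.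
by near: n; exact: nbhs_infty_ger.
Unshelve. all: by end_near. Qed.

End asymptotic_normality.

Lemma independent_sub {R : realType} d (T : measurableType d) (P : probability T R)
  (I J : finType) (f : J -> I) (X : I -> T -> R) : injective f ->
  independent_family P X -> independent_family P (X \o f).
Proof.
move=> fI iX A mA.
(* Indices outside the image of [f] receive the whole space and contribute a factor [1]. *)
pose B i := if [pick j | f j == i] is Some j then A j else setT.
have Bf j : B (f j) = A j.
  rewrite /B; case: pickP => [k /eqP /fI -> //|/(_ j)]; by rewrite eqxx.
have BN i : i \notin [set f j | j : J] -> B i = setT.
  rewrite /B; case: pickP => // j /eqP <- /negP[]; exact: imset_f.
have mB i : measurable (B i) by rewrite /B; case: pickP.
rewrite (_ : [set w | _] = [set w | forall i, B i (X i w)]).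
  rewrite (iX B mB) (bigID (fun i => i \in [set f j | j : J]))/= [X in _ * X]big1 ?mulr1.
    congr (_%:E); rewrite big_imset/=; last by move=> ? ? _ _; exact: fI.
    by apply: eq_big => j; rewrite ?inE// Bf.
  by move=> i /BN ->; rewrite preimage_setT probability_setT.
apply/seteqP; split => w /= h; last by move=> j; rewrite -Bf; exact: h.
move=> i; case: (boolP (i \in [set f j | j : J])) => [/imsetP[j _ ->]|/BN ->//].
by rewrite Bf; exact: h.
Qed.

Lemma pair_inj (I J : Type) (j : J) : injective (fun i : I => (i, j)).
Proof. by move=> i k []. Qed.

Section clt_vector.
Context {R : realType} (m : nat) (d : nat -> measure_display)
  (T : forall n, measurableType (d n)) (P : forall n, probability (T n) R).
Variables (X : forall n, 'I_n * 'I_m -> T n -> R) (v : nat -> 'I_m -> R).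
Variables (V b : R) (a : forall n, T n -> 'cV[R]_m) (r : nat -> R).
Arguments X : clear implicits.
Arguments a : clear implicits.
Hypothesis mX : forall n ij, measurable_fun setT (X n ij).
Hypothesis iX : forall n, independent_family (P n) (X n).
Hypothesis i1 : forall n ij, intg (P n) (X n ij).
Hypothesis i2 : forall n ij, intg (P n) (fun w => X n ij w ^+ 2).
Hypothesis i3 : forall n ij, intg (P n) (fun w => `|X n ij w| ^+ 3).
Hypothesis m1 : forall n ij, mean (P n) (X n ij) = 0.
Hypothesis m2 : forall n i j, mean (P n) (fun w => X n (i, j) w ^+ 2) = v n j.
Hypothesis m3 : forall n ij, mean (P n) (fun w => `|X n ij w| ^+ 3) <= b.
Hypotheses (b0 : 0 <= b) (v0 : forall n j, 0 <= v n j) (vV : forall n j, v n j <= V).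
Hypothesis ma : forall n j, measurable_fun setT (fun w => a n w j 0).
Hypothesis r0 : forall e, 0 < e -> \forall n \near \oo, r n <= e.
Hypothesis aW : forall n j w, (0 < n)%N ->
  `|a n w j 0 - nsum (fun i => X n (i, j)) w| <= r n.

Let W n j := nsum (fun i => X n (i, j)).

(** With [x = root8 n], [sg = 1 / x] and [sqrt n = x^4], the two Lindeberg terms are [18 b / x] and
    [23 v^2 / x^4]. *)
Let bound n j y : (0 < n)%N ->
  `|smooth_cdf (P n) (@W n j) (root8 n)^-1 y - gcdf (y / Num.sqrt ((root8 n)^-1 ^+ 2 + v n j))|
  <= (18 * b + 23 * V ^+ 2) / root8 n.
Proof.
move=> n0; have x1 := @root8_ge1 R n; have x4 := @root8_pow4 R n n0.
set x := root8 n in x1 x4 *; have x0 : 0 < x by apply: lt_le_trans x1.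
have xn : x != 0 by rewrite gt_eqF.
have V0 : 0 <= V := le_trans (v0 n j) (vV n j).
have n2 : (n%:R : R) = x ^+ 8.
  by rewrite -[8%N]/(4 * 2)%N exprM x4 sqr_sqrtr.
have xi0 : 0 < x^-1 by rewrite invr_gt0.
have h := lindeberg_smooth n0 (fun i => mX (i, j)) (independent_sub (f := fun i => (i, j)) (@pair_inj _ _ j) (@iX n))
  (fun i => i1 (i, j)) (fun i => i2 (i, j)) (fun i => i3 (i, j))
  (fun i => m1 (i, j)) (fun i => m2 i j) (fun i => m3 (i, j)) xi0 y.
apply: (le_trans h); rewrite -x4 n2 (mulrDl (18 * b)); apply: lerD.
  by rewrite le_eqVlt; apply/orP; left; apply/eqP; field.
rewrite (_ : x ^+ 8 * x^-1 ^+ 4 = x ^+ 4); last by field.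
have hv : v n j ^+ 2 <= V ^+ 2 by apply: lerXn2r; rewrite ?nnegrE.
have hx : (x ^+ 4)^-1 <= x^-1.
  rewrite lef_pV2 ?posrE ?exprn_gt0// -[leLHS]expr1; exact: ler_weXn2l.
have h1 : 0 <= 23 * v n j ^+ 2 by apply: mulr_ge0; [exact: ler0n|exact: sqr_ge0].
have h2 : 0 <= (x ^+ 4)^-1 by rewrite invr_ge0; exact: exprn_ge0 (ltW x0).
exact: (ler_pM h1 h2 (ler_wpM2l (ler0n R 23) hv) hx).
Qed.

Lemma clt_vector : asymp_indep_normal P a v.
Proof.
have xi0 n : 0 < (root8 n)^-1 :> R.
  by rewrite invr_gt0; apply: lt_le_trans (root8_ge1 n).
pose H n := inhabited_witness
  (coupling_exists (@mX n) (@iX n) (v0 n) (xi0 n)).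
exists (fun n => cdisp (H n)), (fun n => cT (H n)), (fun n => cP (H n)),
  (fun n => cpi (H n)), (fun n => cb (H n)); split.
- by move=> n; exact: cpiP.
- by move=> n; exact: cb_indep.
- by move=> n; exact: cb_law.
move=> eps eps0; apply: ecvg0P => [n|dl dl0]; first exact: measure_ge0.
(* The successor keeps [M] positive for every [m]. *)
pose M : R := m.+1%:R; have M0 : 0 < M by rewrite ltr0n.
(* Each coordinate may deviate by [2 * e]: once from [a] to the normalized sum, once from there to
   the Gaussian. *)
pose e := eps / (2 * M); have ep : 0 < e by rewrite divr_gt0// mulr_gt0.
have dl2 : 0 < dl / (2 * M) by rewrite divr_gt0// mulr_gt0.
have [K K0 hK] := normal_tail dl2.
(* As [sg <= 1], the number [|V| + 2] bounds [sqrt (sg^2 + v)], so the [eta] term of [cb_close] is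
   at most [e / 2]; the other half is for [2 * sg * K]. *)
pose eta := e / (2 * (`|V| + 2)).
have V2 : 0 < `|V| + 2 by rewrite ltr_wpDl.
have eta0 : 0 < eta by rewrite divr_gt0// mulr_gt0.
pose C := 18 * b + 23 * V ^+ 2.
have C0 : 0 <= C by have := sqr_ge0 V; move: (b0) => b0'; rewrite /C; lra.
pose t := eta * gpdf (K + eta).
have t0 : 0 < t by rewrite mulr_gt0// gpdf_gt0.
near=> n.
have n0 : (0 < n)%N by near: n; exact: nbhs_infty_gt.
have rn : r n <= e by near: n; exact: r0.
have s1 : (root8 n)^-1 <= e / (4 * K).
  by near: n; apply: root8_inv_small; rewrite divr_gt0// mulr_gt0.
have s2 : (root8 n)^-1 <= t / (C + 1).
  by near: n; apply: root8_inv_small; rewrite divr_gt0// ltr_wpDl.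
have hB := @cb_close _ _ _ _ _ _ _ _ _ (H n).
set sg := (root8 n)^-1 in s1 s2 hB *.
have sgp : 0 < sg by exact: xi0.
have sg1 : sg <= 1 by rewrite invf_le1 ?root8_ge1// (lt_le_trans _ (root8_ge1 n)).
have Cs : C / root8 n < t.
  have h : C * sg <= C * (t / (C + 1)) by rewrite ler_wpM2l.
  apply: le_lt_trans h _; rewrite mulrA ltr_pdivrMr ?ltr_wpDl//.
  by rewrite mulrC ltr_pM2l// ltrDl.
have mb j : measurable_fun setT (fun w => cb (H n) w j 0).
  exact: measurable_entry.
have mWp j : measurable_fun setT (fun w => @W n j (cpi (H n) w)).
  apply: measurableT_comp; last by [].
  by apply: nsum_measurable => i; exact: mX.
have map' j : measurable_fun setT (fun w => a n (cpi (H n) w) j 0).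
  by apply: (measurableT_comp (@ma n j)).
have mset (f : cT (H n) -> R) (c : R) : measurable_fun setT f ->
    measurable [set w | c < `|f w|].
  move=> mf; have mn : measurable_fun setT (fun w => `|f w|) by exact: measurableT_comp.
  rewrite (_ : [set _ | _] = (fun w => `|f w|) @^-1` `]c, +oo[%classic).
    by rewrite -[_ @^-1` _]setTI; exact: mn.
  by apply/seteqP; split => x /=; rewrite in_itv/= andbT.
have hj (j : 'I_m) :
    (cP (H n) [set w | (e < `|cb (H n) w j 0 - @W n j (cpi (H n) w)|)%R] <= (dl / M)%:E)%E.
  have hb := hB j _ K eta K0 eta0 (fun y => bound j y n0) Cs.
  have := le_trans hb (leeD hK hK).
  rewrite -EFinD (_ : dl / (2 * M) + dl / (2 * M) = dl / M); last by field; rewrite gt_eqF.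
  apply: le_trans; apply: prob_le; [exact: mset _ _ (measurable_funB (mb j) (mWp j))..|].
  move=> w /=; apply: le_lt_trans.
  have hs : Num.sqrt (sg ^+ 2 + v n j) <= `|V| + 2.
    rewrite -[leRHS]ger0_norm ?(ltW V2)// -sqrtr_sqr ler_wsqrtr//.
    have v1 := vV n j; have := ler_norm V => V1.
    have sg2 : sg ^+ 2 <= 1 by rewrite exprn_ile1// ltW.
    by have := normr_ge0 V; nra.
  have h1 : Num.sqrt (sg ^+ 2 + v n j) * eta <= e / 2.
    have -> : e / 2 = (`|V| + 2) * eta by rewrite /eta; field; rewrite gt_eqF.
    by rewrite ler_pM2r.
  have h2 : 2 * sg * K <= e / 2.
    have -> : e / 2 = 2 * (e / (4 * K)) * K by field; rewrite gt_eqF.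
    by rewrite ler_pM2r// ler_pM2l.
  by rewrite [leRHS](_ : e = e / 2 + e / 2); [exact: lerD|field].
have dM0 : 0 <= dl / M by apply: divr_ge0; exact: ltW.
have [mU hU] := union_bound (P := cP (H n)) (Q := xpredT) dM0
  (fun j : 'I_m => mset _ e (measurable_funB (mb j) (mWp j))) (fun j _ => hj j).
apply: le_trans (_ : (\sum_(j < m) dl / M)%:E <= _)%E; last first.
  rewrite lee_fin sumr_const card_ord -[leLHS]mulr_natl mulrA ler_pdivrMr//.
  by rewrite mulrC ler_pM2l// /M ler_nat.
apply: le_trans hU; apply: prob_le => //.
  apply: mset; apply: enorm_measurable => j.
  rewrite (_ : (fun w => _) = fun w => a n (cpi (H n) w) j 0 - cb (H n) w j 0).
    exact: measurable_funB.
  by apply/funext => w; rewrite !mxE.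
move=> w /=; rewrite mulr1 => hw; apply: contrapT => hN.
move: hw; apply/negP; rewrite -leNgt ger0_norm ?sqrtr_ge0//.
have -> : eps = M * (2 * e) by rewrite /e; field; rewrite gt_eqF.
apply: (@le_trans _ _ (m%:R * (2 * e))); last first.
  have mM : m%:R <= M by rewrite ler_nat.
  by apply: (ler_wpM2r _ mM); lra.
apply: enorm_le => [|j]; first by lra.
rewrite !mxE; set A := a n _ j 0; set B := cb _ _ j 0.
have h1 : `|A - @W n j (cpi (H n) w)| <= e by apply: le_trans rn; exact: aW.
have h2 : `|@W n j (cpi (H n) w) - B| <= e.
  by rewrite leNgt; apply/negP => h; apply: hN; exists j => //=; rewrite distrC.
by apply: le_trans (ler_distD (@W n j (cpi (H n) w)) _ _) _; lra.
Unshelve. all: by end_near.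
Qed.

End clt_vector.

(** * The spiked covariance model *)

Section std_moments.
Context {d} {T : measurableType d} {R : realType} (P : probability T R).
Variables (X : T -> R) (C : R).
Hypothesis C0 : 0 < C.
Hypothesis mX : measurable_fun setT X.
Hypothesis EX : ('E_P[X] = 0)%E.
Hypothesis VX : ('V_P[X] = 1)%E.
Hypothesis sX : (psi2_norm P X <= C%:E)%E.

Lemma fine_expectation (Y : T -> R) : fine ('E_P[Y])%E = mean P Y.
Proof. by rewrite unlock. Qed.

(** Bounds the mean of [1 + X^6]: the cubic Taylor term of [exp (a x^2)] gives
    [x^6 <= 6 / a^3 * exp (a x^2)], whose mean is at most [12 / a^3]. Degree six is what third
    absolute moments of [X^2 - 1] require. *)
Definition pow6_bound (c : R) : R := 1 + 12 / sq_rate c ^+ 3.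

Lemma sq_rate_gt0 (c : R) : 0 < c -> 0 < sq_rate c.
Proof. by move=> c0; rewrite invr_gt0 !mulr_gt0 ?expR_gt0 ?exprn_gt0. Qed.

Lemma poly6_mean (f : R -> R) (c : R) : 0 <= c -> measurable_fun setT f ->
  (forall x, `|f x| <= c * (1 + x ^+ 6)) ->
  intg P (f \o X) /\ mean P (fun w => `|f (X w)|) <= c * pow6_bound C.
Proof.
move=> c0 mf hf; have a0 := sq_rate_gt0 C0.
set a := sq_rate C in a0.
have [iE mE] := exp_sq_psi2 C0 mX sX; rewrite -/a in iE mE.
have h6 x : x ^+ 6 <= 6 / a ^+ 3 * expR (a * x ^+ 2).
  have y0 : 0 <= a * x ^+ 2 by rewrite mulr_ge0 ?sqr_ge0// ltW.
  have h := @expR_ge1Dxn R (a * x ^+ 2) 2 y0.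
  have e : x ^+ 6 = 6 / a ^+ 3 * ((a * x ^+ 2) ^+ 3 / (3`!)%:R).
    by rewrite !factS fact0; field; rewrite gt_eqF.
  rewrite e ler_pM2l; last by rewrite divr_gt0// exprn_gt0.
  by apply: le_trans h; rewrite lerDr.
pose D w := c * (1 + 6 / a ^+ 3 * expR (a * X w ^+ 2)).
have iD' : intg P (fun w => 1 + 6 / a ^+ 3 * expR (a * X w ^+ 2)).
  by apply: intgD; [exact: intg_cst|exact: intgZ].
have iD : intg P D by exact: intgZ.
have fD w : `|f (X w)| <= D w.
  by apply: le_trans (hf _) _; rewrite /D ler_wpM2l// lerD2l.
have ifX : intg P (f \o X).
  by apply: (intg_le _ fD iD); exact: measurableT_comp.
split => //; apply: le_trans (mean_le (intg_norm ifX) iD fD) _.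
rewrite (meanZ _ iD') ler_wpM2l// meanD ?mean_cst//; [|exact: intg_cst|exact: intgZ].
rewrite lerD2l (meanZ _ iE) /pow6_bound -/a.
rewrite (_ : 12 / a ^+ 3 = 6 / a ^+ 3 * 2); last by field; rewrite gt_eqF.
by rewrite ler_pM2l// divr_gt0// exprn_gt0.
Qed.

Let pow_le k (x : R) : (k <= 6)%N -> `|x ^+ k| <= 1 * (1 + x ^+ 6).
Proof.
move=> k6; rewrite mul1r normrX.
have -> : x ^+ 6 = `|x| ^+ 6 by rewrite -normrX ger0_norm// exprn_even_ge0.
have [x1|x1] := leP `|x| 1.
  by rewrite (le_trans (exprn_ile1 k (normr_ge0 x) x1))// lerDl exprn_ge0.
by rewrite (le_trans (ler_weXn2l (ltW x1) k6))// lerDr.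
Qed.

Lemma std_intg_pow k : (k <= 6)%N -> intg P (fun w => X w ^+ k).
Proof.
move=> k6; apply: (poly6_mean ler01 _ (fun x => pow_le x k6)).1.
exact: measurable_funX.
Qed.

Lemma std_mean1 : mean P X = 0.
Proof. by rewrite -fine_expectation EX. Qed.

Lemma std_mean2 : mean P (fun w => X w ^+ 2) = 1.
Proof.
rewrite -[RHS]/(fine 1%E) -VX /variance [in RHS]unlock EX /= fine_expectation.
by congr mean; apply/funext => w; rewrite !fctE /= subr0 expr2.
Qed.

Lemma std_mean4 : mean P (fun w => X w ^+ 4) <= pow6_bound C.
Proof.
have m4 : measurable_fun setT (fun x : R => x ^+ 4) by exact: measurable_funX.
have [i4 h] := poly6_mean ler01 m4 (fun x => @pow_le 4 x isT).
apply: le_trans (mean_le i4 (intg_norm i4) (fun w => ler_norm _)) _.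
by rewrite mul1r in h.
Qed.

Lemma std_sq_mean : mean P (fun w => X w ^+ 2 - 1) = 0.
Proof.
by rewrite meanB ?mean_cst ?std_mean2 ?subrr//; [exact: std_intg_pow|exact: intg_cst].
Qed.

Lemma std_sq_sq : intg P (fun w => (X w ^+ 2 - 1) ^+ 2) /\
  mean P (fun w => (X w ^+ 2 - 1) ^+ 2) = kurtosis P X - 1.
Proof.
have e w : (X w ^+ 2 - 1) ^+ 2 = X w ^+ 4 - 2 * X w ^+ 2 + 1 by ring.
have i4 := @std_intg_pow 4 isT; have i2 := @std_intg_pow 2 isT.
have i42 : intg P (fun w => X w ^+ 4 - 2 * X w ^+ 2) by apply: intgB => //; exact: intgZ.
under eq_fun do rewrite e.
split; first by apply: intgD => //; exact: intg_cst.
rewrite meanD ?mean_cst//; last exact: intg_cst.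
rewrite (meanB i4 (intgZ _ i2)) (meanZ _ i2) std_mean2 /kurtosis.
by rewrite fine_expectation; ring.
Qed.

Lemma std_sq_cube : intg P (fun w => `|X w ^+ 2 - 1| ^+ 3) /\
  mean P (fun w => `|X w ^+ 2 - 1| ^+ 3) <= 4 * pow6_bound C.
Proof.
have hf (x : R) : `| `|x ^+ 2 - 1| ^+ 3 | <= 4 * (1 + x ^+ 6).
  rewrite ger0_norm ?exprn_ge0//.
  have x20 := sqr_ge0 x.
  apply: (@le_trans _ _ ((x ^+ 2 + 1) ^+ 3)).
    rewrite lerXn2r ?nnegrE ?addr_ge0// (le_trans (ler_normB _ _))//.
    by rewrite normr1 (ger0_norm x20).
  rewrite (_ : x ^+ 6 = (x ^+ 2) ^+ 3); last by rewrite -exprM.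
  move: (x ^+ 2) x20 => u u0; rewrite -subr_ge0.
  rewrite (_ : _ - _ = 3 * (u + 1) * (u - 1) ^+ 2); last by ring.
  by rewrite mulr_ge0 ?sqr_ge0// mulr_ge0// addr_ge0.
have mf : measurable_fun setT (fun x : R => `|x ^+ 2 - 1| ^+ 3).
  apply: measurable_funX; apply: measurableT_comp; first exact: normr_measurable.
  by apply: measurable_funB => //; exact: measurable_funX.
have [i h] := poly6_mean (ler0n R 4) mf hf.
split => //; apply: le_trans h.
by apply: mean_le => //; [exact: intg_norm|move=> w; exact: ler_norm].
Qed.

End std_moments.

Section second_moment_sum.
Context {d} {T : measurableType d} {R : realType} (P : probability T R).
Variables (I : finType) (X : I -> T -> R).
Hypothesis mX : forall i, measurable_fun setT (X i).
Hypothesis iX : independent_family P X.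
Hypothesis intX : forall i, intg P (X i).
Hypothesis X0 : forall i, mean P (X i) = 0.
Hypothesis intX2 : forall i, intg P (fun w => X i w ^+ 2).

Lemma mean_sq_sum : intg P (fun w => (\sum_i X i w) ^+ 2) /\
  mean P (fun w => (\sum_i X i w) ^+ 2) = \sum_i mean P (fun w => X i w ^+ 2).
Proof.
have pair i j : intg P (fun w => X i w * X j w) /\
    mean P (fun w => X i w * X j w) = if i == j then mean P (fun w => X i w ^+ 2) else 0.
  case: eqVneq => [->|ij].
    by split; [exact: intX2|].
  have [h1 ->] := indep_pair_mean mX iX ij (@measurable_id _ _ _) (@measurable_id _ _ _)
    (intX i) (intX j).
  by split => //; rewrite /comp (X0 i) mul0r.
have e w : (\sum_i X i w) ^+ 2 = \sum_i \sum_j X i w * X j w.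
  by rewrite expr2 mulr_suml; apply: eq_bigr => i _; rewrite mulr_sumr.
under eq_fun do rewrite e.
have i1 i : intg P (fun w => \sum_j X i w * X j w).
  by apply: intg_sum => j; exact: (pair i j).1.
split; first by apply: intg_sum => i; exact: i1.
rewrite mean_sum//; apply: eq_bigr => i _.
rewrite mean_sum; last by move=> j; exact: (pair i j).1.
rewrite (bigD1 i)//= (pair i i).2 eqxx big1 ?addr0// => j ji.
by rewrite (pair i j).2 eq_sym (negbTE ji).
Qed.

End second_moment_sum.

Section iid_rows.
Context {R : realType} {d1 d2} {T : measurableType d1} {S : measurableType d2}
  (P : probability T R) (Q : probability S R).
Variables (n p : nat) (U : 'I_n -> T -> 'cV[R]_p) (Z : S -> 'cV[R]_p).
Hypothesis mU : forall i, measurable_fun setT (U i).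
Hypothesis mZ : measurable_fun setT Z.
Hypothesis iU : independent_family P U.
Hypothesis UZ : forall i, same_law P Q (U i) Z.
Hypothesis iZ : independent_family Q (fun (k : 'I_p) w => Z w k 0).

Definition entry (x : 'I_n * 'I_p) w : R := U x.1 w x.2 0.

Lemma entry_measurable x : measurable_fun setT (entry x).
Proof. exact: measurable_entry. Qed.

(** A rectangle in the entries is a rectangle in the rows, whose sides are again rectangles in the
    coordinates; the law of [Z] factors each side. *)
Lemma entry_indep : independent_family P entry.
Proof.
move=> A mA.
have mE (k : 'I_p) (B : set R) : measurable B ->
    measurable [set M : 'cV[R]_p | B (M k 0)].
  move=> mB; have h : measurable_fun setT (fun M : 'cV[R]_p => M k 0).
    exact: (measurable_entry k 0 (@measurable_id _ _ _)).
  by have := h measurableT B mB; rewrite setTI.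
pose D i := [set M : 'cV[R]_p | forall k, A (i, k) (M k 0)].
have mD i : measurable (D i).
  rewrite (_ : D i = \bigcap_(k in setT) [set M : 'cV[R]_p | A (i, k) (M k 0)]).
    by apply: fin_bigcap_measurable => [|k _]; [exact: finite_finset|exact: mE].
  by apply/seteqP; split => [M h k _|M h k]; exact: h.
rewrite (_ : [set w | _] = [set w | forall i, D i (U i w)]); last first.
  by apply/seteqP; split => w /= h; [move=> i k; exact: (h (i, k))|move=> [i k]; exact: h].
rewrite (iU mD); congr (_%:E).
have e : \prod_x fine (P (entry x @^-1` A x)) =
    \prod_i \prod_k fine (P (entry (i, k) @^-1` A (i, k))).
  by rewrite pair_bigA/=; apply: eq_bigr => -[].
rewrite e; apply: eq_bigr => i _.
rewrite (UZ i (mD i)) (iZ (fun k => mA (i, k)))/=; apply: eq_bigr => k _.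
congr fine; exact/esym/(UZ i (mE k _ (mA (i, k)))).
Qed.

Lemma entry_mean (f : R -> R) x : measurable_fun setT f ->
  intg Q (fun w => f (Z w x.2 0)) ->
  intg P (fun w => f (entry x w)) /\
  mean P (fun w => f (entry x w)) = mean Q (fun w => f (Z w x.2 0)).
Proof.
move=> mf iQ; have mg : measurable_fun setT (fun M : 'cV[R]_p => f (M x.2 0)).
  by apply: measurableT_comp => //; exact: (measurable_entry _ _ (@measurable_id _ _ _)).
split; first exact: (same_law_intg (mU x.1) mZ (UZ x.1) mg iQ).
exact: (same_law_mean (mU x.1) mZ (UZ x.1) mg iQ).
Qed.

End iid_rows.

(** * Concentration of the leading Gram matrix *)

Section gram_concentration.
Context {d} {T : measurableType d} {R : realType} (P : probability T R).
Variables (n p m : nat) (z : 'I_n * 'I_p -> T -> R) (f : 'I_m -> 'I_p) (B : R).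
Hypothesis mz : forall x, measurable_fun setT (z x).
Hypothesis iz : independent_family P z.
Hypothesis iz1 : forall x, intg P (z x).
Hypothesis iz2 : forall x, intg P (fun w => z x w ^+ 2).
Hypothesis iz4 : forall x, intg P (fun w => z x w ^+ 4).
Hypothesis z0 : forall x, mean P (z x) = 0.
Hypothesis z1 : forall x, mean P (fun w => z x w ^+ 2) = 1.
Hypothesis z4 : forall x, mean P (fun w => z x w ^+ 4) <= B.
Hypothesis B0 : 0 <= B.
Hypothesis f_inj : injective f.
Hypothesis n0 : (0 < n)%N.

Let D j l (i : 'I_n) w : R := z (i, f j) w * z (i, f l) w - (j == l)%:R.

Let mD j l i : measurable_fun setT (D j l i).
Proof. by apply: measurable_funB => //; exact: measurable_funM. Qed.

Let iD j l : independent_family P (D j l).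
Proof.
apply: (indep_blocks (g := fun x : 'I_n * 'I_p => x.1) mz iz) => i.
have h k : measurable_fun setT
    (z (i, k) : g_sigma_algebraType (gen_sys [set x | x.1 = i] z) -> R).
  exact: (gen_sigma_fun (J := [set x | x.1 = i]) (X := z) (i := (i, k)) erefl).
by apply: measurable_funB => //; exact: measurable_funM.
Qed.

Let D2_le j l i w : D j l i w ^+ 2 <= z (i, f j) w ^+ 4 + z (i, f l) w ^+ 4 + 2.
Proof.
rewrite /D; move: (z _ w) (z _ w) => x y; case: (j == l); rewrite ?subr0/=; last first.
  by have := sqr_ge0 (x ^+ 2 - y ^+ 2); have := sqr_ge0 (x ^+ 2 + y ^+ 2); nra.
have := sqr_ge0 (x ^+ 2 - y ^+ 2); have := sqr_ge0 (x * y + 1).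
have := sqr_ge0 (x ^+ 2 + y ^+ 2); nra.
Qed.

Let D_moments j l i : [/\ intg P (D j l i), mean P (D j l i) = 0,
  intg P (fun w => D j l i w ^+ 2) & mean P (fun w => D j l i w ^+ 2) <= 2 * B + 2].
Proof.
have [ip mp] : intg P (fun w => z (i, f j) w * z (i, f l) w) /\
    mean P (fun w => z (i, f j) w * z (i, f l) w) = (j == l)%:R.
  case: eqVneq => [->|jl]; first by split; [exact: iz2|exact: z1].
  have ne : (i, f j) != (i, f l) by apply: contra_neq jl => -[/f_inj].
  have [h1 ->] := indep_pair_mean mz iz ne (@measurable_id _ _ _) (@measurable_id _ _ _)
    (iz1 _) (iz1 _).
  by split => //; rewrite /comp z0 mul0r.
have i44 : intg P (fun w => z (i, f j) w ^+ 4 + z (i, f l) w ^+ 4) by exact: intgD.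
have ib : intg P (fun w => z (i, f j) w ^+ 4 + z (i, f l) w ^+ 4 + 2).
  by apply: intgD => //; exact: intg_cst.
have i2 : intg P (fun w => D j l i w ^+ 2).
  apply: (intg_le _ _ ib) => [|w]; first by apply: measurable_funX; exact: mD.
  by rewrite ger0_norm ?sqr_ge0// D2_le.
split => //; first by apply: intgB => //; exact: intg_cst.
  by rewrite /D meanB ?mean_cst ?mp ?subrr//; exact: intg_cst.
apply: le_trans (mean_le i2 ib (D2_le j l i)) _.
rewrite meanD ?mean_cst//; last exact: intg_cst.
rewrite meanD//; have := z4 (i, f j); have := z4 (i, f l); lra.
Qed.

(** For a fixed pair [(j, l)] the centered products from different rows are independent with second
    moment at most [2 B + 2]; the factor [m * m] is the union bound over the pairs. *)
Lemma gram_event (eta : R) : 0 < eta -> exists A : set T,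
  [/\ measurable A, (P A <= ((m * m)%:R * ((2 * B + 2) / (n%:R * eta ^+ 2)))%:E)%E &
    forall w, ~ A w -> forall j l,
      `|n%:R^-1 * \sum_i z (i, f j) w * z (i, f l) w - (j == l)%:R| <= eta].
Proof.
move=> eta0.
have nR : 0 < n%:R :> R by rewrite ltr0n.
pose F (x : 'I_m * 'I_m) := [set w | ((n%:R * eta) ^+ 2 <= (\sum_i D x.1 x.2 i w) ^+ 2)%R].
have ne0 : 0 < (n%:R * eta) ^+ 2 by rewrite exprn_gt0// mulr_gt0.
pose c := (2 * B + 2) / (n%:R * eta ^+ 2).
have S x := mean_sq_sum (mD x.1 x.2) (@iD x.1 x.2) (fun i => let: And4 h _ _ _ := D_moments x.1 x.2 i in h)
  (fun i => let: And4 _ h _ _ := D_moments x.1 x.2 i in h)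
  (fun i => let: And4 _ _ h _ := D_moments x.1 x.2 i in h).
have hF x : (P (F x) <= c%:E)%E.
  have [iS mS] := S x.
  apply: le_trans (markov_mean ne0 iS (fun w => sqr_ge0 _)) _.
  rewrite lee_fin mS ler_pdivrMr//.
  apply: (@le_trans _ _ (\sum_(i < n) (2 * B + 2))).
    by apply: ler_sum => i _; have [] := D_moments x.1 x.2 i.
  rewrite sumr_const card_ord -[leLHS]mulr_natl le_eqVlt; apply/orP; left; apply/eqP.
  by rewrite /c; field; rewrite !gt_eqF.
have mF x : measurable (F x).
  have mS : measurable_fun setT (fun w => (\sum_i D x.1 x.2 i w) ^+ 2).
    by apply: measurable_funX; apply: measurable_sum => i; exact: mD.
  rewrite (_ : F x = (fun w => (\sum_i D x.1 x.2 i w) ^+ 2) @^-1` `[(n%:R * eta) ^+ 2, +oo[%classic).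
    by rewrite -[_ @^-1` _]setTI; exact: mS.
  by apply/seteqP; split => w /=; rewrite in_itv/= andbT.
have c0 : 0 <= c by rewrite /c divr_ge0 ?mulr_ge0 ?sqr_ge0//; move: (B0); lra.
have [mU hU] := union_bound (P := P) (Q := xpredT) c0 mF (fun x _ => hF x).
exists [set w | exists2 x, xpredT x & F x w]; split => //.
  by apply: le_trans hU _; rewrite lee_fin sumr_const card_prod card_ord mulr_natl.
move=> w hw j l; rewrite leNgt; apply/negP => h; apply: hw; exists (j, l) => //=.
rewrite /F/= -[leRHS]real_normK ?num_real// lerXn2r ?nnegrE ?mulr_ge0 ?(ltW nR) ?(ltW eta0)//.
have -> : \sum_i D j l i w = n%:R * (n%:R^-1 * \sum_i z (i, f j) w * z (i, f l) w - (j == l)%:R).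
  rewrite /D sumrB sumr_const card_ord -[X in _ - X]mulr_natl mulrBr mulrA divff ?mul1r//.
  by rewrite gt_eqF.
by rewrite normrM (gtr0_norm nR) ler_pM2l// ltW.
Qed.

End gram_concentration.

(** * Splitting the energy into spikes, bulk mean and noise *)

Section spiked_decomposition.
Context {R : realType} {d} {T : measurableType d}.
Variables (m n p : nat) (mp : (m < p)%N).
Variables (lam : 'I_p -> R) (z : 'I_n * 'I_p -> T -> R) (x : 'I_n -> 'cV[R]_p) (w : T).
Hypothesis n0 : (0 < n)%N.
Hypothesis lam0 : forall k, 0 < lam k.
Hypothesis xz : forall i k, x i k 0 = Num.sqrt (lam k) * z (i, k) w.

(** Weights vanishing on the leading coordinates let [noise] keep all [p] columns, without
    reindexing. *)
Definition tail_weight (k : 'I_p) : R := if (k < m)%N then 0 else lam k.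
Definition tail_mean : R := n%:R^-1 * \sum_k tail_weight k.
Definition lead_gram (j l : 'I_m) : R :=
  n%:R^-1 * \sum_i z (i, lead_idx mp j) w * z (i, lead_idx mp l) w.

Let q : R := Num.sqrt n%:R.
Let nR : 0 < n%:R :> R. Proof. by rewrite ltr0n. Qed.
Let q2 : q^-1 * q^-1 = n%:R^-1.
Proof. by rewrite -expr2 exprVn sqr_sqrtr// ltW. Qed.

Let y : 'M[R]_(m, n) := \matrix_(j, i) (q^-1 * z (i, lead_idx mp j) w).
Let K : 'M[R]_(n, p) := \matrix_(i, k) (q^-1 * x i k 0).

Lemma sample_cov_gram : sample_cov x = K^T *m K.
Proof.
rewrite /sample_cov; apply/matrixP => k l; rewrite !mxE mulr_sumr.
by apply: eq_bigr => i _; rewrite !mxE mulrACA q2.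
Qed.

Let gramE j l : (y *m y^T) j l = lead_gram j l.
Proof.
rewrite mxE /lead_gram mulr_sumr; apply: eq_bigr => i _.
by rewrite !mxE mulrACA q2.
Qed.

Let split_energy (v : 'rV[R]_n) :
  nrm2 (v *m K) - \sum_j lam (lead_idx mp j) * (v *m y^T) 0 j ^+ 2 - tail_mean * nrm2 v =
  n%:R^-1 * qf (noise z tail_weight w) v.
Proof.
pose xi k := \sum_i v 0 i * z (i, k) w.
have e1 : nrm2 (v *m K) = \sum_k n%:R^-1 * (lam k * xi k ^+ 2).
  rewrite nrm2E; apply: eq_bigr => k _; rewrite mxE.
  rewrite (_ : \sum_j _ = q^-1 * Num.sqrt (lam k) * xi k); last first.
    rewrite /xi mulr_sumr; apply: eq_bigr => i _; rewrite !mxE xz; ring.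
  by rewrite -q2 -[in RHS](sqr_sqrtr (ltW (lam0 k))); ring.
have e2 j : (v *m y^T) 0 j = q^-1 * xi (lead_idx mp j).
  by rewrite mxE /xi mulr_sumr; apply: eq_bigr => i _; rewrite !mxE; ring.
rewrite qf_noise -/xi e1 (bigID (fun k : 'I_p => (k < m)%N))/=.
rewrite (big_ord_narrow (ltnW mp)) /=.
rewrite (eq_bigr (fun j => lam (lead_idx mp j) * (v *m y^T) 0 j ^+ 2)) => [|j _]; last first.
  by rewrite e2 -q2 -/(lead_idx mp j); ring.
rewrite addrC addrK /tail_mean -mulrA -mulr_sumr -mulrBr; congr (_ * _).
rewrite big_mkcond /= mulr_suml -sumrB; apply: eq_bigr => k _.
by rewrite /tail_weight -/(xi k); case: (k < m)%N => /=; ring.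
Qed.

Lemma spiked_eigenvalue (delta theta eta : R) (j : 'I_m) :
  0 < delta -> delta <= 1 -> 0 <= eta -> 2 * eta * (m%:R + 2) <= delta -> 0 <= theta ->
  (forall i k : 'I_m, (i < k)%N ->
    lam (lead_idx mp k) <= (1 - delta) * lam (lead_idx mp i)) ->
  (forall i k, `|lead_gram i k - (i == k)%:R| <= eta) ->
  (forall v, `|qf (noise z tail_weight w) v| <= n%:R * theta * nrm2 v) ->
  `|(eigvals (sample_cov x))`_j / lam (lead_idx mp j) - lead_gram j j -
     tail_mean / lam (lead_idx mp j)|
  <= theta / lam (lead_idx mp j) + 4 * m%:R / delta * eta ^+ 2.
Proof.
move=> d0 d1 e0 ed t0 gap hG hN.
have tm0 : 0 <= tail_mean.
  rewrite mulr_ge0 ?invr_ge0 ?(ltW nR)//; apply: sumr_ge0 => k _.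
  by rewrite /tail_weight; case: ifP => // _; exact: ltW.
have hK v : `|nrm2 (v *m K) - \sum_j lam (lead_idx mp j) * (v *m y^T) 0 j ^+ 2 -
    tail_mean * nrm2 v| <= theta * nrm2 v.
  rewrite split_energy normrM ger0_norm ?invr_ge0 ?(ltW nR)//.
  by rewrite ler_pdivrMl// mulrA.
have hG' i k : `|(y *m y^T) i k - (i == k)%:R| <= eta by rewrite gramE.
have h := eig_perturb d0 d1 e0 ed (fun i => lam0 (lead_idx mp i)) gap hG' hK tm0 t0
  (j := j) (k := lead_idx mp j) erefl.
rewrite -sample_cov_gram gramE/= in h.
have l0 := lam0 (lead_idx mp j); move: (lam (lead_idx mp j)) l0 h => lj l0 h.
move: (lead_gram j j) (eigvals _)`_j tail_mean h => g la t h.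
rewrite (_ : la / lj - g - t / lj = (la - lj * g - t) / lj); last by field; rewrite gt_eqF.
rewrite normrM (gtr0_norm (x := lj^-1)) ?invr_gt0// ler_pdivrMr// mulrDl divfK ?gt_eqF//.
by rewrite mulrAC.
Qed.

End spiked_decomposition.

Section clip.
Context {R : realType}.

(** Truncation to [[-r, r]]. The clipped part is small everywhere and not just on a good event, so
    the vector left after removing the excess is deterministically close to the normalized sums, as
    [clt_vector] asks. *)
Definition clip (r x : R) : R := Num.max (- r) (Num.min r x).

Lemma clip_le (r x : R) : 0 <= r -> `|clip r x| <= r.
Proof.
move=> r0; rewrite ler_norml /clip le_max lexx/= ge_max ge_min lexx/= andbT.
by rewrite lerNl; lra.
Qed.

Lemma clip_dist (r x b : R) : 0 <= r -> 0 <= b -> `|x| <= b + r -> `|x - clip r x| <= b.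
Proof.
move=> r0 b0; rewrite /clip !ler_norml => /andP[h1 h2].
by case: (leP r x) => h3; case: (leP (- r)) => h4; apply/andP; split; lra.
Qed.

Lemma measurable_clip (r : R) d (T : measurableType d) (f : T -> R) :
  measurable_fun setT f -> measurable_fun setT (fun w => clip r (f w)).
Proof.
by move=> mf; apply: measurable_maxr; [exact: measurable_cst|apply: measurable_minr].
Qed.

End clip.

Section spiked_model.
Context {R : realType} {d e} {T : measurableType d} {S : measurableType e}
  (P : probability T R) (Q : probability S R).
Variables (n p m : nat) (mp : (m < p)%N) (np : (n < p)%N).
Variables (Y : 'I_n -> {RV P >-> 'cV[R]_p}) (Gamma : 'M[R]_p) (lam : 'I_p -> R).
Variables (Z : {RV Q >-> 'cV[R]_p}) (C : R).
Hypothesis C0 : 0 < C.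
Hypothesis lam0 : forall k, 0 < lam k.

Let U (i : 'I_n) w :=
  diag_mx (\row_j (Num.sqrt (lam j))^-1) *m Gamma^T *m Y i w.

Hypothesis iU : iid P U.
Hypothesis UZ : forall i, same_law P Q (U i) Z.
Hypothesis iZ : independent_family Q (fun (j : 'I_p) w => Z w j 0).
Hypothesis EZ : forall j : 'I_p, ('E_Q[(fun w => Z w j 0)%R] = 0)%E.
Hypothesis VZ : forall j : 'I_p, ('V_Q[(fun w => Z w j 0)%R] = 1)%E.
Hypothesis sZ : forall j : 'I_p, (psi2_norm Q (fun w => Z w j 0)%R <= C%:E)%E.

Let mZ : measurable_fun setT Z. Proof. by []. Qed.
Let mZk k : measurable_fun setT (fun w => Z w k 0).
Proof. exact: measurable_entry. Qed.

Let mulmx_measurable (A : 'M[R]_p) i : measurable_fun setT (fun w => A *m Y i w).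
Proof.
apply: measurable_mxP => k l.
rewrite (_ : (fun w => _) = fun w => \sum_j A k j * Y i w j l).
  apply: measurable_sum => j; apply: measurable_funM; first exact: measurable_cst.
  exact: measurable_entry.
by apply/funext => w; rewrite mxE.
Qed.

Let mU i : measurable_fun setT (U i).
Proof. exact: mulmx_measurable. Qed.

Definition std_entry : 'I_n * 'I_p -> T -> R := entry U.
Local Notation z := std_entry.

Lemma std_entry_measurable x : measurable_fun setT (z x).
Proof. exact: entry_measurable. Qed.

Lemma std_entry_indep : independent_family P z.
Proof. exact: (entry_indep iU.1 UZ iZ). Qed.

Lemma std_entryE i k w : ((Gamma)^T *m Y i w) k 0 = Num.sqrt (lam k) * z (i, k) w.
Proof.
rewrite /std_entry /entry /U -mulmxA mul_diag_mx [in RHS]mxE [in RHS]mxE.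
by rewrite mulVKf// gt_eqF// sqrtr_gt0.
Qed.

Lemma std_entry_mean (f : R -> R) x : measurable_fun setT f ->
  intg Q (fun w => f (Z w x.2 0)) ->
  intg P (fun w => f (z x w)) /\
  mean P (fun w => f (z x w)) = mean Q (fun w => f (Z w x.2 0)).
Proof. exact: (entry_mean mU mZ UZ). Qed.

Let mpow k : measurable_fun setT (fun x : R => x ^+ k).
Proof. exact: measurable_funX. Qed.

Let zpow k x (k6 : (k <= 6)%N) :=
  std_entry_mean (x := x) (mpow k) (std_intg_pow C0 (mZk x.2) (sZ x.2) k6).

Lemma std_entry_mgf x : mgf_le P (z x) (5 / sq_rate C).
Proof.
have [i1 m1] := @zpow 1 x isT.
have me : measurable_fun setT (fun y : R => expR (sq_rate C * y ^+ 2)).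
  apply: measurableT_comp; first exact: measurable_expR.
  by apply: measurable_funM; [exact: measurable_cst|exact: measurable_funX].
have [iE hE] := exp_sq_psi2 C0 (mZk x.2) (sZ x.2).
have [i2 m2] := std_entry_mean (x := x) me iE.
apply: mgf_of_exp_sq => //; first exact: sq_rate_gt0.
  by apply: etrans m1 _; apply: std_mean1; exact: EZ.
by rewrite m2.
Qed.

Let B := pow6_bound C.

Lemma pow6_bound_ge0 : 0 <= B.
Proof.
have a0 := sq_rate_gt0 C0.
by rewrite /B /pow6_bound addr_ge0// divr_ge0// exprn_ge0// ltW.
Qed.

Definition sq_entry (x : 'I_n * 'I_m) w : R := z (x.1, lead_idx mp x.2) w ^+ 2 - 1.

Lemma sq_entry_indep : independent_family P sq_entry.
Proof.
have inj : injective (fun x : 'I_n * 'I_m => (x.1, lead_idx mp x.2)).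
  by move=> [i j] [k l] [-> h]; congr (_, _); apply/val_inj.
apply: (independent_sub (X := fun x w => z x w ^+ 2 - 1) inj).
apply: (indep_blocks (g := id) std_entry_measurable std_entry_indep) => x.
apply: measurable_funB => //; apply: measurable_funX.
exact: (gen_sigma_fun (J := [set y | y = x]) erefl).
Qed.

Lemma sq_entry_measurable x : measurable_fun setT (sq_entry x).
Proof.
by apply: measurable_funB => //; apply: measurable_funX; exact: std_entry_measurable.
Qed.

Let msq : measurable_fun setT (fun y : R => y ^+ 2 - 1).
Proof. by apply: measurable_funB => //; exact: measurable_funX. Qed.

Lemma sq_entry_moments x :
  [/\ intg P (sq_entry x), mean P (sq_entry x) = 0,
   intg P (fun w => sq_entry x w ^+ 2) &
   mean P (fun w => sq_entry x w ^+ 2) =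
     kurtosis Q (fun w => Z w (lead_idx mp x.2) 0) - 1].
Proof.
set k := lead_idx mp x.2.
have i2 := std_intg_pow C0 (mZk k) (sZ k) (isT : (2 <= 6)%N).
have [h1 h2] := std_entry_mean (x := (x.1, k)) msq (intgB i2 (intg_cst Q 1)).
have [j1 j2] := std_sq_sq C0 (mZk k) (EZ k) (VZ k) (sZ k).
have [h3 h4] := std_entry_mean (x := (x.1, k)) (f := fun y => (y ^+ 2 - 1) ^+ 2)
  (measurable_funX 2 msq) j1.
split => //; first by apply: etrans h2 _; exact: (std_sq_mean C0 (mZk k) (EZ k) (VZ k) (sZ k)).
by apply: etrans h4 _.
Qed.

Lemma sq_entry_cube x : intg P (fun w => `|sq_entry x w| ^+ 3) /\
  mean P (fun w => `|sq_entry x w| ^+ 3) <= 4 * B.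
Proof.
set k := lead_idx mp x.2.
have [j1 j2] := std_sq_cube C0 (mZk k) (sZ k).
have mf : measurable_fun setT (fun y : R => `|y ^+ 2 - 1| ^+ 3).
  by apply: measurable_funX; apply: measurableT_comp; first exact: normr_measurable.
have [h3 h4] := std_entry_mean (x := (x.1, k)) mf j1.
by split => //; rewrite h4.
Qed.

(** Follows from [u^2 <= u^3 + 1] for [u >= 0]; it provides the uniform bound on the limit
    variances. *)
Lemma kurtosis_bounds (j : 'I_p) :
  0 <= kurtosis Q (fun w => Z w j 0) - 1 <= 4 * B + 1.
Proof.
have [j1 j2] := std_sq_sq C0 (mZk j) (EZ j) (VZ j) (sZ j).
have [k1 k2] := std_sq_cube C0 (mZk j) (sZ j).
rewrite -j2; apply/andP; split; first by apply: mean_ge0 => w; exact: sqr_ge0.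
apply: le_trans (_ : mean Q (fun w => `|Z w j 0 ^+ 2 - 1| ^+ 3 + 1) <= _).
  apply: mean_le => // [|w]; first by apply: intgD => //; exact: intg_cst.
  rewrite -real_normK ?num_real//; move: `|_| (normr_ge0 (Z w j 0 ^+ 2 - 1)) => u u0.
  by have [u1|u1] := leP u 1; nra.
by rewrite meanD ?mean_cst ?lerD2r//; exact: intg_cst.
Qed.

Definition lamhat (k : nat) w : R :=
  (eigvals (sample_cov (fun i : 'I_n => Gamma^T *m Y i w)))`_k.

Lemma lamhat_measurable (k : nat) : (k < p)%N -> measurable_fun setT (lamhat k).
Proof.
move=> kp; apply: (@measurable_eigvals _ _ _ _
  (fun w => sample_cov (fun i : 'I_n => Gamma^T *m Y i w)) (Ordinal kp)) => [i j|w].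
  rewrite (_ : (fun w => _) = fun w => n%:R^-1 * \sum_l
      (Gamma^T *m Y l w) i 0 * (Gamma^T *m Y l w) j 0).
    apply: measurable_funM; first exact: measurable_cst.
    apply: measurable_sum => l; apply: measurable_funM; apply: measurable_entry;
      exact: mulmx_measurable.
  apply/funext => w; rewrite /sample_cov mxE [X in _ * X]mxE; congr (_ * _).
  by apply: eq_bigr => l _; rewrite [X in X * _]mxE [X in X * _]mxE [X in _ * X]mxE.
by rewrite /sample_cov linearZ/= trmx_mul trmxK.
Qed.

Definition eig_rem (j : 'I_m) w : R :=
  lamhat j w / lam (lead_idx mp j) - lead_gram mp z w j j -
  tail_mean m n lam / lam (lead_idx mp j).

Lemma eig_rem_measurable j : measurable_fun setT (eig_rem j).
Proof.
apply: measurable_funB; last exact: measurable_cst.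
apply: measurable_funB.
  apply: measurable_funM; last exact: measurable_cst.
  by apply: lamhat_measurable; exact: ltn_trans (ltn_ord j) mp.
apply: measurable_funM; first exact: measurable_cst.
apply: measurable_sum => i; apply: measurable_funM; exact: std_entry_measurable.
Qed.

Definition noise_const : R := 3 * opnorm_const (5 / sq_rate C) C.

Lemma noise_const_ge0 : 0 <= noise_const.
Proof.
have a0 := sq_rate_gt0 C0.
by rewrite /noise_const mulr_ge0// opnorm_const_ge0// divr_ge0// ltW.
Qed.

Lemma good_event (delta eta : R) : (0 < n)%N -> 0 < eta ->
  0 < delta -> delta <= 1 -> 2 * eta * (m%:R + 2) <= delta ->
  (forall k : 'I_p, (m <= k)%N -> lam k <= C) ->
  (forall i k : 'I_m, (i < k)%N ->
    lam (lead_idx mp k) <= (1 - delta) * lam (lead_idx mp i)) ->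
  exists A : set T, [/\ measurable A,
    (P A <= (2 / 2 ^+ n + (m * m)%:R * ((2 * B + 2) / (n%:R * eta ^+ 2)))%:E)%E &
    forall w, ~ A w -> forall j, `|eig_rem j w| <=
      noise_const * ((lam (lead_idx mp j))^-1 * Num.sqrt (p%:R / n%:R)) +
      4 * m%:R / delta * eta ^+ 2].
Proof.
move=> n0 eta0 d0 d1 ed lamC gap.
have m4 x : mean P (fun w => z x w ^+ 4) <= B.
  by rewrite (@zpow 4 x isT).2; apply: std_mean4.
have m1 x : mean P (z x) = 0.
  by apply: etrans (@zpow 1 x isT).2 _; apply: std_mean1; exact: EZ.
have m2 x : mean P (fun w => z x w ^+ 2) = 1.
  by rewrite (@zpow 2 x isT).2; apply: std_mean2; [exact: EZ|exact: VZ].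
have i1 x : intg P (z x) := (@zpow 1 x isT).1.
have i2 x := (@zpow 2 x isT).1.
have i4 x := (@zpow 4 x isT).1.
have inj : injective (lead_idx mp) by move=> j k /(congr1 val) h; apply/val_inj.
have [A1 [mA1 PA1 hA1]] := gram_event std_entry_measurable std_entry_indep i1 i2 i4
  m1 m2 m4 pow6_bound_ge0 inj n0 eta0.
have a0 := sq_rate_gt0 C0.
have K0 : 0 <= 5 / sq_rate C by rewrite divr_ge0// ltW.
have tw k : 0 <= tail_weight m lam k <= C.
  rewrite /tail_weight; case: ltnP => [_|mk]; first by rewrite lexx ltW.
  by rewrite (ltW (lam0 k)) lamC.
have [A2 [mA2 PA2 hA2]] := noise_opnorm std_entry_measurable std_entry_indep i1 m1 i2 m2
  K0 C0 std_entry_mgf tw n0 (ltnW np).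
exists (A2 `|` A1); split; first exact: measurableU.
  apply: le_trans (measureU2 P mA2 mA1) _.
  by rewrite EFinD; exact: leeD.
move=> w /not_orP[/hA2 h2 /hA1 h1] j.
pose theta := n%:R^-1 * (3 * (opnorm_const (5 / sq_rate C) C * Num.sqrt (n%:R * p%:R))).
have nR : 0 < n%:R :> R by rewrite ltr0n.
have pR : 0 < p%:R :> R by rewrite ltr0n (leq_ltn_trans _ np).
have nt : n%:R * theta = 3 * (opnorm_const (5 / sq_rate C) C * Num.sqrt (n%:R * p%:R)).
  by rewrite /theta mulVKf// gt_eqF.
have sE : n%:R^-1 * Num.sqrt (n%:R * p%:R) = Num.sqrt (p%:R / n%:R) :> R.
  rewrite -[X in X * _]ger0_norm ?invr_ge0 ?(ltW nR)// -sqrtr_sqr -sqrtrM ?sqr_ge0//.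
  by congr Num.sqrt; field; rewrite gt_eqF.
have thE : theta = noise_const * Num.sqrt (p%:R / n%:R).
  by rewrite -sE /theta /noise_const; ring.
(* Nonnegativity is read off the noise bound at a unit vector. *)
have th0 : 0 <= theta.
  pose v : 'rV[R]_n := delta_mx 0 (Ordinal n0).
  have := le_trans (normr_ge0 _) (h2 v); rewrite nrm2_delta mulr1 -nt.
  by rewrite pmulr_rge0.
have := spiked_eigenvalue (w := w) (x := fun i => Gamma^T *m Y i w) (z := z) (mp := mp)
  n0 lam0 (fun i k => std_entryE i k w) j d0 d1 (ltW eta0) ed th0 gap h1.
rewrite nt => /(_ h2) h; apply: le_trans h _.
by rewrite lerD2r thE mulrCA mulrC mulrA.
Qed.

(** Here [h] is the part of [eig_rem] withheld from the remainder, later its clipped part. Beyond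
    the normalized sum only [h] and a deterministic bias are left. *)
Lemma fluctuation_split (j : 'I_m) (cbar h : R) w : (0 < n)%N ->
  Num.sqrt n%:R * (lamhat j w / lam (lead_idx mp j) -
    (1 + cbar * (p%:R / (n%:R * lam (lead_idx mp j))) + (eig_rem j w - h))) -
  nsum (fun i => sq_entry (i, j)) w =
  Num.sqrt n%:R * h + Num.sqrt n%:R * (tail_mean m n lam / lam (lead_idx mp j) -
    cbar * (p%:R / (n%:R * lam (lead_idx mp j)))).
Proof.
move=> n0; have nR : 0 < n%:R :> R by rewrite ltr0n.
have [q q0 qE] : exists2 q : R, 0 < q & Num.sqrt n%:R = q by exists (Num.sqrt n%:R); rewrite ?sqrtr_gt0.
have q2 : n%:R = q ^+ 2 by rewrite -qE sqr_sqrtr// ltW.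
have -> : nsum (fun i => sq_entry (i, j)) w = q * (lead_gram mp z w j j - 1).
  rewrite /nsum qE /sq_entry /lead_gram sumrB sumr_const card_ord -[X in _ - X]mulr_natl.
  rewrite mulr1 q2; under [in RHS]eq_bigr do rewrite -expr2.
  by move: (\sum_i _) => u; field; rewrite gt_eqF.
by rewrite qE /eig_rem; ring.
Qed.

(** The bias has two sources: the average of the small eigenvalues differs from [cbar], and it runs
    over [p - m] rather than [p] indices, which costs [m |cbar| / n]. Both are scaled by the bound
    [K] on [c_j]. *)
Lemma tail_bias (j : 'I_m) (cbar K : R) : (0 < n)%N ->
  p%:R / (n%:R * lam (lead_idx mp j)) <= K ->
  `|tail_mean m n lam / lam (lead_idx mp j) - cbar * (p%:R / (n%:R * lam (lead_idx mp j)))|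
  <= K * (`|(p - m)%:R^-1 * (\sum_(k < p | (m <= k)%N) lam k) - cbar| + m%:R * `|cbar| / n%:R).
Proof.
move=> n0 hK; have nR : 0 < n%:R :> R by rewrite ltr0n.
have pR : 0 < p%:R :> R by rewrite ltr0n (leq_ltn_trans _ np).
have pmR : 0 < (p - m)%:R :> R by rewrite ltr0n subn_gt0.
have npR : n%:R <= p%:R :> R by rewrite ler_nat ltnW.
have l0 := lam0 (lead_idx mp j); set lj := lam _ in l0 hK *.
set s := _ - cbar.
have -> : tail_mean m n lam = n%:R^-1 * ((p - m)%:R * (s + cbar)).
  rewrite /s subrK mulVKf ?gt_eqF// /tail_mean; congr (_ * _).
  rewrite [RHS]big_mkcond; apply: eq_bigr => k _.
  by rewrite /tail_weight ltnNge; case: (m <= k)%N.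
rewrite natrB ?(ltnW mp)//; rewrite natrB ?(ltnW mp)// in pmR.
set u := (n%:R * lj)^-1; have u0 : 0 < u by rewrite invr_gt0 mulr_gt0.
have -> : n%:R^-1 * ((p%:R - m%:R) * (s + cbar)) / lj - cbar * (p%:R * u) =
    u * ((p%:R - m%:R) * s - m%:R * cbar).
  by rewrite /u; field; rewrite !gt_eqF.
rewrite normrM (gtr0_norm u0).
have m0 : 0 <= m%:R :> R by [].
have h1 : `|(p%:R - m%:R) * s - m%:R * cbar| <= p%:R * `|s| + m%:R * `|cbar|.
  apply: le_trans (ler_normB _ _) _; rewrite !normrM (gtr0_norm pmR) (ger0_norm m0).
  by rewrite lerD2r ler_wpM2r// lerBlDr lerDl.
apply: le_trans (ler_wpM2l (ltW u0) h1) _.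
have hK' : p%:R * u <= K by [].
have K0 : 0 <= K by apply: le_trans hK'; rewrite mulr_ge0 ?(ltW u0) ?(ltW pR).
have uK : u <= K / n%:R.
  rewrite ler_pdivlMr//; apply: le_trans hK'; rewrite mulrC ler_wpM2r//; exact: ltW.
have c1 : 0 <= m%:R * `|cbar| by rewrite mulr_ge0.
have -> : u * (p%:R * `|s| + m%:R * `|cbar|) = p%:R * u * `|s| + u * (m%:R * `|cbar|).
  by ring.
have -> : K * (`|s| + m%:R * `|cbar| / n%:R) = K * `|s| + K / n%:R * (m%:R * `|cbar|).
  by field; rewrite gt_eqF.
by apply: lerD; apply: ler_wpM2r.
Qed.

End spiked_model.

Theorem theorem3p1 (R : realType) (m : nat) (m_gt0 : (0 < m)%N)
  (p : nat -> nat) (np : forall n, (n < p n)%N) (mp : forall n, (m < p n)%N)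
  (d : nat -> measure_display) (T : forall n, measurableType (d n))
  (P : forall n, probability (T n) R)
  (Y : forall n, 'I_n -> {RV (P n) >-> 'cV[R]_(p n)})
  (Sigma Gamma : forall n, 'M[R]_(p n)) (lam : forall n, 'I_(p n) -> R)
  (e : nat -> measure_display) (S : forall n, measurableType (e n))
  (Q : forall n, probability (S n) R)
  (Z : forall n, {RV (Q n) >-> 'cV[R]_(p n)})
  (c0 C0 delta0 cbar : R)
  (c0_gt0 : 0 < c0) (C0_gt0 : 0 < C0) (delta0_gt0 : 0 < delta0)
  (Y_iid : forall n, iid (P n) (fun i : 'I_n => Y n i : T n -> 'cV[R]_(p n)))
  (Y_mean : forall n (i : 'I_n) (j : 'I_(p n)),
    ('E_(P n)[(fun w => Y n i w j 0)%R] = 0)%E)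
  (Y_cov : forall n (i : 'I_n) (j k : 'I_(p n)),
    covariance (P n) (fun w => Y n i w j 0) (fun w => Y n i w k 0)
      = (Sigma n j k)%:E)
  (Gamma_orth : forall n, (Gamma n)^T *m Gamma n = 1%:M)
  (Sigma_spectral : forall n,
    Sigma n = Gamma n *m diag_mx (\row_j lam n j) *m (Gamma n)^T)
  (lam_sorted : forall n (j k : 'I_(p n)), (j <= k)%N -> lam n k <= lam n j)
  (lam_strict : forall n (j k : 'I_(p n)),
    (j < m)%N -> (j < k)%N -> lam n k < lam n j)
  (lam_gt0 : forall n (j : 'I_(p n)), 0 < lam n j)
  (lam_bounds : forall n (j : 'I_(p n)), (m <= j)%N -> c0 <= lam n j <= C0)
  (lam_gap : forall n (j k : 'I_(p n)), (j < m)%N -> k = j.+1 :> nat ->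
    delta0 <= (lam n j - lam n k) / lam n j)
  (c_bounded : forall j : 'I_m, exists K : R, forall n,
    (p n)%:R / (n%:R * lam n (lead_idx (mp n) j)) <= K)
  (lam_mean :
    (fun n => (p n - m)%:R^-1 * (\sum_(j < p n | (m <= j)%N) lam n j) - cbar
       : R^o) =o_\oo (fun n => n%:R `^ (- 2^-1) : R^o))
  (std_iid : forall n, iid (P n) (fun (i : 'I_n) w =>
    diag_mx (\row_j (Num.sqrt (lam n j))^-1) *m (Gamma n)^T *m Y n i w))
  (std_law : forall n (i : 'I_n), same_law (P n) (Q n)
    (fun w => diag_mx (\row_j (Num.sqrt (lam n j))^-1)
                *m (Gamma n)^T *m Y n i w) (Z n))
  (Z_indep : forall n,
    independent_family (Q n) (fun (j : 'I_(p n)) w => Z n w j 0))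
  (Z_mean : forall n (j : 'I_(p n)), ('E_(Q n)[(fun w => Z n w j 0)%R] = 0)%E)
  (Z_var : forall n (j : 'I_(p n)), ('V_(Q n)[(fun w => Z n w j 0)%R] = 1)%E)
  (Z_subgaussian : forall n (j : 'I_(p n)),
    (psi2_norm (Q n) (fun w => Z n w j 0)%R <= C0%:E)%E) :
  exists Rem : forall n, 'I_m -> {RV (P n) >-> R},
    (forall j : 'I_m, is_OP P (fun n => Rem n j)
       (fun n => (lam n (lead_idx (mp n) j))^-1
                   * Num.sqrt ((p n)%:R / n%:R))) /\
    asymp_indep_normal P
      (fun n w => \col_(j < m)
         let lamj := lam n (lead_idx (mp n) j) in
         let cj := (p n)%:R / (n%:R * lamj) in
         let lamhat :=
           eigvals (sample_cov (fun i : 'I_n => (Gamma n)^T *m Y n i w)) in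
         Num.sqrt n%:R * (lamhat`_j / lamj - (1 + cbar * cj + Rem n j w)))
      (fun n j =>
         kurtosis (Q n) (fun w => Z n w (lead_idx (mp n) j) 0) - 1).
Proof.
(* The perturbation bound wants a gap parameter at most [1], hence the minimum of [delta0] and
   [1]. *)
have [delta [dl0 dl1 dld]] : exists delta, [/\ 0 < delta, delta <= 1 & delta <= delta0].
  by exists (Num.min delta0 1); split; rewrite ?lt_min ?delta0_gt0 ?ltr01// ge_min lexx ?orbT.
(* The relative gap between [i] and [i + 1], extended to all [k > i] by monotonicity of [lam]. *)
have gap n (i k : 'I_m) : (i < k)%N ->
    lam n (lead_idx (mp n) k) <= (1 - delta) * lam n (lead_idx (mp n) i).
  move=> ik; have i1p : (i.+1 < p n)%N by apply: leq_ltn_trans ik (ltn_trans (ltn_ord k) (mp n)).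
  apply: le_trans (lam_sorted n (Ordinal i1p) (lead_idx (mp n) k) ik) _.
  have := lam_gap n (lead_idx (mp n) i) (Ordinal i1p) (ltn_ord i) erefl.
  have l0 := lam_gt0 n (lead_idx (mp n) i).
  by rewrite ler_pdivlMr// => h; nra.
have lamC n (k : 'I_(p n)) : (m <= k)%N -> lam n k <= C0.
  by move=> mk; have /andP[] := lam_bounds n k mk.
pose x n : R := root8 n.
have x1 n : 1 <= x n by exact: root8_ge1.
have x0 n : 0 < x n by apply: lt_le_trans (x1 n).
have xi1 n : (x n)^-1 <= 1 by rewrite invf_le1.
have xi0 n : 0 < (x n)^-1 by rewrite invr_gt0.
have x4 n : (0 < n)%N -> Num.sqrt n%:R = x n ^+ 4 by move=> n0; rewrite root8_pow4.
have x8 n : (0 < n)%N -> n%:R = x n ^+ 8.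
  by move=> n0; rewrite -[8%N]/(4 * 2)%N exprM -x4// sqr_sqrtr.
have xpow n k : (0 < k)%N -> (x n)^-1 ^+ k <= (x n)^-1.
  by case: k => // k _; rewrite exprS ler_piMr ?exprn_ile1// ltW.
have CdE : 0 <= 4 * m%:R / delta by rewrite divr_ge0 ?mulr_ge0// ltW.
have [Cd Cd0 CdE'] : exists2 Cd, 0 <= Cd & Cd = 4 * m%:R / delta.
  by exists (4 * m%:R / delta).
(* rho n = Cd n^(-3/4): the part of D below this level is not put into Rem, as
   sqrt n * rho n -> 0, while the quadratic term Cd eta^2 of good_event is at
   most rho n for eta = n^(-3/8). *)
pose rho n := Cd * (x n)^-1 ^+ 6.
have rho0 n : 0 <= rho n by rewrite mulr_ge0// exprn_ge0// ltW.
pose D n j := eig_rem (mp n) (Y n) (Gamma n) (lam n) j.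
have mD n j : measurable_fun setT (D n j) by exact: eig_rem_measurable.
have mRem n j : measurable_fun setT (fun w => D n j w - clip (rho n) (D n j w)).
  by apply: measurable_funB => //; exact: measurable_clip.
pose Rem n j : {RV (P n) >-> R} :=
  MeasurableFun.Pack (MeasurableFun.Class (isMeasurableFun.Build _ _ _ _ _ (mRem n j))).
pose B := pow6_bound C0.
have B0 : 0 <= B by exact: pow6_bound_ge0.
exists Rem; split.
  move=> j eps eps0; exists (noise_const C0).
  (* Up to the factor [1 / x n] this bounds the probability in [good_event], since [2^n >= n >= x n]
     and [n eta^2 = (x n)^2]. *)
  pose c := 2 + (m * m)%:R * (2 * B + 2).
  have cpos : 0 < c by rewrite /c ltr_wpDr// mulr_ge0//; lra.
  have m2 : 0 < 2 * (m%:R + 2) :> R by rewrite mulr_gt0// ltr_wpDl.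
  near=> n.
  have n0 : (0 < n)%N by near: n; exact: nbhs_infty_gt.
  have h1 : (x n)^-1 <= delta / (2 * (m%:R + 2)).
    by near: n; apply: root8_inv_small; rewrite divr_gt0.
  have h2 : (x n)^-1 <= eps / c by near: n; apply: root8_inv_small; rewrite divr_gt0.
  (* The exponent [-3/8] lies between [-1/2] and [-1/4]: Chebyshev's inequality needs [n eta^2] to
     diverge, the quadratic error needs [sqrt n * eta^2] to vanish. *)
  pose eta := (x n)^-1 ^+ 3.
  have eta0 : 0 < eta by rewrite exprn_gt0.
  have ed : 2 * eta * (m%:R + 2) <= delta.
    have h3 : eta <= delta / (2 * (m%:R + 2)) by apply: le_trans h1; exact: xpow.
    by rewrite mulrAC mulrC -ler_pdivlMr.
  have [A [mA PA hA]] := good_event (np n) C0_gt0 (lam_gt0 n) (std_iid n) (std_law n)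
    (Z_indep n) (Z_mean n) (Z_var n) (Z_subgaussian n) n0 eta0 dl0 dl1 ed (lamC n) (gap n).
  have PAe : (P n A <= eps%:E)%E.
    apply: (le_trans PA); rewrite lee_fin.
    have e1 : 2 / 2 ^+ n <= 2 * (x n)^-1.
      rewrite ler_pM2l// lef_pV2 ?posrE ?exprn_gt0//.
      apply: (@le_trans _ _ (n%:R : R)); last by rewrite -natrX ler_nat ltnW// ltn_expl.
      by rewrite x8// -[leLHS]expr1 ler_weXn2l.
    have e2 : (m * m)%:R * ((2 * B + 2) / (n%:R * eta ^+ 2)) <=
        (m * m)%:R * (2 * B + 2) * (x n)^-1.
      rewrite mulrA; apply: ler_wpM2l; first by rewrite mulr_ge0//; lra.
      rewrite (_ : (n%:R * eta ^+ 2)^-1 = (x n)^-1 ^+ 2); first exact: xpow.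
      by rewrite /eta x8//; field; rewrite gt_eqF.
    apply: (le_trans (lerD e1 e2)); rewrite -mulrDl -/c.
    by rewrite mulrC -ler_pdivlMr.
  apply: le_trans PAe; apply: prob_le => //.
    have mn : measurable_fun setT (fun w => `|Rem n j w|).
      by apply: measurableT_comp => //; exact: mRem.
    rewrite (_ : [set _ | _] = (fun w => `|Rem n j w|) @^-1`
      `](noise_const C0 * ((lam n (lead_idx (mp n) j))^-1 * Num.sqrt ((p n)%:R / n%:R))), +oo[%classic).
      by rewrite -[_ @^-1` _]setTI; exact: mn.
    by apply/seteqP; split => w /=; rewrite in_itv/= andbT.
  move=> w /= hw; apply: contrapT => nA.
  have := hA w nA j; rewrite -CdE' (_ : Cd * eta ^+ 2 = rho n); last first.
    by rewrite /rho /eta -exprM.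
  move=> hD; move: hw; apply/negP; rewrite -leNgt; apply: clip_dist => //.
  have := le_trans (normr_ge0 _) hD; rewrite -/(D n j).
  have nc0 : 0 <= noise_const C0 by exact: (noise_const_ge0 C0_gt0).
  by move=> _; rewrite mulr_ge0// mulr_ge0 ?sqrtr_ge0// invr_ge0 ltW.
(* One bound for all [j], as [c_bounded] gives a constant for each [j] separately. *)
pose Kc := \sum_(j < m) `|projT1 (cid (c_bounded j))|.
pose es n := (p n - m)%:R^-1 * (\sum_(j < p n | (m <= j)%N) lam n j) - cbar.
(* The deterministic distance to the normalized sums: [sqrt n * rho n] for the clipped part, then
   [sqrt n] times the two terms of [tail_bias]. *)
pose r n := Cd * (x n)^-1 + Kc * (Num.sqrt n%:R * `|es n| + m%:R * `|cbar| * (x n)^-1).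
have Kc0 : 0 <= Kc by apply: sumr_ge0.
have cK n j : (p n)%:R / (n%:R * lam n (lead_idx (mp n) j)) <= Kc.
  apply: le_trans (projT2 (cid (c_bounded j)) n) _.
  by apply: le_trans (ler_norm _) _; rewrite /Kc (bigD1 j)//= lerDl sumr_ge0.
have c1 : 0 <= m%:R * `|cbar| by rewrite mulr_ge0.
apply: (@clt_vector R m d T P (fun n => sq_entry (mp n) (Y n) (Gamma n) (lam n)) _
  (4 * B + 1) (4 * B) _ r).
- by move=> n ij; exact: sq_entry_measurable.
- by move=> n; exact: sq_entry_indep (std_iid n) (std_law n) (Z_indep n).
- by move=> n ij; have [] := sq_entry_moments (mp n) C0_gt0 (std_law n) (Z_mean n) (Z_var n) (Z_subgaussian n) ij.
- by move=> n ij; have [] := sq_entry_moments (mp n) C0_gt0 (std_law n) (Z_mean n) (Z_var n) (Z_subgaussian n) ij.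
- by move=> n ij; have [] := sq_entry_cube (mp n) C0_gt0 (std_law n) (Z_subgaussian n) ij.
- by move=> n ij; have [] := sq_entry_moments (mp n) C0_gt0 (std_law n) (Z_mean n) (Z_var n) (Z_subgaussian n) ij.
- by move=> n i j; have [] := sq_entry_moments (mp n) C0_gt0 (std_law n) (Z_mean n) (Z_var n) (Z_subgaussian n) (i, j).
- by move=> n ij; have [] := sq_entry_cube (mp n) C0_gt0 (std_law n) (Z_subgaussian n) ij.
- by rewrite mulr_ge0.
- by move=> n j; have /andP[] := kurtosis_bounds C0_gt0 (Z_mean n) (Z_var n) (Z_subgaussian n) (lead_idx (mp n) j).
- by move=> n j; have /andP[] := kurtosis_bounds C0_gt0 (Z_mean n) (Z_var n) (Z_subgaussian n) (lead_idx (mp n) j).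
- move=> n j; rewrite (_ : (fun w => _) = fun w => Num.sqrt n%:R *
    (lamhat (Y n) (Gamma n) j w / lam n (lead_idx (mp n) j) -
     (1 + cbar * ((p n)%:R / (n%:R * lam n (lead_idx (mp n) j))) + Rem n j w))).
    apply: measurable_funM; first exact: measurable_cst.
    apply: measurable_funB; last by apply: measurable_funD; [exact: measurable_cst|exact: mRem].
    apply: measurable_funM; last exact: measurable_cst.
    by apply: lamhat_measurable; exact: ltn_trans (ltn_ord j) (mp n).
  by apply/funext => w; rewrite mxE.
- move=> ep ep0.
  pose c := Cd + Kc * (m%:R * `|cbar|) + 1.
  have cpos : 0 < c by rewrite ltr_wpDl// addr_ge0// mulr_ge0.
  have K1 : 0 < 2 * (Kc + 1) by rewrite mulr_gt0// ltr_wpDl.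
  have es0 : 0 < ep / (2 * (Kc + 1)) by rewrite divr_gt0.
  near=> n.
  have n0 : (0 < n)%N by near: n; exact: nbhs_infty_gt.
  have h1 : (x n)^-1 <= ep / (2 * c).
    by near: n; apply: root8_inv_small; rewrite divr_gt0// mulr_gt0.
  have h2 : `|es n| <= ep / (2 * (Kc + 1)) * `|n%:R `^ (- 2^-1)|.
    by near: n; have /eqoP := lam_mean; apply.
  have q0 : 0 < Num.sqrt n%:R :> R by rewrite sqrtr_gt0 ltr0n.
  have qes : Num.sqrt n%:R * `|es n| <= ep / (2 * (Kc + 1)).
    have qi : 0 <= (Num.sqrt n%:R)^-1 :> R by rewrite invr_ge0 ltW.
    move: h2; rewrite powRN powR12_sqrt// (ger0_norm qi).
    by rewrite ler_pdivlMr// mulrC.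
  apply: (@le_trans _ _ (c * (x n)^-1 + (Kc + 1) * (Num.sqrt n%:R * `|es n|))).
    have qe0 : 0 <= Num.sqrt n%:R * `|es n| by rewrite mulr_ge0// ltW.
    have xx := xi0 n.
    by rewrite /r /c; move: (Num.sqrt _ * _) qe0 (m%:R * _) => a a0 b; nra.
  have h3 : c * (x n)^-1 <= ep / 2.
    by rewrite (_ : ep / 2 = c * (ep / (2 * c))) ?ler_pM2l//; field; rewrite gt_eqF.
  have h4 : (Kc + 1) * (Num.sqrt n%:R * `|es n|) <= ep / 2.
    have k1 : 0 < Kc + 1 by rewrite ltr_wpDl.
    by rewrite (_ : ep / 2 = (Kc + 1) * (ep / (2 * (Kc + 1)))) ?ler_pM2l//; field; rewrite gt_eqF.
  by lra.
- move=> n j w n0; rewrite mxE.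
  have -> := fluctuation_split (mp n) (Y n) (Gamma n) (lam n) j cbar (clip (rho n) (D n j w)) w n0.
  apply: le_trans (ler_normD _ _) _; apply: lerD.
    have x6 : x n ^+ 4 * rho n = Cd * (x n)^-1 ^+ 2.
      by rewrite /rho; field; rewrite gt_eqF.
    rewrite normrM ger0_norm ?sqrtr_ge0// x4//.
    apply: le_trans (_ : x n ^+ 4 * rho n <= _).
      by rewrite ler_wpM2l ?clip_le// exprn_ge0// ltW.
    by rewrite x6 ler_wpM2l// xpow.
  rewrite normrM ger0_norm ?sqrtr_ge0//.
  have q0 : 0 <= Num.sqrt n%:R :> R by rewrite sqrtr_ge0.
  have := tail_bias (np n) (lam_gt0 n) cbar n0 (cK n j).
  move=> /(ler_wpM2l q0) h; apply: (le_trans h).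
  rewrite -/(es n) mulrCA ler_wpM2l// mulrDr lerD2l.
  rewrite (_ : Num.sqrt n%:R * (m%:R * `|cbar| / n%:R) = m%:R * `|cbar| * (x n)^-1 ^+ 4).
    by rewrite ler_wpM2l// xpow.
  by rewrite x4// (x8 n n0); field; rewrite gt_eqF.
Unshelve. all: by end_near.
Qed.
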